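(* Let $(\xi_{i,j})_{i,j=1}^\infty$ be independent copies of a random variable $\xi$ with $\mathbb{E}\xi=0$ and $\mathbb{E}\xi^2=1$. For $d,i\in\mathbb{N}$ let $X_i^{(d)}:=(\xi_{i,1},\dots,\xi_{i,d})/\sqrt d\in\mathbb{R}^d$ and $S_k^{(d)}:=X_1^{(d)}+\dots+X_k^{(d)}$. Suppose that for some $\alpha\in(1,2)$, independent copies $\xi_1,\xi_2,\dots$ of $\xi$ satisfy $$\frac{\xi_1^2+\dots+\xi_m^2-m}{m^{1/\alpha}L(m)}\ \overset{w}{\longrightarrow}\ \zeta_\alpha\qquad(m\to\infty)$$ for some slowly varying function $L$ and a zero-mean random variable $\zeta_\alpha$ having a spectrally positive $\alpha$-stable distribution. Let $n=n(d)$ be a sequence of positive integers such that $n(d)\to\infty$ as $d\to\infty$. (a) If $n>d^{\frac{2-\alpha}{2\alpha-2}+\delta}$ for some $\delta>0$ and all sufficiently large $d$, then, as $d\to\infty$, $$\frac{\|S_n^{(d)}\|^2-n}{\sqrt{2n^2/d}}\ \overset{w}{\longrightarrow}\ \mathrm{N}(0,1).$$ (b) If $n<d^{\frac{2-\alpha}{2\alpha-2}-\delta}$ for some $\delta>0$ and all sufficiently large $d$, then, as $d\to\infty$, $$\frac{\|S_n^{(d)}\|^2-n}{d^{-1}(nd)^{1/\alpha}L(nd)}\ \overset{w}{\longrightarrow}\ \zeta_\alpha.$$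
   Context: $\|\cdot\|$ is the Euclidean norm, $\overset{w}{\longrightarrow}$ denotes convergence in distribution, and $\mathrm{N}(0,1)$ is the standard normal distribution. Slowly varying means (positive and) slowly varying at infinity in Karamata's sense: $L(cx)/L(x)\to1$ as $x\to\infty$ for every $c>0$. Spectrally positive means that the (non-degenerate) stable law has no negative jumps, i.e. its Lévy measure is concentrated on $(0,\infty)$. *)

(* Defs.v *)
From HB Require Import structures.
From mathcomp Require Import all_boot all_order all_algebra finmap.
From mathcomp Require Import all_classical all_reals all_analysis.

Set Implicit Arguments.
Unset Strict Implicit.
Unset Printing Implicit Defensive.

Import Order.TTheory GRing.Theory Num.Theory.
Import numFieldNormedType.Exports.

Local Open Scope classical_set_scope.
Local Open Scope ring_scope.

(* Laws are compared on measurable sets only: the value of a measure outside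
   its sigma-algebra carries no information. *)
Definition eq_law (R : realType) (mu nu : set R -> \bar R) : Prop :=
  forall A : set R, measurable A -> mu A = nu A.

Definition mutually_independent (R : realType) (d : measure_display)
    (T : measurableType d) (P : probability T R) (I : choiceType)
    (X : I -> {RV P >-> R}) : Prop :=
  forall (J : {fset I}) (B : I -> set R), (forall i, measurable (B i)) ->
    P (\bigcap_(i in [set` J]) (X i @^-1` B i)) =
    (\prod_(i <- J) P (X i @^-1` B i))%E.

Definition independent_copies (R : realType)
    (d0 : measure_display) (T0 : measurableType d0) (P0 : probability T0 R)
    (xi : {RV P0 >-> R})
    (d : measure_display) (T : measurableType d) (P : probability T R)
    (I : choiceType) (X : I -> {RV P >-> R}) : Prop :=
  mutually_independent X /\
  forall i, eq_law (distribution P (X i)) (distribution P0 xi).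

(* Weak convergence of the laws of Y 0, Y 1, ... to mu, tested on bounded
   continuous functions; it is only meant for measurable Y k. *)
Definition cvg_in_distribution (R : realType) (d : measure_display)
    (T : measurableType d) (P : probability T R) (Y : nat -> T -> R)
    (mu : probability R R) : Prop :=
  forall f : R -> R, continuous f ->
    (exists M : R, forall x : R, `|f x| <= M) ->
    (\int[P]_w (f (Y k w))%:E)%E @[k --> \oo] --> (\int[mu]_x (f x)%:E)%E.

(* normal_prob lives on measurableTypeR R, whose display differs from that of
   the canonical measurable structure of R; it is transported by the
   identity. *)
Definition of_measurableTypeR (R : realType) : measurableTypeR R -> R := idfun.

HB.instance Definition _ (R : realType) :=
  @isMeasurableFun.Build _ _ _ _ (@of_measurableTypeR R)
    (@measurable_id _ _ setT).

Definition std_normal (R : realType) : probability R R :=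
  distribution (normal_prob 0 1) (@of_measurableTypeR R).

Definition slowly_varying (R : realType) (L : R -> R) : Prop :=
  (forall x : R, 0 < x -> 0 < L x) /\
  (forall c : R, 0 < c -> L (c * x) / L x @[x --> +oo] --> (1 : R)).

Definition nondegenerate_law (R : realType) (mu : probability R R) : Prop :=
  forall c : R, mu [set c] <> 1%E.

(* If Z, Z1, Z2 are independent with law mu, then for all a, b > 0 the variable
   a Z1 + b Z2 has the law of (a^alpha + b^alpha)^(1/alpha) Z + e for some
   real e. *)
Definition stable_law (R : realType) (alpha : R) (mu : probability R R)
    : Prop :=
  nondegenerate_law mu /\
  forall a b : R, 0 < a -> 0 < b -> exists e : R,
    forall A : set R, measurable A ->
      (mu \x mu)%E [set p | A (a * p.1 + b * p.2)] =
      mu [set x | A ((a `^ alpha + b `^ alpha) `^ alpha^-1 * x + e)].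

Definition is_levy_measure (R : realType) (nu : {measure set R -> \bar R})
    : Prop :=
  nu [set 0] = 0%E /\ (\int[nu]_x (Num.min (x ^+ 2) 1)%:E < +oo)%E.

(* The real and imaginary parts of the exponent
   i b t - s t^2 / 2 + \int (e^(i t x) - 1 - i t x 1_(|x| <= 1)) nu(dx). *)
Definition levy_exponent_re (R : realType) (s : R)
    (nu : {measure set R -> \bar R}) (t : R) : R :=
  - (s * t ^+ 2 / 2) + \int[nu]_x (cos (t * x) - 1).

Definition levy_exponent_im (R : realType) (b : R)
    (nu : {measure set R -> \bar R}) (t : R) : R :=
  b * t + \int[nu]_x (sin (t * x) - t * x * \1_(`[-1, 1]%classic) x).

(* The Levy-Khintchine formula
   \int e^(i t x) mu(dx) = exp (levy_exponent t), in real and imaginary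
   parts. *)
Definition has_levy_triplet (R : realType) (mu : probability R R)
    (b s : R) (nu : {measure set R -> \bar R}) : Prop :=
  [/\ 0 <= s, is_levy_measure nu &
    forall t : R,
      \int[mu]_x cos (t * x) =
        expR (levy_exponent_re s nu t) * cos (levy_exponent_im b nu t) /\
      \int[mu]_x sin (t * x) =
        expR (levy_exponent_re s nu t) * sin (levy_exponent_im b nu t)].

Definition spectrally_positive (R : realType) (mu : probability R R) : Prop :=
  exists (b s : R) (nu : {measure set R -> \bar R}),
    has_levy_triplet mu b s nu /\ nu `]-oo, 0[%classic = 0%E.

(* The library norm on row vectors is the sup norm. *)
Definition enorm (R : realType) (d : nat) (v : 'rV[R]_d) : R :=
  Num.sqrt (\sum_(j < d) v ord0 j ^+ 2).

(* Steps and coordinates are numbered from 0. *)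
Definition walk_step (R : realType) (T : Type) (xi : nat -> nat -> T -> R)
    (d i : nat) (w : T) : 'rV[R]_d :=
  \row_(j < d) (xi i j w / Num.sqrt d%:R).

Definition walk (R : realType) (T : Type) (xi : nat -> nat -> T -> R)
    (d k : nat) (w : T) : 'rV[R]_d :=
  \sum_(i < k) walk_step xi d i w.

(* Main.v *)
(* Let [b m = m^(1/alpha) L(m)]. Expanding the squares of the coordinates gives
     ||S_n||^2 - n = b(nd)/d W_d + n/d sqrt(2d) Z_d,
   where [b(nd) W_d] is the sum of the [xi_ij^2 - 1] over the [n * d] entries and
   [Z_d] is the normalized sum over the [d] columns of the off-diagonal products
   [(sum_(i <> i') xi_ij xi_i'j) / n].

   The law of [W_d] is the one of the hypothesis with [m = nd], so [W_d] converges
   to the stable law. The columns are independent and centered with variance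
   [2 (1 - 1/n)], and they are square integrable uniformly in [n] because
   truncating [xi] replaces them, up to a small L2 error, by forms with bounded
   third moments; hence [Z_d] converges to the normal law. By Slutsky's lemma it
   remains to compare [b(nd)] with [n sqrt(2d)], that is, to show
   [b m = m^(1/alpha + o(1))]. Slow variation gives this along the powers of 2.
   In between, [b] is almost monotone: with [phi] the characteristic function of
   [xi^2 - 1], [|phi|^m] decreases in [m], so a much larger normalization at an
   earlier time would force the limit law to be degenerate.

   Convergence of cosine transforms is turned into weak convergence by
   approximating Lipschitz functions on [-K, K] by Bernstein polynomials in
   [sin (x / K)] and bounding the tails by the second moments. *)

Require Import Defs.
From mathcomp Require Import all_boot all_order all_algebra finmap.
From mathcomp Require Import all_classical all_reals all_analysis.
From mathcomp Require Import measurable_realfun.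
From mathcomp Require Import ring lra.

Set Implicit Arguments.
Unset Strict Implicit.
Unset Printing Implicit Defensive.

Import Order.TTheory GRing.Theory Num.Theory.
Import numFieldNormedType.Exports.

Local Open Scope classical_set_scope.
Local Open Scope ring_scope.

(** * Expectations *)

(** The exponent (2 - alpha) / (2 alpha - 2) is where (n d)^(1/alpha) and n d^(1/2) have the same
    order. At a polynomial distance from it one of the two terms vanishes in probability after
    normalization, so their dependence on each other is harmless. Three obstacles shape the proof.
    The entries have only two moments and [n] grows with [d] at an arbitrary rate, so the law of a
    column changes with [d] and no Lyapunov condition is available; it is replaced by a bound on E
    U^2 min(1, s |U|), uniform in [n], which is the quantity met in the Taylor remainders of the
    transform. Next, [L] is not assumed measurable, so neither the uniform convergence theorem nor
    Potter's bounds apply; control between powers of 2 has to come from the assumed weak convergence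
    itself. Finally, the stable limit has no second moment: cosine transforms serve only the normal
    limit, and the tails of the stable term are measured by E min(M, t |X|), which is small for
    small [t] without any moment. *)

Definition L1 (R : realType) d (T : measurableType d) (P : probability T R)
  (X : T -> R) : Prop := P.-integrable [set: T] (EFin \o X).

(** Measurability is stated apart because it does not follow from integrability of the square. *)
Definition L2 (R : realType) d (T : measurableType d) (P : probability T R)
    (X : T -> R) : Prop :=
  measurable_fun [set: T] X /\ L1 P (fun w => X w ^+ 2).

Section expectation.
Context {R : realType} d (T : measurableType d) (P : probability T R).
Implicit Types (X Y : T -> R).

Lemma L1_measurable X : L1 P X -> measurable_fun [set: T] X.
Proof. by move=> /measurable_int/measurable_EFinP. Qed.

Lemma L1_le X Y : measurable_fun [set: T] X -> L1 P Y ->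
  (forall w, `|X w| <= Y w) -> L1 P X.
Proof.
move=> mX iY XY; apply: (le_integrable _ _ _ iY) => //.
  exact/measurable_EFinP.
by move=> w _ /=; rewrite lee_fin (le_trans (XY w))// ler_norm.
Qed.

Lemma L1_cst (c : R) : L1 P (fun _ => c).
Proof. exact: finite_measure_integrable_cst. Qed.

Lemma L1_bounded X (M : R) : measurable_fun [set: T] X ->
  (forall w, `|X w| <= M) -> L1 P X.
Proof. by move=> mX; apply: L1_le => //; exact: L1_cst. Qed.

Lemma L1D X Y : L1 P X -> L1 P Y -> L1 P (fun w => X w + Y w).
Proof. by move=> iX iY; exact: (integrableD measurableT iX iY). Qed.

Lemma L1B X Y : L1 P X -> L1 P Y -> L1 P (fun w => X w - Y w).
Proof. by move=> iX iY; exact: (integrableB measurableT iX iY). Qed.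

Lemma L1Z (k : R) X : L1 P X -> L1 P (fun w => k * X w).
Proof. by move=> iX; exact: (integrableZl measurableT k iX). Qed.

Lemma L1_norm X : L1 P X -> L1 P (fun w => `|X w|).
Proof. by move=> iX; exact: integrable_norm. Qed.

Lemma Ex_cst (c : R) : \int[P]_w (fun=> c) w = c.
Proof. by rewrite Rintegral_cst//= probability_setT mulr1. Qed.

Lemma ExD X Y : L1 P X -> L1 P Y ->
  \int[P]_w (X w + Y w) = \int[P]_w X w + \int[P]_w Y w.
Proof. exact: RintegralD. Qed.

Lemma ExB X Y : L1 P X -> L1 P Y ->
  \int[P]_w (X w - Y w) = \int[P]_w X w - \int[P]_w Y w.
Proof. exact: RintegralB. Qed.

Lemma ExZ (k : R) X : L1 P X -> \int[P]_w (k * X w) = k * \int[P]_w X w.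
Proof. exact: RintegralZl. Qed.

Lemma ExN X : L1 P X -> \int[P]_w (- X w) = - \int[P]_w X w.
Proof.
move=> iX; rewrite -mulN1r -ExZ//.
by apply: eq_Rintegral => w _; rewrite mulN1r.
Qed.

Lemma le_Ex X Y : L1 P X -> L1 P Y -> (forall w, X w <= Y w) ->
  \int[P]_w X w <= \int[P]_w Y w.
Proof. by move=> iX iY XY; exact: le_Rintegral. Qed.

Lemma Ex_ge0 X : (forall w, 0 <= X w) -> 0 <= \int[P]_w X w.
Proof. by move=> X0; exact: Rintegral_ge0. Qed.

Lemma ler_norm_Ex X : L1 P X -> `|\int[P]_w X w| <= \int[P]_w `|X w|.
Proof. exact: le_normr_Rintegral. Qed.

Lemma EFin_Ex X : L1 P X -> (\int[P]_w (X w)%:E)%E = (\int[P]_w X w)%:E.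
Proof. by move=> iX; rewrite /Rintegral fineK//; exact: integrable_fin_num. Qed.

Lemma ler_norm_Ex_bounded X (M : R) : measurable_fun [set: T] X ->
  (forall w, `|X w| <= M) -> `|\int[P]_w X w| <= M.
Proof.
move=> mX XM; have iX := L1_bounded mX XM.
rewrite (le_trans (ler_norm_Ex iX))// -[leRHS]Ex_cst.
by apply: le_Ex => //; [exact: L1_norm|exact: L1_cst].
Qed.

Lemma Ex_dist_le X Y (Z : T -> R) : L1 P X -> L1 P Y -> L1 P Z ->
  (forall w, `|X w - Y w| <= Z w) ->
  `|\int[P]_w X w - \int[P]_w Y w| <= \int[P]_w Z w.
Proof.
move=> iX iY iZ XYZ; rewrite -ExB// (le_trans (ler_norm_Ex _))//; first exact: L1B.
by apply: le_Ex => //; exact/L1_norm/L1B.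
Qed.

Lemma L2_measurable X : L2 P X -> measurable_fun [set: T] X.
Proof. by case. Qed.

Lemma L2_sqr X : L2 P X -> L1 P (fun w => X w ^+ 2).
Proof. by case. Qed.

Lemma L2_mul X Y : L2 P X -> L2 P Y -> L1 P (fun w => X w * Y w).
Proof.
move=> [mX iX] [mY iY]; apply: (@L1_le _ (fun w => X w ^+ 2 + Y w ^+ 2)).
- exact: measurable_funM.
- exact: L1D.
- move=> w; rewrite ler_norml; apply/andP; split; nra.
Qed.

Lemma L2_cst c : L2 P (fun=> c).
Proof. by split => //; exact: L1_cst. Qed.

Lemma L2_L1 X : L2 P X -> L1 P X.
Proof.
move=> sX; rewrite (_ : X = fun w => 1 * X w).
  exact: (L2_mul (L2_cst 1)).
by apply/funext => w; rewrite mul1r.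
Qed.

Lemma L2D X Y : L2 P X -> L2 P Y -> L2 P (fun w => X w + Y w).
Proof.
move=> sX sY; split.
  by apply: measurable_funD; exact: L2_measurable.
under eq_fun do rewrite sqrrD -mulr_natl.
by apply: L1D; [apply: L1D; [exact: L2_sqr|exact/L1Z/L2_mul]|exact: L2_sqr].
Qed.

Lemma L2Z (k : R) X : L2 P X -> L2 P (fun w => k * X w).
Proof.
move=> [mX iX]; split; first exact: measurable_funM.
by under eq_fun do rewrite exprMn; exact: L1Z.
Qed.

Lemma L2B X Y : L2 P X -> L2 P Y -> L2 P (fun w => X w - Y w).
Proof.
move=> sX sY; under eq_fun do rewrite -mulN1r.
by apply: L2D => //; exact: L2Z.
Qed.

Lemma L2_sum I (s : seq I) (X : I -> T -> R) : (forall i, L2 P (X i)) ->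
  L2 P (fun w => \sum_(i <- s) X i w).
Proof.
move=> iX; elim: s => [|i s IH].
  by under eq_fun do rewrite big_nil; exact: L2_cst.
by under eq_fun do rewrite big_cons; exact: L2D.
Qed.

Lemma L2_bounded X (M : R) : measurable_fun [set: T] X ->
  (forall w, `|X w| <= M) -> L2 P X.
Proof.
move=> mX XM; split => //; apply: (@L1_bounded _ (M ^+ 2)).
  exact: measurable_funX.
by move=> w; rewrite normrX lerXn2r ?nnegrE// (le_trans _ (XM w)).
Qed.

Lemma Ex_sqrD_orth X Y : L2 P X -> L2 P Y -> \int[P]_w (X w * Y w) = 0 ->
  \int[P]_w ((X w + Y w) ^+ 2) =
  \int[P]_w (X w ^+ 2) + \int[P]_w (Y w ^+ 2).
Proof.
move=> sX sY XY0.
transitivity (\int[P]_w ((X w ^+ 2 + Y w ^+ 2) + 2 * (X w * Y w))).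
  by apply: eq_Rintegral => w _; ring.
rewrite ExD; [|by apply: L1D; exact: L2_sqr|exact/L1Z/L2_mul].
by rewrite ExD ?ExZ ?XY0 ?mulr0 ?addr0//; first [exact: L2_mul|exact: L2_sqr].
Qed.

Lemma Ex_sqr_le (X : T -> R) : L2 P X -> (\int[P]_w X w) ^+ 2 <= \int[P]_w (X w ^+ 2).
Proof.
move=> sX; set m := \int[P]_w X w.
suff : 0 <= \int[P]_w (X w ^+ 2) - m ^+ 2 by lra.
have -> : \int[P]_w (X w ^+ 2) - m ^+ 2 = \int[P]_w ((X w - m) ^+ 2).
  transitivity (\int[P]_w ((X w ^+ 2 + (- 2 * m) * X w) + m ^+ 2)).
    rewrite ExD; [|apply: L1D; [exact: L2_sqr|exact/L1Z/L2_L1]|exact: L1_cst].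
    rewrite ExD; [|exact: L2_sqr|exact/L1Z/L2_L1].
    rewrite ExZ; last exact: L2_L1.
    by rewrite Ex_cst -/m; ring.
  by apply: eq_Rintegral => w _; ring.
by apply: Ex_ge0 => w; exact: sqr_ge0.
Qed.

End expectation.

(** * Independence *)

Lemma sigma_algebra_sub_measurable d (T : measurableType d) (G : set (set T)) :
  G `<=` measurable -> <<s G >> `<=` measurable.
Proof. by apply: smallest_sub; exact: sigma_algebra_measurable. Qed.

Section independence.
Local Open Scope ereal_scope.
Context {R : realType} d (T : measurableType d) (P : probability T R).

Definition indep_sets (E F : set T) : Prop := P (E `&` F) = P E * P F.

Lemma indep_setsC (E F : set T) : indep_sets E F -> indep_sets F E.
Proof. by rewrite /indep_sets setIC muleC. Qed.

(** Both sides of the product formula are finite measures in [E]; agreeing on a pi-system that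
    contains the whole space, they agree on the generated sigma-algebra. *)
Lemma indep_sets_sigma (F : set T) (G : set (set T)) :
  measurable F -> setI_closed G -> G setT -> G `<=` measurable ->
  (forall E, G E -> indep_sets E F) ->
  forall E, <<s G >> E -> indep_sets E F.
Proof.
move=> mF GI GT Gm GF E sE.
have r0 : (0 <= fine (P F))%R by rewrite fine_ge0.
pose m2 : {measure set T -> \bar R} := mscale (NngNum r0) P.
have m2E A : m2 A = P A * P F.
  by rewrite /m2 /= /mscale /= muleC fineK// fin_num_measure.
rewrite /indep_sets -m2E -[LHS]/(mrestr P mF E).
apply: (@g_sigma_algebra_measure_unique _ _ _ G Gm (fun=> setT)) => //.
- by rewrite bigcup_const//; exists 0%N.
- by move=> A GA; rewrite m2E; exact: GF.
- by move=> k; rewrite /= /mrestr setTI (le_lt_trans (probability_le1 _ _)) ?ltry.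
Qed.

Context {I : choiceType} (X : I -> {RV P >-> R}).

Definition gen_sets (J : set I) : set (set T) :=
  [set A | exists i, J i /\ exists2 B, measurable B & A = X i @^-1` B].

Definition gen_measurable (J : set I) (A : T -> R) : Prop :=
  forall B, measurable B -> <<s gen_sets J >> (A @^-1` B).

(** Unlike [gen_sets], a family closed under finite intersections, so independence extends from it
    to the sigma-algebra generated by the [X i], [i] in [J]. *)
Definition cylinders (J : set I) : set (set T) :=
  [set A | exists K : {fset I}, exists B : I -> set R,
    [/\ [set` K] `<=` J, forall i, measurable (B i) &
        A = \bigcap_(i in [set` K]) (X i @^-1` B i)]].

Lemma cylinders_setI (J : set I) : setI_closed (cylinders J).
Proof.
move=> _ _ [K [B [KJ mB ->]]] [K' [B' [KJ' mB' ->]]].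
exists (K `|` K')%fset.
exists (fun i => (if i \in K then B i else setT) `&`
                 (if i \in K' then B' i else setT)); split.
- by move=> i /=; rewrite in_fsetU => /orP[/KJ//|/KJ'].
- by move=> i; apply: measurableI; case: ifP.
- apply/seteqP; split => w.
  + move=> [h h'] i _ /=; split; case: ifP => // iK; [exact: h|exact: h'].
  + move=> h; split => i /= iK.
    * by have /= := h i; rewrite in_fsetU iK => /(_ isT) [].
    * by have /= := h i; rewrite in_fsetU iK orbT => /(_ isT) [].
Qed.

Lemma cylindersT (J : set I) : cylinders J setT.
Proof.
exists fset0, (fun=> setT); split => //.
by apply/seteqP; split => // w _ i.
Qed.

Lemma cylinders_measurable (J : set I) : cylinders J `<=` measurable.
Proof.
move=> _ [K [B [_ mB ->]]]; apply: fin_bigcap_measurable.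
  exact: finite_fset.
by move=> i _; rewrite -[_ @^-1` _]setTI; exact: measurable_funP.
Qed.

Lemma gen_sets_cylinders (J : set I) : gen_sets J `<=` cylinders J.
Proof.
move=> _ [i [Ji [B mB ->]]]; exists [fset i]%fset, (fun=> B); split => //.
  by move=> j /=; rewrite in_fset1 => /eqP ->.
apply/seteqP; split => [w Bw j /=|w /(_ i)/=].
  by rewrite in_fset1 => /eqP ->.
by rewrite in_fset1 eqxx; exact.
Qed.

Hypothesis indX : mutually_independent X.

(** As the index sets are disjoint, the two constraints splice into a single family [C], to which
    mutual independence applies. *)
Lemma cylinders_indep (J J' : set I) : J `&` J' = set0 ->
  forall E F, cylinders J E -> cylinders J' F -> indep_sets E F.
Proof.
move=> JJ' _ _ [K [B [KJ mB ->]]] [K' [B' [KJ' mB' ->]]].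
have dis i : i \in K -> i \in K' -> False.
  move=> iK iK'; have : (J `&` J') i by split; [exact: KJ|exact: KJ'].
  by rewrite JJ'.
pose C i := if i \in K then B i else B' i.
have mC i : measurable (C i) by rewrite /C; case: ifP.
rewrite /indep_sets.
have -> : \bigcap_(i in [set` K]) (X i @^-1` B i) `&`
    \bigcap_(i in [set` K']) (X i @^-1` B' i) =
    \bigcap_(i in [set` (K `|` K')%fset]) (X i @^-1` C i).
  apply/seteqP; split => w.
    move=> [h h'] i /=; rewrite in_fsetU /C; case: ifPn => [iK _|_ /= iK'].
      exact: h.
    exact: h'.
  move=> h; split => i /= iK.
    by have := h i; rewrite /= in_fsetU /C iK; exact.
  have := h i; rewrite /= in_fsetU /C iK orbT; case: ifPn => [iK1|_]; last exact.
  by case: (dis _ iK1 iK).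
rewrite !indX//.
have KK : perm_eq (K `|` K')%fset (K ++ K').
  apply: uniq_perm; first exact: fset_uniq.
    rewrite cat_uniq !fset_uniq/= andbT; apply/hasPn => i iK'.
    by apply/negP => iK; exact: dis iK iK'.
  by move=> i; rewrite in_fsetU mem_cat.
rewrite (perm_big _ KK) big_cat/=; congr (_ * _).
  by apply: eq_big_seq => i iK; rewrite /C iK.
apply: eq_big_seq => i iK'; rewrite /C; case: ifPn => // iK.
by case: (dis _ iK iK').
Qed.

(** The pi-system argument is run twice: with [F] fixed, to reduce [E] to a cylinder, then with this
    cylinder fixed, to reduce [F]. *)
Lemma gen_indep_sets (J J' : set I) : J `&` J' = set0 ->
  forall E F, <<s gen_sets J >> E -> <<s gen_sets J' >> F -> indep_sets E F.
Proof.
move=> JJ' E F sE sF.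
have sub J0 : <<s gen_sets J0 >> `<=` <<s cylinders J0 >>.
  by apply: sub_sigma_algebra2; exact: gen_sets_cylinders.
have mF : measurable F.
  exact: sigma_algebra_sub_measurable (@cylinders_measurable J') _ (sub _ _ sF).
apply: (indep_sets_sigma mF (@cylinders_setI J)) (sub _ _ sE).
- exact: cylindersT.
- exact: cylinders_measurable.
move=> E' cE'; apply: indep_setsC.
apply: (indep_sets_sigma (cylinders_measurable cE') (@cylinders_setI J'))
  (sub _ _ sF).
- exact: cylindersT.
- exact: cylinders_measurable.
by move=> F' cF'; apply: indep_setsC; exact: cylinders_indep JJ' _ _ cE' cF'.
Qed.

Definition indep (A B : T -> R) : Prop :=
  forall U V, measurable U -> measurable V ->
    indep_sets (A @^-1` U) (B @^-1` V).

Lemma gen_indep (J J' : set I) (A B : T -> R) : J `&` J' = set0 ->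
  gen_measurable J A -> gen_measurable J' B -> indep A B.
Proof.
by move=> JJ' mA mB U V mU mV; apply: gen_indep_sets JJ' _ _ _ _; [exact: mA|exact: mB].
Qed.

End independence.

Section gen_measurable.
Context {R : realType} d (T : measurableType d) (P : probability T R).
Context {I : choiceType} (X : I -> {RV P >-> R}).

Lemma gen_measurable_sub (J J' : set I) (A : T -> R) : J `<=` J' ->
  gen_measurable X J A -> gen_measurable X J' A.
Proof.
move=> JJ' mA B mB; apply: sub_sigma_algebra2 (mA _ mB).
by move=> _ [i [Ji [U mU ->]]]; exists i; split; [exact: JJ'|exists U].
Qed.

Lemma gen_measurable_measurable (J : set I) (A : T -> R) :
  gen_measurable X J A -> measurable_fun [set: T] A.
Proof.
move=> mA _ B mB; rewrite setTI.
apply: (sigma_algebra_sub_measurable _ (mA _ mB)).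
move=> _ [i [_ [U mU ->]]].
by rewrite -[_ @^-1` _]setTI; exact: measurable_funP.
Qed.

(** Through this equivalence, sums, products and compositions inherit the closure properties of
    measurable functions on the space carrying the generated sigma-algebra. *)
Lemma gen_measurableP (J : set I) (A : T -> R) : gen_measurable X J A <->
  measurable_fun setT (A : g_sigma_algebraType (gen_sets X J) -> R).
Proof.
split=> [mA _ B mB|mA B mB]; first by rewrite setTI; exact: mA.
by rewrite -[_ @^-1` _]setTI; exact: (mA measurableT).
Qed.

Lemma gen_measurable_comp (J : set I) (i : I) (g : R -> R) : J i ->
  measurable_fun [set: R] g -> gen_measurable X J (fun w => g (X i w)).
Proof.
move=> Ji mg B mB; apply: sub_sigma_algebra; exists i; split => //.
by exists (g @^-1` B) => //; rewrite -[_ @^-1` _]setTI; exact: mg.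
Qed.

Lemma gen_measurable_fun (J : set I) (A : T -> R) (g : R -> R) :
  measurable_fun [set: R] g -> gen_measurable X J A ->
  gen_measurable X J (fun w => g (A w)).
Proof. by move=> mg /gen_measurableP mA; apply/gen_measurableP/measurableT_comp. Qed.

Lemma gen_measurableD (J : set I) (A B : T -> R) :
  gen_measurable X J A -> gen_measurable X J B ->
  gen_measurable X J (fun w => A w + B w).
Proof.
by move=> /gen_measurableP mA /gen_measurableP mB; exact/gen_measurableP/measurable_funD.
Qed.

Lemma gen_measurableM (J : set I) (A B : T -> R) :
  gen_measurable X J A -> gen_measurable X J B ->
  gen_measurable X J (fun w => A w * B w).
Proof.
by move=> /gen_measurableP mA /gen_measurableP mB; exact/gen_measurableP/measurable_funM.
Qed.

Lemma gen_measurable_cst (J : set I) (c : R) : gen_measurable X J (fun=> c).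
Proof. exact/gen_measurableP/measurable_cst. Qed.

Lemma gen_measurable_sum (J : set I) (K : eqType) (s : seq K)
    (A : K -> T -> R) :
  (forall k, k \in s -> gen_measurable X J (A k)) ->
  gen_measurable X J (fun w => \sum_(k <- s) A k w).
Proof.
elim: s => [|k s IH] mA.
  rewrite (_ : (fun _ => _) = (fun=> 0)); first exact: gen_measurable_cst.
  by apply/funext => w; rewrite big_nil.
rewrite (_ : (fun _ => _) = (fun w => A k w + \sum_(j <- s) A j w)).
  apply: gen_measurableD; first by apply: mA; rewrite mem_head.
  by apply: IH => j js; apply: mA; rewrite in_cons js orbT.
by apply/funext => w; rewrite big_cons.
Qed.

End gen_measurable.

Lemma measurable_sqr (R : realType) :
  measurable_fun [set: R] (fun x : R => x ^+ 2).
Proof. exact: (measurable_funX 2 (@measurable_id _ R [set: R])). Qed.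

Lemma measurable_preimage d d' (T : measurableType d) (T' : measurableType d')
    (f : T -> T') (U : set T') :
  measurable_fun [set: T] f -> measurable U -> measurable (f @^-1` U).
Proof. by move=> mf mU; rewrite -[_ @^-1` _]setTI; exact: mf. Qed.

(** * Laws of pairs and of sums of independent variables *)

Section law_of_pair.
Local Open Scope ereal_scope.
Context {R : realType} d (T : measurableType d) (P : probability T R).

(** The law of the pair and the product law agree on rectangles, which determine the product
    measure. *)
Lemma indep_product_law (A B : {RV P >-> R}) : indep P A B ->
  forall S : set (R * R), measurable S ->
  (distribution P A \x distribution P B) S = P [set w | S (A w, B w)].
Proof.
move=> AB.
have mAB : measurable_fun [set: T] (fun w => (A w, B w)).
  exact: measurable_fun_pair.
pose AB' : {RV P >-> (R * R)%type} := mfun_Sub (mem_set mAB).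
move=> S mS; rewrite [RHS](_ : _ = distribution P AB' S)//.
by apply: product_measure_unique => // U V mU mV; exact: AB.
Qed.

Lemma indep_comp (A B : T -> R) (g h : R -> R) :
  measurable_fun [set: R] g -> measurable_fun [set: R] h ->
  indep P A B -> indep P (g \o A) (h \o B).
Proof.
move=> mg mh AB U V mU mV; apply: (AB (g @^-1` U) (h @^-1` V)).
  exact: measurable_preimage.
exact: measurable_preimage.
Qed.

(** Fubini for the product of the two laws, after Tonelli has shown that the product of the
    coordinates is integrable there. *)
Lemma indep_integral_mul (A B : {RV P >-> R}) : indep P A B ->
  L1 P A -> L1 P B ->
  L1 P (fun w => A w * B w)%R /\
  (\int[P]_w (A w * B w)%:E = (\int[P]_w (A w)%:E) * (\int[P]_w (B w)%:E)).
Proof.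
move=> AB iA iB.
have mAB : measurable_fun [set: T] (fun w => (A w, B w)).
  exact: measurable_fun_pair.
pose AB' : {RV P >-> (R * R)%type} := mfun_Sub (mem_set mAB).
pose PA := distribution P A; pose PB := distribution P B.
have lawE S : measurable S -> (PA \x PB) S = distribution P AB' S.
  exact: indep_product_law.
pose f (p : R * R) := (p.1 * p.2)%:E.
have mf : measurable_fun setT f.
  by apply/measurable_EFinP; exact: measurable_funM.
have iPA : PA.-integrable setT (EFin : R -> \bar R).
  exact: (integrable_pushforward (phi := A)).
have iPB : PB.-integrable setT (EFin : R -> \bar R).
  exact: (integrable_pushforward (phi := B)).
have if_ : (PA \x PB).-integrable setT f.
  apply/integrable12ltyP => //.
  have mabs : measurable_fun [set: R] (fun x : R => `|x%:E|).
    exact: measurableT_comp.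
  have -> : \int[PA]_x \int[PB]_y `|f (x, y)| =
      (\int[PA]_x `|x%:E|) * (\int[PB]_y `|y%:E|).
    rewrite -ge0_integralZr//; last exact: integral_ge0.
    apply: eq_integral => x _; rewrite -ge0_integralZl//.
    by apply: eq_integral => y _; rewrite /f EFinM abseM.
  have /integrableP[_ hA] := iPA.
  have /integrableP[_ hB] := iPB.
  by rewrite lte_mul_pinfty ?integral_ge0// ge0_fin_numE ?integral_ge0.
have iAB : P.-integrable setT (f \o AB').
  apply/integrableP; split; first exact: measurableT_comp.
  move/integrableP : if_ => [_].
  rewrite (eq_measure_integral (distribution P AB')); last by move=> S mS _; exact: lawE.
  by rewrite ge0_integral_pushforward//; exact: measurableT_comp.
split; first exact: iAB.
transitivity (\int[P]_w (f \o AB') w); first by [].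
rewrite -integral_distribution//.
rewrite (eq_measure_integral (PA \x PB)); last by move=> S mS _; exact/esym/lawE.
rewrite -integral12_prod_meas1//= /fubini_F /=.
have EB : \int[PB]_y y%:E = \int[P]_w (B w)%:E by rewrite integral_distribution.
have EA : \int[PA]_y y%:E = \int[P]_w (A w)%:E by rewrite integral_distribution.
have fB : \int[P]_w (B w)%:E \is a fin_num by exact: integrable_fin_num.
rewrite -EA -(fineK fB) -integralZr//.
by apply: eq_integral => x _; rewrite fineK// -EB -integralZl.
Qed.

Lemma indep_mul (A B : T -> R) : indep P A B -> L1 P A -> L1 P B ->
  L1 P (fun w => A w * B w)%R /\
  (\int[P]_w (A w * B w) = (\int[P]_w (A w)) * (\int[P]_w (B w)))%R.
Proof.
move=> AB iA iB.
pose A' : {RV P >-> R} := mfun_Sub (mem_set (L1_measurable iA)).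
pose B' : {RV P >-> R} := mfun_Sub (mem_set (L1_measurable iB)).
have [i e] := @indep_integral_mul A' B' AB iA iB.
split => //; rewrite /Rintegral e fineM//; exact: integrable_fin_num.
Qed.

Lemma indep_L1M (A B : T -> R) : indep P A B -> L1 P A -> L1 P B ->
  L1 P (fun w => A w * B w)%R.
Proof. by move=> AB iA iB; case: (indep_mul AB iA iB). Qed.

Lemma indep_ExM (A B : T -> R) : indep P A B -> L1 P A -> L1 P B ->
  (\int[P]_w (A w * B w) = (\int[P]_w (A w)) * (\int[P]_w (B w)))%R.
Proof. by move=> AB iA iB; case: (indep_mul AB iA iB). Qed.

Lemma indep_L2M (A B : T -> R) : indep P A B -> L2 P A -> L2 P B ->
  L2 P (fun w => A w * B w)%R.
Proof.
move=> AB sA sB; split.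
  by apply: measurable_funM; [exact: L2_measurable sA|exact: L2_measurable sB].
under eq_fun do rewrite exprMn.
apply: indep_L1M (L2_sqr sA) (L2_sqr sB).
exact: (indep_comp (@measurable_sqr R) (@measurable_sqr R) AB).
Qed.

Lemma indep_Ex_sqrM (A B : T -> R) : indep P A B -> L2 P A -> L2 P B ->
  (\int[P]_w ((A w * B w) ^+ 2) = \int[P]_w (A w ^+ 2) * \int[P]_w (B w ^+ 2))%R.
Proof.
move=> AB sA sB.
under eq_Rintegral do rewrite exprMn.
apply: indep_ExM (L2_sqr sA) (L2_sqr sB).
exact: (indep_comp (@measurable_sqr R) (@measurable_sqr R) AB).
Qed.

End law_of_pair.

Section law_of_sum.
Local Open Scope ereal_scope.
Context {R : realType} d (T : measurableType d) (P : probability T R)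
  d' (T' : measurableType d') (P' : probability T' R).

(** Two spaces, because the array that drives the walks and the sequence in the hypothesis on sums
    of squares may live on different ones. *)
Definition same_law (A : T -> R) (A' : T' -> R) : Prop :=
  forall U, measurable U -> P (A @^-1` U) = P' (A' @^-1` U).

Lemma same_law_add (A B : T -> R) (A' B' : T' -> R) :
  measurable_fun setT A -> measurable_fun setT B ->
  measurable_fun setT A' -> measurable_fun setT B' ->
  indep P A B -> indep P' A' B' -> same_law A A' -> same_law B B' ->
  same_law (fun w => A w + B w)%R (fun w => A' w + B' w)%R.
Proof.
move=> mA mB mA' mB' AB AB' AA' BB' U mU.
pose A0 : {RV P >-> R} := mfun_Sub (mem_set mA).
pose B0 : {RV P >-> R} := mfun_Sub (mem_set mB).
pose A1 : {RV P' >-> R} := mfun_Sub (mem_set mA').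
pose B1 : {RV P' >-> R} := mfun_Sub (mem_set mB').
pose S := (fun p : R * R => (p.1 + p.2)%R) @^-1` U.
have mS : measurable S.
  exact: measurable_preimage (measurable_funD measurable_fst measurable_snd) mU.
rewrite -[LHS](@indep_product_law _ _ _ _ A0 B0 AB S mS).
rewrite -[RHS](@indep_product_law _ _ _ _ A1 B1 AB' S mS).
apply: product_measure_unique => // V W mV mW.
apply: (eq_trans (product_measure1E _ _ mV mW)).
by congr (_ * _); apply/esym; [exact: AA'|exact: BB'].
Qed.

Lemma same_law_integral (A : T -> R) (A' : T' -> R) (f : R -> R) (M : R) :
  measurable_fun setT A -> measurable_fun setT A' -> same_law A A' ->
  measurable_fun setT f -> (forall x, `|f x| <= M)%R ->
  (\int[P]_w f (A w) = \int[P']_w f (A' w))%R.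
Proof.
move=> mA mA' AA' mf fM.
pose A0 : {RV P >-> R} := mfun_Sub (mem_set mA).
pose A1 : {RV P' >-> R} := mfun_Sub (mem_set mA').
have mf' : measurable_fun setT (EFin \o f) by exact/measurable_EFinP.
rewrite /Rintegral; congr fine.
transitivity (\int[distribution P A0]_y (EFin \o f) y).
  rewrite integral_distribution//.
  by apply: (@L1_bounded _ _ _ P (f \o A) M); [exact: measurableT_comp|move=> w; exact: fM].
rewrite (eq_measure_integral (distribution P' A1)); last first.
  by move=> S mS _; exact: AA'.
rewrite integral_distribution//.
by apply: (@L1_bounded _ _ _ P' (f \o A') M); [exact: measurableT_comp|move=> w; exact: fM].
Qed.

(** By induction: each new index is absent from the rest of the list, so the new term is independent
    of the remaining sum, and the law of an independent sum depends only on the laws of its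
    terms. *)
Lemma same_law_sum (I I' : choiceType) (X : I -> {RV P >-> R})
    (X' : I' -> {RV P' >-> R}) (g : R -> R) (s : seq I) (s' : seq I') :
  measurable_fun setT g ->
  mutually_independent X -> mutually_independent X' ->
  (forall i i', same_law (X i) (X' i')) ->
  uniq s -> uniq s' -> size s = size s' ->
  same_law (fun w => \sum_(i <- s) g (X i w))%R
           (fun w => \sum_(i <- s') g (X' i w))%R.
Proof.
move=> mg iX iX' XX'; elim: s s' => [|i s IH] [|i' s']//=.
  move=> _ _ _ U mU.
  under [X in preimage X _]eq_fun do rewrite big_nil.
  under [X in _ = P' (preimage X _)]eq_fun do rewrite big_nil.
  have [U0|U0] := pselect (U 0%R).
    rewrite (_ : _ @^-1` _ = setT) ?probability_setT; last by apply/seteqP; split.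
    rewrite (_ : _ @^-1` _ = setT) ?probability_setT//; last by apply/seteqP; split.
  rewrite (_ : _ @^-1` _ = set0) ?measure0; last by apply/seteqP; split.
  by rewrite (_ : _ @^-1` _ = set0) ?measure0//; apply/seteqP; split.
move=> /andP[is_ us] /andP[is'_ us'] [ss'].
rewrite (_ : (fun w => \sum_(j <- i :: s) g (X j w))%R =
    (fun w => g (X i w) + \sum_(j <- s) g (X j w))%R); last first.
  by apply/funext => w; rewrite big_cons.
rewrite (_ : (fun w => \sum_(j <- i' :: s') g (X' j w))%R =
    (fun w => g (X' i' w) + \sum_(j <- s') g (X' j w))%R); last first.
  by apply/funext => w; rewrite big_cons.
have gmi J (j : I) : J j -> gen_measurable X J (fun w => g (X j w)) by move=> ?; exact: gen_measurable_comp.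
have gmi' J (j : I') : J j -> gen_measurable X' J (fun w => g (X' j w)) by move=> ?; exact: gen_measurable_comp.
have gms : gen_measurable X [set` s] (fun w => \sum_(j <- s) g (X j w))%R.
  by apply: gen_measurable_sum => j js; exact: gmi.
have gms' : gen_measurable X' [set` s'] (fun w => \sum_(j <- s') g (X' j w))%R.
  by apply: gen_measurable_sum => j js; exact: gmi'.
apply: same_law_add.
- exact: gen_measurable_measurable (gmi [set i] _ _).
- exact: gen_measurable_measurable gms.
- exact: gen_measurable_measurable (gmi' [set i'] _ _).
- exact: gen_measurable_measurable gms'.
- apply: (gen_indep iX _ (gmi [set i] _ _) gms) => //.
  by apply/seteqP; split => // j [/= ->]; rewrite (negbTE is_).
- apply: (gen_indep iX' _ (gmi' [set i'] _ _) gms') => //.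
  by apply/seteqP; split => // j [/= ->]; rewrite (negbTE is'_).
- by move=> U mU; exact: (XX' i i' (g @^-1` U)) (measurable_preimage mg mU).
- exact: IH.
Qed.

End law_of_sum.

(** * Convergence in distribution *)

Section limits_of_expectations.
Context {R : realType} d (T : measurableType d) (P : probability T R).

Lemma Ex_dominated_cvg (g_ : nat -> T -> R) (g G : T -> R) :
  (forall n, measurable_fun [set: T] (g_ n)) -> L1 P G ->
  (forall n w, `|g_ n w| <= G w) ->
  (forall w, g_ n w @[n --> \oo] --> g w) ->
  \int[P]_w g_ n w @[n --> \oo] --> \int[P]_w g w.
Proof.
move=> mg iG gG gg.
have mg' : measurable_fun [set: T] g.
  by apply: (measurable_fun_cvg (h := g_)) => // w _; exact: gg.
have gGw w : `|g w| <= G w.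
  have : `|g_ n w| @[n --> \oo] --> `|g w| by apply: cvg_norm; exact: gg.
  move=> h; rewrite -(cvg_lim _ h)//; apply: limr_le; first by apply/cvg_ex; exists `|g w|.
  by near=> n; exact: gG.
have ig : L1 P g by exact: L1_le iG gGw.
have mgE n : measurable_fun [set: T] (EFin \o g_ n).
  by apply/measurable_EFinP; exact: mg.
have mgE' : measurable_fun [set: T] (EFin \o g) by exact/measurable_EFinP.
have cE : {ae P, forall w, [set: T] w ->
    (EFin \o g_ n) w @[n --> \oo] --> (EFin \o g) w}.
  by apply: aeW => w _; apply: cvg_EFin; [near=> n|exact: gg].
have bE : {ae P, forall w n, [set: T] w ->
    (`|(EFin \o g_ n) w| <= (EFin \o G) w)%E}.
  by apply: aeW => w n _ /=; rewrite lee_fin; exact: gG.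
have [_ _ h] := dominated_convergence measurableT mgE mgE' cE iG bE.
apply: fine_cvg; move: h; rewrite /= -(EFin_Ex ig); exact.
Unshelve. all: by end_near. Qed.

(** Dominated convergence along t = 1 / (n + 1). The integrand is a bounded Lipschitz substitute for
    the indicator of |X| > 1 / t, so this plays the role of tightness for variables without
    moments. *)
Lemma Ex_min_cvg0 (X : T -> R) (M : R) : measurable_fun [set: T] X -> 0 <= M ->
  forall e, 0 < e -> exists2 t, 0 < t &
    \int[P]_w (Num.min M (t * `|X w|)) <= e.
Proof.
move=> mX M0 e e0.
pose g_ (n : nat) w := Num.min M (n.+1%:R^-1 * `|X w|).
have g0 n w : 0 <= g_ n w by rewrite le_min M0 mulr_ge0.
have /cvgrPdist_le/(_ _ e0)[N _ hN] : \int[P]_w g_ n w @[n --> \oo] --> \int[P]_w (fun=> 0) w.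
  apply: (@Ex_dominated_cvg g_ (fun=> 0) (fun=> M)).
  - move=> n; apply: measurable_minr => //; apply: measurable_funM => //.
    exact: measurableT_comp.
  - exact: L1_cst.
  - by move=> n w; rewrite ger0_norm// /g_ ge_min lexx.
  - move=> w; apply/cvgrPdist_le => eps eps0.
    have [N hN] : exists N : nat, forall n, (N <= n)%N -> n.+1%:R^-1 * `|X w| <= eps.
      exists (Num.truncn (`|X w| / eps)) => n Nn.
      rewrite mulrC ler_pdivrMr// mulrC -ler_pdivrMr//.
      apply/ltW; apply: (lt_le_trans (truncnS_gt _)).
      by rewrite ler_nat.
    exists N => // n /= Nn; rewrite sub0r normrN ger0_norm//.
    by rewrite ge_min hN ?orbT.
exists N.+1%:R^-1; first by rewrite invr_gt0.
have := hN N (leqnn N); rewrite Ex_cst sub0r normrN ger0_norm//.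
by apply: Ex_ge0.
Qed.

End limits_of_expectations.

Section inf_convolution.
Context {R : realType} (f : R -> R) (M : R).
Hypothesis cf : continuous f.
Hypothesis fM : forall x, `|f x| <= M.

(** The Pasch-Hausdorff envelope: for bounded [f], its largest [n]-Lipschitz minorant. *)
Definition inf_conv (n : nat) (x : R) : R :=
  inf [set f y + n%:R * `|x - y| | y in [set: R]].

Let inf_conv_has_inf n x :
  has_inf [set f y + n%:R * `|x - y| | y in [set: R]].
Proof.
split; first by exists (f x + n%:R * `|x - x|), x.
exists (- M) => _ [y _ <-].
have := fM y; rewrite ler_norml => /andP[h _].
by rewrite (le_trans h)// lerDl mulr_ge0.
Qed.

Lemma inf_conv_le_val n x y : inf_conv n x <= f y + n%:R * `|x - y|.
Proof. by apply: ge_inf; [exact: (inf_conv_has_inf n x).2|exists y]. Qed.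

Lemma inf_conv_le n x : inf_conv n x <= f x.
Proof. by have := inf_conv_le_val n x x; rewrite subrr normr0 mulr0 addr0. Qed.

Lemma inf_conv_ge n x c :
  (forall y, c <= f y + n%:R * `|x - y|) -> c <= inf_conv n x.
Proof.
move=> h; apply: lb_le_inf; first exact: (inf_conv_has_inf n x).1.
by move=> _ [y _ <-].
Qed.

Lemma inf_conv_bounded n x : `|inf_conv n x| <= M.
Proof.
rewrite ler_norml (le_trans (inf_conv_le n x)) ?andbT; last first.
  by rewrite (le_trans (ler_norm _)).
apply: inf_conv_ge => y.
have := fM y; rewrite ler_norml => /andP[h _].
by rewrite (le_trans h)// lerDl mulr_ge0.
Qed.

Lemma inf_conv_lipschitz n x y :
  `|inf_conv n x - inf_conv n y| <= n%:R * `|x - y|.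
Proof.
wlog suff h : x y / inf_conv n x - inf_conv n y <= n%:R * `|x - y|.
  by rewrite ler_norml h andbT lerNl opprB distrC; exact: h.
rewrite lerBlDr addrC -lerBlDr; apply: inf_conv_ge => z.
rewrite lerBlDr (le_trans (inf_conv_le_val n x z))// -addrA lerD2l -mulrDr.
rewrite ler_wpM2l//.
by rewrite [leRHS]addrC ler_distD.
Qed.

(** Points [y] at distance at least [r] from [x] pay a penalty of at least 2 M, the largest possible
    oscillation of [f]; closer points have values near [f x]. *)
Lemma inf_conv_cvg x : inf_conv n x @[n --> \oo] --> f x.
Proof.
have M0 : 0 <= M by exact: le_trans (fM 0).
apply/cvgrPdist_le => e e0.
have /cvgrPdist_le/(_ _ e0)/nbhs_ballP[r /= r0 hr] := @cf x.
have [N hN] : exists N : nat, 2 * M <= N%:R * r.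
  exists (Num.truncn (2 * M / r)).+1.
  by rewrite -ler_pdivrMr// ltW// truncnS_gt.
exists N => // n /= Nn; rewrite ger0_norm ?subr_ge0 ?inf_conv_le//.
rewrite lerBlDr addrC -lerBlDr; apply: inf_conv_ge => y.
have [xy|xy] := ltP `|x - y| r.
  have := hr y xy; rewrite ler_norml => /andP[_].
  have : 0 <= n%:R * `|x - y| by rewrite mulr_ge0.
  by lra.
have : N%:R * r <= n%:R * `|x - y|.
  by rewrite ler_pM ?ler_nat// ltW.
have := fM x; have := fM y; rewrite !ler_norml => /andP[? ?] /andP[? ?].
by lra.
Qed.

End inf_convolution.

Section convergence_in_distribution.
Context {R : realType} d (T : measurableType d) (P : probability T R).
Variables (Y : nat -> T -> R) (mu : probability R R).
Hypothesis mY : forall k, measurable_fun [set: T] (Y k).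

Let continuous_L1 (f : R -> R) (M : R) k : continuous f ->
  (forall x, `|f x| <= M) -> L1 P (fun w => f (Y k w)).
Proof.
move=> cf fM; apply: (@L1_bounded _ _ _ _ _ M) => //.
by apply: (measurableT_comp _ (mY k)); exact: continuous_measurable_fun.
Qed.

Let continuous_L1mu (f : R -> R) (M : R) : continuous f ->
  (forall x, `|f x| <= M) -> L1 mu f.
Proof.
move=> cf fM; apply: (@L1_bounded _ _ _ _ _ M) => //.
exact: continuous_measurable_fun.
Qed.

Lemma cvg_in_distribution_Ex (f : R -> R) (M : R) :
  cvg_in_distribution P Y mu -> continuous f -> (forall x, `|f x| <= M) ->
  \int[P]_w f (Y k w) @[k --> \oo] --> \int[mu]_x f x.
Proof.
move=> h cf fM; have := h f cf (ex_intro _ M fM).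
by rewrite (EFin_Ex (continuous_L1mu cf fM)) => /fine_cvg.
Qed.

Lemma lipschitz_continuous (f : R -> R) (K : R) :
  (forall x y, `|f x - f y| <= K * `|x - y|) -> continuous f.
Proof.
move=> fK x; apply/cvgrPdist_le => e e0.
have K0 : 0 < `|K| + 1 by rewrite ltr_wpDl.
apply/nbhs_ballP; exists (e / (`|K| + 1)); first by rewrite /= divr_gt0.
move=> y /= xy; rewrite (le_trans (fK _ _))//.
rewrite (@le_trans _ _ ((`|K| + 1) * `|x - y|))//.
  by rewrite ler_wpM2r// (le_trans (ler_norm _))// lerDl.
by rewrite mulrC -ler_pdivlMr// ltW.
Qed.

(** Lipschitz minorants converging pointwise to [f] bound the limit of the expectations from below;
    the same argument for - f bounds it from above. *)
Lemma lipschitz_cvg_in_distribution :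
  (forall (f : R -> R) (K M : R), (forall x y, `|f x - f y| <= K * `|x - y|) ->
    (forall x, `|f x| <= M) ->
    \int[P]_w f (Y k w) @[k --> \oo] --> \int[mu]_x f x) ->
  cvg_in_distribution P Y mu.
Proof.
move=> H f cf [M fM].
have lower (g : R -> R) : continuous g -> (forall x, `|g x| <= M) ->
    forall e, 0 < e -> \forall k \near \oo,
    \int[mu]_x g x - e <= \int[P]_w g (Y k w).
  move=> cg gM e e0.
  have e20 : 0 < e / 2 by rewrite divr_gt0.
  have c n : continuous (inf_conv g n).
    by apply: (@lipschitz_continuous _ n%:R); exact: inf_conv_lipschitz.
  have /cvgrPdist_le/(_ _ e20)[n _ /(_ n (leqnn n)) hn] :
      \int[mu]_x inf_conv g n x @[n --> \oo] --> \int[mu]_x g x.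
    apply: (@Ex_dominated_cvg _ _ _ mu _ _ (fun=> M)).
    - by move=> n; exact: continuous_measurable_fun.
    - exact: L1_cst.
    - by move=> n x; exact: inf_conv_bounded.
    - by move=> x; exact: inf_conv_cvg.
  have /cvgrPdist_le/(_ _ e20) := H (inf_conv g n) n%:R M
    (inf_conv_lipschitz gM n) (inf_conv_bounded gM n).
  apply: filterS => k hk.
  have : \int[P]_w inf_conv g n (Y k w) <= \int[P]_w g (Y k w).
    apply: le_Ex.
    - exact: continuous_L1 (inf_conv_bounded gM n).
    - exact: continuous_L1 gM.
    - by move=> w; exact: inf_conv_le.
  move: hn hk; rewrite !ler_norml => /andP[_ ?] /andP[_ ?] ?; lra.
have lf := lower f cf fM.
have fNM x : `|- f x| <= M by rewrite normrN.
have lNf := lower (fun x => - f x) (fun x => cvgN (cf x)) fNM.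
rewrite (EFin_Ex (continuous_L1mu cf fM)).
apply: cvg_EFin.
  by near=> k; rewrite EFin_Ex//; exact: continuous_L1 fM.
apply/cvgrPdist_le => e e0; near=> k.
rewrite /= -/(Rintegral P [set: T] (fun w => f (Y k w))) ler_norml.
have h1 : \int[mu]_x f x - e <= \int[P]_w f (Y k w).
  by near: k; exact: lf.
have : \int[mu]_x (- f x) - e <= \int[P]_w (- f (Y k w)).
  by near: k; exact: lNf.
rewrite !ExN; [|exact: continuous_L1 fM|exact: continuous_L1mu fM].
by move=> h2; apply/andP; split; lra.
Unshelve. all: by end_near. Qed.

End convergence_in_distribution.

(** * Trigonometric approximation *)

Section trigonometric_bounds.
Context {R : realType}.
Implicit Types x y : R.

Lemma mvt_eq (f df : R -> R) (a b : R) : (forall x, is_derive x 1 f (df x)) ->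
  exists2 c, Num.min a b <= c <= Num.max a b & f b - f a = df c * (b - a).
Proof.
move=> fdf.
have cf (u v : R) : {within `[u, v], continuous f}.
  apply: derivable_within_continuous => x _.
  by have [] := fdf x.
have [ab|ba] := leP a b.
  have [c] := MVT_segment ab (fun x _ => fdf x) (@cf a b).
  by rewrite in_itv/= => cab ->; exists c.
have [c] := MVT_segment (ltW ba) (fun x _ => fdf x) (@cf b a).
rewrite in_itv/= => cab e; exists c => //.
by rewrite -opprB e -mulrN opprB.
Qed.

Lemma mvt_le (f df : R -> R) (a b M : R) : (forall x, is_derive x 1 f (df x)) ->
  (forall x, Num.min a b <= x <= Num.max a b -> `|df x| <= M) ->
  `|f b - f a| <= M * `|b - a|.
Proof.
move=> fdf dM; have [c cab ->] := mvt_eq a b fdf.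
by rewrite normrM ler_wpM2r// dM.
Qed.

Lemma norm_between0 x y : Num.min 0 x <= y <= Num.max 0 x -> `|y| <= `|x|.
Proof.
have [x0|x0] := leP 0 x => /andP[h1 h2].
  by rewrite !ger0_norm.
by rewrite !ler0_norm// ?lerN2// ltW.
Qed.

Lemma norm_sin_le x : `|sin x| <= `|x|.
Proof.
have := @mvt_le sin cos 0 x 1 (fun y => is_derive_sin y).
by rewrite sin0 !subr0 mul1r; apply => y _; exact: cos_max.
Qed.

Lemma onem_cos_le x : 1 - cos x <= x ^+ 2 / 2.
Proof.
have -> : cos x = cos ((x / 2) *+ 2) by congr cos; rewrite -mulr_natr; field.
rewrite cos_mulr2n cos2sin2.
have := norm_sin_le (x / 2) => h.
have : sin (x / 2) ^+ 2 <= (x / 2) ^+ 2.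
  by rewrite -ler_sqrt ?sqr_ge0// !sqrtr_sqr.
by rewrite -mulr_natr; nra.
Qed.

(** Common bound for the Taylor remainders of sine and cosine: cubic near 0, yet never more than
    x^2, so it is integrable as soon as x^2 is. *)
Definition cub x := x ^+ 2 * Num.min 1 `|x|.

Lemma sin_taylor3 x : `|sin x - x| <= `|x| ^+ 3 / 2.
Proof.
have d (y : R) : is_derive y 1 (fun y => sin y - y) (cos y - 1) by exact: is_deriveB.
have := @mvt_le (fun y => sin y - y) _ 0 x (`|x| ^+ 2 / 2) d.
rewrite sin0 !subr0 (_ : `|x| ^+ 3 / 2 = `|x| ^+ 2 / 2 * `|x|); last by field.
apply => y hy.
rewrite ler0_norm ?subr_le0 ?cos_le1// opprB (le_trans (onem_cos_le y))//.
rewrite ler_wpM2r// -[leLHS]real_normK ?num_real//.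
by rewrite lerXn2r ?nnegrE// norm_between0.
Qed.

Lemma sin_taylor x : `|sin x - x| <= 2 * cub x.
Proof.
have h3 := sin_taylor3 x; rewrite /cub -(real_normK (num_real x)).
have x0 := normr_ge0 x.
have [x1|x1] := leP 1 `|x|.
  have := ler_normB (sin x) x; have := norm_sin_le x.
  by move=> h1 h2; nra.
have : 0 <= `|x| ^+ 2 * `|x| by rewrite mulr_ge0// exprn_ge0.
by rewrite -exprSr => h; lra.
Qed.

Lemma cos_taylor x : `|cos x - 1 + x ^+ 2 / 2| <= cub x.
Proof.
have x0 := normr_ge0 x.
rewrite /cub; have [x1|x1] := leP 1 `|x|.
  have := onem_cos_le x; have := cos_le1 x; have := sqr_ge0 x.
  by rewrite mulr1 ler_norml => ? ? ?; apply/andP; split; lra.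
have h3 : `|cos x - 1 + x ^+ 2 / 2| <= `|x| ^+ 3 / 2 * `|x|.
  have d (y : R) : is_derive y 1 (fun y => cos y + y ^+ 2 / 2) (- (sin y - y)).
    have -> : (fun y : R => cos y + y ^+ 2 / 2) = @cos R + (2^-1 \*: (@id R ^+ 2)).
      by apply/funext => z; rewrite /= !fctE /= mulrC.
    apply: is_derive_eq.
    by rewrite expr1 /GRing.scale/= mulr1 mulKf ?pnatr_eq0// opprB addrC.
  have := @mvt_le (fun y => cos y + y ^+ 2 / 2) _ 0 x (`|x| ^+ 3 / 2) d.
  rewrite cos0 subr0 expr0n/= mul0r addr0 addrAC; apply => y hy.
  rewrite normrN (le_trans (sin_taylor3 y))// ler_wpM2r//.
  by rewrite lerXn2r ?nnegrE// norm_between0.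
rewrite (le_trans h3)// -(real_normK (num_real x)).
have : 0 <= `|x| ^+ 2 * `|x| by rewrite mulr_ge0// exprn_ge0.
by rewrite exprSr; nra.
Qed.

Lemma cub_ge0 x : 0 <= cub x.
Proof. by rewrite mulr_ge0 ?sqr_ge0// le_min ler01 normr_ge0. Qed.

(** The derivative of the sine is at least cos 1 on [-1, 1]. Read backwards, this makes [asin]
    Lipschitz on the image of that interval. *)
Lemma sin_lower_lipschitz x y : `|x| <= 1 -> `|y| <= 1 ->
  cos 1 * `|x - y| <= `|sin x - sin y|.
Proof.
move=> x1 y1; have [c] := mvt_eq y x (@is_derive_sin R).
move=> hc ->; rewrite normrM ler_wpM2r//.
have c1 : `|c| <= 1.
  move: x1 y1 hc; rewrite !ler_norml ge_min le_max.
  move=> /andP[? ?] /andP[? ?] /andP[/orP[?|?] /orP[?|?]]; apply/andP; split; lra.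
rewrite -cos_norm (le_trans _ (ler_norm _))//.
rewrite -[X in _ <= X](cos_norm c) leNgt ltr_cos ?in_itv/=.
- by rewrite -leNgt normr1.
- by rewrite normr_ge0 normr1 (le_trans _ (@pi_ge2 R))// ler1n.
- by rewrite normr_ge0 (le_trans c1)// (le_trans _ (@pi_ge2 R))// ler1n.
Qed.

End trigonometric_bounds.

(** * Bernstein polynomials in a sine *)

Section bernstein.
Context {R : realType}.

(* The expectation of [h (m + B)], where [B] is binomial with parameters [n] and
   [p x]; evaluated at 0, it is the Bernstein polynomial of [h] in [p x]. *)
Fixpoint bernstein (p : R -> R) (h : nat -> R) (n m : nat) (x : R) : R :=
  if n is n'.+1 then
    p x * bernstein p h n' m.+1 x + (1 - p x) * bernstein p h n' m x
  else h m.

Variables (p : R -> R).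
Hypothesis p01 : forall x, 0 <= p x <= 1.

Lemma le_bernstein (h g : nat -> R) n m x : (forall k, h k <= g k) ->
  bernstein p h n m x <= bernstein p g n m x.
Proof.
move=> hg; elim: n m => [|n IH] m //=.
have /andP[p0 p1] := p01 x.
by rewrite lerD// ler_wpM2l// subr_ge0.
Qed.

Lemma bernstein_affine (h : nat -> R) a b n m x :
  bernstein p (fun k => a + b * h k) n m x = a + b * bernstein p h n m x.
Proof. by elim: n m => [|n IH] m //=; rewrite !IH; ring. Qed.

(** Squared bias plus the variance n p (1 - p) of the binomial variable. *)
Lemma bernstein_sqr (c : R) n m x :
  bernstein p (fun k => (k%:R - c) ^+ 2) n m x =
  (m%:R + n%:R * p x - c) ^+ 2 + n%:R * (p x * (1 - p x)).
Proof.
elim: n m => [|n IH] m /=; first by rewrite !mul0r !addr0.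
by rewrite !IH -!natr1; ring.
Qed.

Lemma bernstein_cst (c : R) n m x : bernstein p (fun=> c) n m x = c.
Proof. by elim: n m => [|n IH] m //=; rewrite !IH; ring. Qed.

Lemma bernstein_bounded (h : nat -> R) M n m x : (forall k, `|h k| <= M) ->
  `|bernstein p h n m x| <= M.
Proof.
move=> hM; rewrite ler_norml -[- M](bernstein_cst _ n m x).
rewrite -[X in _ && (_ <= X)](bernstein_cst _ n m x).
by rewrite !le_bernstein// => k; have := hM k; rewrite ler_norml => /andP[].
Qed.

(** The quadratic term is centred at the binomial mean, so it averages to [B] times the variance,
    which is at most n. *)
Lemma bernstein_approx (h : nat -> R) (y e B : R) n x : (0 < n)%N -> 0 <= B ->
  (forall k, `|h k - y| <= e + B * (k%:R - n%:R * p x) ^+ 2) ->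
  `|bernstein p h n 0 x - y| <= e + B * n%:R.
Proof.
move=> n0 B0 hy; have /andP[p0 p1] := p01 x.
have key : bernstein p (fun k => e + B * (k%:R - n%:R * p x) ^+ 2) n 0 x <=
    e + B * n%:R.
  rewrite bernstein_affine bernstein_sqr add0r subrr expr0n/= add0r.
  rewrite lerD2l ler_wpM2l// ler_piMr//; nra.
have sub s : bernstein p (fun k => - s * y + s * h k) n 0 x =
    s * (bernstein p h n 0 x - y).
  by rewrite bernstein_affine; ring.
rewrite ler_norml; apply/andP; split.
  have := sub (-1); rewrite mulN1r opprB => e1.
  rewrite lerNl opprB -e1 (le_trans _ key)//.
  apply: le_bernstein => k; rewrite (le_trans _ (hy k))// -normrN.
  by rewrite (le_trans _ (ler_norm _))// le_eqVlt; apply/orP; left; apply/eqP; ring.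
have := sub 1; rewrite mul1r => <-; rewrite (le_trans _ key)//.
apply: le_bernstein => k; rewrite (le_trans _ (hy k))//.
by rewrite (le_trans _ (ler_norm _))// le_eqVlt; apply/orP; left; apply/eqP; ring.
Qed.

End bernstein.

Section trigonometric_approximation.
Context {R : realType}.

(** The success probability of the binomial variable: an affine image of sin (x / K) in [0, 1] that,
    for K > 0, determines x on [-K, K]. *)
Definition half_sin (K x : R) : R := (1 + sin (x / K)) / 2.

Lemma half_sin01 (K x : R) : 0 <= half_sin K x <= 1.
Proof.
rewrite /half_sin; have := sin_le1 (x / K); have := sin_geN1 (x / K).
by move=> ? ?; apply/andP; split; lra.
Qed.

Definition clamp (s y : R) : R := Num.max (- s) (Num.min s y).

Lemma clamp_norm (s y : R) : 0 <= s -> `|clamp s y| <= s.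
Proof.
move=> s0; rewrite ler_norml /clamp le_max lexx/= ge_max ge_min lexx/= andbT.
by lra.
Qed.

Lemma clamp_dist (s y z : R) : `|z| <= s -> `|clamp s y - z| <= `|y - z|.
Proof.
rewrite ler_norml => /andP[z1 z2]; rewrite /clamp.
have [ys|ys] := leP s y.
  rewrite max_r; last by lra.
  by rewrite !ger0_norm; lra.
have [sy|sy] := leP (- s) y; first by [].
by rewrite !ler0_norm; lra.
Qed.

(* [asin] inverts [sin] on the clamped range, where it is Lipschitz. *)
Lemma trig_approx (f : R -> R) (L M K e : R) : 0 < K -> 0 < e ->
  (forall x y, `|f x - f y| <= L * `|x - y|) -> (forall x, `|f x| <= M) ->
  exists h : nat -> R, exists n : nat, (forall k, `|h k| <= M) /\
    forall x, `|x| <= K -> `|bernstein (half_sin K) h n 0 x - f x| <= e.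
Proof.
move=> K0 e0 fL fM.
have L0 : 0 <= `|L| by [].
have c0 := @cos1_gt0 R.
pose s : R := sin 1.
have s0 : 0 <= s by rewrite sin_ge0_pi// ler01 (le_trans _ (@pi_ge2 R))// ler1n.
have s1 : s <= 1 := sin_le1 1.
(* [C] bounds the variation of [f] in terms of [half_sin K x]; [B] comes from X <= e / 2 + X^2 / (2
   e), used with X = C |k / n - half_sin K x|. *)
pose C := 2 * `|L| * K / cos 1.
have C0 : 0 <= C by rewrite !mulr_ge0// ?invr_ge0 ltW.
pose B := C ^+ 2 / (2 * e).
have B0 : 0 <= B by rewrite mulr_ge0 ?sqr_ge0// invr_ge0 mulr_ge0// ltW.
pose n := (Num.truncn (2 * B / e)).+1.
have n0 : 0 < n%:R :> R by rewrite ltr0n.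
have nB : B / n%:R <= e / 2.
  rewrite ler_pdivrMr// mulrC -ler_pdivrMr ?divr_gt0//.
  have -> : B / (e / 2) = 2 * B / e by field; rewrite gt_eqF.
  by rewrite ltW// truncnS_gt.
(* k / n estimates [half_sin K x], so 2 k / n - 1 estimates sin (x / K). *)
exists (fun k => f (K * asin (clamp s (2 * k%:R / n%:R - 1)))), n.
split => [k|x xK]; first exact: fM.
rewrite (@le_trans _ _ (e / 2 + B / n%:R ^+ 2 * n%:R))//; last first.
  have -> : B / n%:R ^+ 2 * n%:R = B / n%:R by field; rewrite gt_eqF.
  by lra.
apply: bernstein_approx => //; first exact: half_sin01.
  by rewrite mulr_ge0// invr_ge0 sqr_ge0.
move=> k; set q := 2 * k%:R / n%:R - 1.
pose u := k%:R - n%:R * half_sin K x.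
have x1 : `|x / K| <= 1.
  by rewrite normrM normfV (gtr0_norm K0) ler_pdivrMr// mul1r.
have pi2 : 1 <= pi / 2 :> R := @pihalf_ge1 R.
have in_pi (z : R) : `|z| <= 1 -> z \in `[(- (pi / 2)), pi / 2].
  rewrite ler_norml in_itv/= => /andP[? ?]; apply/andP; split; lra.
have sx : `|sin (x / K)| <= s.
  have mono := @ltr_sin R.
  have h z : `|z| <= 1 -> sin z <= s.
    move=> z1; rewrite leNgt /s mono ?in_pi ?normr1//.
    by rewrite -leNgt (le_trans (ler_norm _)).
  by rewrite ler_norml h// andbT lerNl -sinN h// normrN.
have cl := clamp_norm q s0.
set v := clamp s q in cl *.
have v1 : -1 <= v <= 1.
  by move: cl; rewrite ler_norml => /andP[? ?]; apply/andP; split; lra.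
have av : sin (asin v) = v by rewrite asinK// in_itv.
have asin_in (z : R) : -1 <= z <= 1 -> asin z \in `[(- (pi / 2)), pi / 2].
  by move=> z1; rewrite in_itv/= asin_geNpi2// asin_lepi2.
have in1 : (1 : R) \in `[(- (pi / 2)), pi / 2] by apply: in_pi; rewrite normr1.
have inN1 : (-1 : R) \in `[(- (pi / 2)), pi / 2] by apply: in_pi; rewrite normrN normr1.
have av1 : `|asin v| <= 1.
  have ge z : -1 <= z <= 1 -> z <= s -> asin z <= 1.
    move=> z1 zs; rewrite leNgt; apply/negP => h.
    have : sin 1 < sin (asin z) by rewrite ltr_sin// asin_in.
    by rewrite asinK ?in_itv//= ltNge zs.
  have vs : v <= s by rewrite (le_trans (ler_norm _)).
  rewrite ler_norml ge// andbT leNgt; apply/negP => h.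
  have : sin (asin v) < sin (-1) by rewrite ltr_sin// asin_in.
  rewrite av sinN -/s => h2.
  by move: cl; rewrite ler_norml => /andP[h3 _]; lra.
have d1 : cos 1 * `|asin v - x / K| <= `|q - sin (x / K)|.
  apply: (le_trans (sin_lower_lipschitz av1 x1)); rewrite av.
  exact: clamp_dist.
have qu : q - sin (x / K) = 2 * u / n%:R.
  by rewrite /q /u /half_sin; field; rewrite !gt_eqF.
have d2 : `|f (K * asin v) - f x| <= C * (`|u| / n%:R).
  rewrite (le_trans (fL _ _))//.
  have -> : K * asin v - x = K * (asin v - x / K) by field; rewrite gt_eqF.
  rewrite normrM gtr0_norm//.
  have : `|asin v - x / K| <= 2 * (`|u| / n%:R) / cos 1.
    rewrite ler_pdivlMr// mulrC (le_trans d1)// qu !normrM normfV.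
    by rewrite (ger0_norm (ler0n _ 2)) (ger0_norm (ltW n0)) mulrA.
  move=> h.
  have -> : C * (`|u| / n%:R) = `|L| * (K * (2 * (`|u| / n%:R) / cos 1)).
    by rewrite /C; field; rewrite !gt_eqF.
  apply: (@le_trans _ _ (`|L| * (K * `|asin v - x / K|))).
    by rewrite ler_wpM2r ?ler_norm// mulr_ge0// ltW.
  by rewrite ler_wpM2l// ler_wpM2l// ltW.
rewrite (le_trans d2)//.
have -> : B / n%:R ^+ 2 * u ^+ 2 = (C * (`|u| / n%:R)) ^+ 2 / (2 * e).
  by rewrite -(real_normK (num_real u)) /B; field; rewrite !gt_eqF.
set X := C * _.
rewrite -subr_ge0 (_ : _ - X = (X - e) ^+ 2 / (2 * e)); last first.
  by field; rewrite gt_eqF.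
by rewrite divr_ge0 ?sqr_ge0// mulr_ge0// ltW.
Qed.

End trigonometric_approximation.

(** * From cosine transforms to weak convergence *)

Lemma continuous_cos_affine (R : realType) (t c : R) :
  continuous (fun x => cos (t * x + c)).
Proof.
move=> x; apply: (@continuous_comp _ _ _ (fun x => t * x + c) cos).
  by apply: cvgD; [apply: cvgM; [exact: cvg_cst|exact: cvg_id]|exact: cvg_cst].
exact: continuous_cos.
Qed.

Lemma measurable_cos_affine (R : realType) (t c : R) :
  measurable_fun [set: R] (fun x => cos (t * x + c)).
Proof. by apply: continuous_measurable_fun; exact: continuous_cos_affine. Qed.

Section trigonometric_convergence.
Context {R : realType} d (T : measurableType d) (P : probability T R).
Variables (Y : nat -> T -> R) (mu : probability R R).
Hypothesis mY : forall k, measurable_fun [set: T] (Y k).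
Hypothesis cosY : forall t c : R,
  \int[P]_w cos (t * Y k w + c) @[k --> \oo] --> \int[mu]_x cos (t * x + c).

(** Admitting every frequency [t] and phase [c] makes this class stable under multiplication by
    [half_sin K], hence large enough to contain the Bernstein polynomials. *)
Definition cos_cvg (g : R -> R) : Prop :=
  [/\ measurable_fun [set: R] g, exists M, forall x, `|g x| <= M &
  forall t c : R, \int[P]_w (g (Y k w) * cos (t * Y k w + c)) @[k --> \oo] -->
    \int[mu]_x (g x * cos (t * x + c))].

Lemma mul_cos_L1 d' (T' : measurableType d') (Q : probability T' R)
    (X : T' -> R) (g : R -> R) (M t c : R) :
  measurable_fun [set: T'] X -> measurable_fun [set: R] g ->
  (forall x, `|g x| <= M) -> L1 Q (fun w => g (X w) * cos (t * X w + c)).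
Proof.
move=> mX mg gM; apply: (@L1_bounded _ _ _ _ _ M).
  apply: (measurableT_comp (f := fun x => g x * cos (t * x + c))) => //.
  by apply: measurable_funM => //; exact: measurable_cos_affine.
move=> w; rewrite normrM (le_trans _ (gM (X w)))// ler_piMr//.
exact: cos_max.
Qed.

Lemma cos_cvg_cst a : cos_cvg (fun=> a).
Proof.
split => //; first by exists `|a|.
(* Stated for any space, to be used both for [Y k] and, with the identity as variable, for the limit
   law. *)
move=> t c; have L d' (T' : measurableType d') (Q : probability T' R)
    (X : T' -> R) : measurable_fun [set: T'] X ->
    \int[Q]_w (a * cos (t * X w + c)) = a * \int[Q]_w cos (t * X w + c).
  move=> mX; rewrite ExZ//; apply: (@L1_bounded _ _ _ _ _ 1) => [|w].
    exact: (measurableT_comp (measurable_cos_affine t c) mX).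
  exact: cos_max.
under eq_fun do rewrite L//.
by rewrite (L _ _ mu id)//; apply: cvgM; [exact: cvg_cst|exact: cosY].
Qed.

Lemma cos_cvgD (g h : R -> R) : cos_cvg g -> cos_cvg h ->
  cos_cvg (fun x => g x + h x).
Proof.
move=> [mg [M gM] cg] [mh [N hN] ch]; split.
- exact: measurable_funD.
- by exists (M + N) => x; rewrite (le_trans (ler_normD _ _))// lerD.
- move=> t c; have L d' (T' : measurableType d') (Q : probability T' R)
    (X : T' -> R) : measurable_fun [set: T'] X ->
    \int[Q]_w ((g (X w) + h (X w)) * cos (t * X w + c)) =
    \int[Q]_w (g (X w) * cos (t * X w + c)) +
    \int[Q]_w (h (X w) * cos (t * X w + c)).
    move=> mX; rewrite -ExD; [|exact: mul_cos_L1 gM|exact: mul_cos_L1 hN].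
    by apply: eq_Rintegral => w _; rewrite mulrDl.
  under eq_fun do rewrite L//.
  by rewrite (L _ _ mu id)//; apply: cvgD.
Qed.

(** By the product formula, sin (x / K) cos (t x + c) is a combination of two sines with frequencies
    1/K + t and 1/K - t; the phase - pi / 2 turns them into cosines. *)
Lemma cos_cvg_half_sin (K a b : R) (g : R -> R) : cos_cvg g ->
  cos_cvg (fun x => (a + b * half_sin K x) * g x).
Proof.
move=> [mg [M gM] cg].
have mhs : measurable_fun [set: R] (half_sin K).
  rewrite (_ : half_sin K = fun x => (1 + cos (K^-1 * x + (- (pi / 2)))) / 2).
    apply: measurable_funM => //; apply: measurable_funD => //.
    exact: measurable_cos_affine.
  by apply/funext => x; rewrite /half_sin cosBpihalf [K^-1 * x]mulrC.
split.
- by apply: measurable_funM => //; apply: measurable_funD => //; exact: measurable_funM.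
- exists ((`|a| + `|b|) * M) => x; rewrite normrM.
  rewrite ler_pM// (le_trans (ler_normD _ _))// lerD2l normrM ler_piMr//.
  by have /andP[? ?] := half_sin01 K x; rewrite ger0_norm.
- move=> t c; pose q := - (pi / 2) : R.
  have L d' (T' : measurableType d') (Q : probability T' R)
    (X : T' -> R) : measurable_fun [set: T'] X ->
    \int[Q]_w ((a + b * half_sin K (X w)) * g (X w) * cos (t * X w + c)) =
    (a + b / 2) * \int[Q]_w (g (X w) * cos (t * X w + c)) +
    (b / 4) * \int[Q]_w (g (X w) * cos ((t + K^-1) * X w + (c + q))) +
    (b / 4) * \int[Q]_w (g (X w) * cos ((K^-1 - t) * X w + (q - c))).
    move=> mX; have I t' c' : L1 Q (fun w => g (X w) * cos (t' * X w + c')).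
      exact: mul_cos_L1 gM.
    rewrite -!ExZ; [|exact: I..].
    have I1 := L1Z (a + b / 2) (I t c).
    have I2 := L1Z (b / 4) (I (t + K^-1) (c + q)).
    have I3 := L1Z (b / 4) (I (K^-1 - t) (q - c)).
    rewrite -(ExD I1 I2) -(ExD (L1D I1 I2) I3).
    apply: eq_Rintegral => w _.
    have -> : (t + K^-1) * X w + (c + q) = (t * X w + c) + (X w / K) - pi / 2.
      by rewrite /q; ring.
    have -> : (K^-1 - t) * X w + (q - c) = (X w / K) - (t * X w + c) - pi / 2.
      by rewrite /q; ring.
    rewrite !cosBpihalf /half_sin sinD sinB.
    by field.
  under eq_fun do rewrite L//.
  rewrite (L _ _ mu id)//.
  by apply: cvgD; [apply: cvgD|]; (apply: cvgM; [exact: cvg_cst|exact: cg]).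
Qed.

Lemma cos_cvg_bernstein (K : R) (h : nat -> R) n m :
  cos_cvg (bernstein (half_sin K) h n m).
Proof.
elim: n m => [|n IH] m; first exact: cos_cvg_cst.
have := cos_cvgD (cos_cvg_half_sin K 0 1 (IH m.+1)) (cos_cvg_half_sin K 1 (-1) (IH m)).
rewrite (_ : (fun _ => _) = bernstein (half_sin K) h n.+1 m)//.
by apply/funext => x /=; rewrite add0r mul1r mulN1r.
Qed.

(* Off [-K, K] the trigonometric approximation of f is only bounded, and
   Chebyshev's inequality takes over. *)
Lemma trig_cvg_lipschitz (C : R) : (forall k, L2 P (Y k)) ->
  (forall k, \int[P]_w (Y k w ^+ 2) <= C) -> L2 mu id ->
  \int[mu]_x (x ^+ 2) <= C ->
  forall (f : R -> R) (L M : R), (forall x y, `|f x - f y| <= L * `|x - y|) ->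
  (forall x, `|f x| <= M) ->
  \int[P]_w f (Y k w) @[k --> \oo] --> \int[mu]_x f x.
Proof.
move=> sY YC smu muC f L M fL fM; apply/cvgrPdist_le => e e0.
have M0 : 0 <= M by exact: le_trans (fM 0).
have C0 : 0 <= C by apply: le_trans muC; apply: Ex_ge0 => x; exact: sqr_ge0.
(* One fifth of [e] goes to the convergence of the transforms and two to each replacement of [f] by
   [g]. As [K] is at least 1, K^2 >= K, which brings the Chebyshev tail 2 M C / K^2 below e / 5. *)
have e5 : 0 < e / 5 by rewrite divr_gt0.
pose K := 1 + 2 * M * C / (e / 5).
have K1 : 1 <= K by rewrite lerDl !mulr_ge0// invr_ge0 ltW.
have K0 : 0 < K by lra.
have KC : 2 * M / K ^+ 2 * C <= e / 5.
  rewrite mulrAC ler_pdivrMr ?exprn_gt0// [leRHS]mulrC -ler_pdivrMr//.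
  have h : 2 * M * C / (e / 5) <= K by rewrite lerDr.
  by rewrite (le_trans h)// ler_eXnr.
have [h [n [hM hf]]] := trig_approx K0 e5 fL fM.
pose g := bernstein (half_sin K) h n 0.
have gM x : `|g x| <= M by apply: bernstein_bounded => //; exact: half_sin01.
have [mg _ cg] := cos_cvg_bernstein K h n 0.
have fg x : `|f x - g x| <= e / 5 + 2 * M / K ^+ 2 * x ^+ 2.
  have [xK|xK] := leP `|x| K.
    rewrite distrC (le_trans (hf x xK))// lerDl mulr_ge0 ?sqr_ge0//.
    by rewrite !mulr_ge0// invr_ge0 sqr_ge0.
  rewrite (@le_trans _ _ (2 * M))//.
    by rewrite (le_trans (ler_normB _ _))// mulr_natl mulr2n lerD.
  rewrite -[leLHS]add0r lerD//; first exact: ltW.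
  rewrite mulrAC ler_pdivlMr ?exprn_gt0// ler_wpM2l ?mulr_ge0//.
  by rewrite -[leRHS]real_normK ?num_real// lerXn2r ?nnegrE// ltW.
have mf : measurable_fun [set: R] f.
  by apply: continuous_measurable_fun; exact: lipschitz_continuous fL.
have close d' (T' : measurableType d') (Q : probability T' R) (X : T' -> R) :
    L2 Q X -> \int[Q]_w (X w ^+ 2) <= C ->
    `|\int[Q]_w f (X w) - \int[Q]_w g (X w)| <= 2 * (e / 5).
  move=> sX XC; have mX := L2_measurable sX.
  have i1 := L1_cst Q (e / 5).
  have i2 := L1Z (2 * M / K ^+ 2) (L2_sqr sX).
  apply: (le_trans (Ex_dist_le _ _ (L1D i1 i2) (fun w => fg (X w)))).
  - apply: (@L1_bounded _ _ _ _ _ M) => //; exact: measurableT_comp.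
  - apply: (@L1_bounded _ _ _ _ _ M) => //; exact: (measurableT_comp mg mX).
  rewrite ExD// Ex_cst ExZ; last exact: L2_sqr.
  have : 2 * M / K ^+ 2 * \int[Q]_w (X w ^+ 2) <= 2 * M / K ^+ 2 * C.
    by rewrite ler_wpM2l// !mulr_ge0// invr_ge0 sqr_ge0.
  by lra.
have /cvgrPdist_le/(_ _ e5) := cg 0 0.
have simp d' (T' : measurableType d') (Q : probability T' R) (X : T' -> R) :
    \int[Q]_w (g (X w) * cos (0 * X w + 0)) = \int[Q]_w g (X w).
  by apply: eq_Rintegral => w _; rewrite mul0r addr0 cos0 mulr1.
apply: filterS => k; rewrite (simp _ _ mu id) simp => h1.
have := close _ _ mu id smu muC.
have := close _ _ P (Y k) (sY k) (YC k).
move: h1; rewrite !ler_norml => /andP[? ?] /andP[? ?] /andP[? ?].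
by apply/andP; split; lra.
Qed.

End trigonometric_convergence.

(** * The normal law *)

Section normal_law.
Context {R : realType}.
Notation mu := (@lebesgue_measure R).
Notation gam := (@normal_pdf R 0 1).
Local Notation N := (std_normal R).

(** The Radon-Nikodym derivative of the law with respect to Lebesgue measure is almost everywhere
    the density, because both have the same integral over every measurable set. *)
Lemma ge0_integral_std_normal (f : R -> \bar R) :
  measurable_fun [set: R] f -> (forall x, 0 <= f x)%E ->
  (\int[N]_x f x = \int[mu]_x (f x * (gam x)%:E))%E.
Proof.
move=> mf f0.
rewrite /std_normal ge0_integral_distribution//.
have dom := @normal_prob_dominates R 0 1.
pose nu : {finite_measure set (measurableTypeR R) -> \bar R} := normal_prob 0 1.
have -> : (\int[normal_prob 0 1]_x (f \o @of_measurableTypeR R) x =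
    \int[nu]_x f x)%E by [].
have nu_mu : nu `<< mu by exact: dom.
rewrite -(Radon_Nikodym_SigmaFinite.change_of_variables nu_mu)//.
have mRN := measurable_int _ (Radon_Nikodym_SigmaFinite.f_integrable nu_mu).
apply: ae_eq_integral => //.
- exact: emeasurable_funM.
- by apply: emeasurable_funM => //; apply/measurable_EFinP; exact: measurable_normal_pdf.
apply: ae_eqe_mul2l; apply: integral_ae_eq => //.
- exact: Radon_Nikodym_SigmaFinite.f_integrable.
- by apply/measurable_EFinP; exact: measurable_normal_pdf.
- by move=> A _ mA; rewrite -Radon_Nikodym_SigmaFinite.f_integral.
Qed.

(** The signed case follows from the nonnegative one through f = (|f| + f) - |f|. *)
Lemma std_normal_transfer (f : R -> R) : measurable_fun [set: R] f ->
  mu.-integrable [set: R] (fun x => (f x * gam x)%:E) ->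
  L1 N f /\ \int[N]_x f x = \int[mu]_x (f x * gam x).
Proof.
move=> mf iF.
have g0 x : 0 <= gam x := normal_pdf_ge0 0 1 x.
have mabs : measurable_fun [set: R] (fun x => `|f x|) by exact: measurableT_comp.
have E (h : R -> R) : measurable_fun [set: R] h -> (forall x, 0 <= h x) ->
    (\int[N]_x (h x)%:E = \int[mu]_x (h x * gam x)%:E)%E.
  move=> mh h0; rewrite ge0_integral_std_normal.
  - by apply: eq_integral => x _; rewrite EFinM.
  - exact/measurable_EFinP.
  - by move=> x; rewrite lee_fin.
have iabs : mu.-integrable [set: R] (fun x => (`|f x| * gam x)%:E).
  rewrite (_ : (fun _ => _) = abse \o (fun x => (f x * gam x)%:E)).
    exact: integrable_abse.
  by apply/funext => x /=; rewrite normrM (ger0_norm (g0 x)).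
have Labs : L1 N (fun x => `|f x|).
  apply/integrableP; split; first exact/measurable_EFinP.
  under eq_integral do rewrite /= normr_id.
  rewrite E//; have /integrableP[_] := iabs.
  apply: le_lt_trans; rewrite le_eqVlt; apply/orP; left; apply/eqP.
  by apply: eq_integral => x _; rewrite gee0_abs// lee_fin mulr_ge0.
have Lf : L1 N f by exact: L1_le Labs _.
split => //.
have -> : \int[N]_x f x = \int[N]_x (`|f x| + f x) - \int[N]_x `|f x|.
  by rewrite ExD// addrAC subrr add0r.
have EF (h : R -> R) : measurable_fun [set: R] h -> (forall x, 0 <= h x) ->
    \int[N]_x h x = \int[mu]_x (h x * gam x).
  by move=> mh h0; rewrite /Rintegral E.
rewrite EF; last 2 first.
- exact: measurable_funD.
- by move=> x; have := ler_norm (- f x); rewrite normrN; lra.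
rewrite EF//.
have -> : \int[mu]_x ((`|f x| + f x) * gam x) =
    \int[mu]_x (`|f x| * gam x) + \int[mu]_x (f x * gam x).
  by rewrite -RintegralD//; apply: eq_Rintegral => x _; rewrite mulrDl.
by rewrite addrAC subrr add0r.
Qed.

Lemma normal_pdfE0 (s x : R) : s != 0 ->
  normal_pdf 0 s x = normal_peak s * expR (- (x ^+ 2 / (s ^+ 2 * 2))).
Proof.
move=> s0; rewrite normal_pdfE// -[LHS]/(normal_peak s * normal_fun 0 s x).
by rewrite /normal_fun subr0 mulNr mulr_natr.
Qed.

Lemma normal_pdf_exp (x : R) : gam x = normal_peak 1 * expR (- (x ^+ 2 / 2)).
Proof. by rewrite normal_pdfE0 ?oner_eq0// expr1n mul1r. Qed.

(** Domination by the density of standard deviation 2, already known to be integrable, spares the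
    computation of a second moment: x^2 / 4 <= exp(x^2 / 4) absorbs the square. *)
Lemma sqr_mul_normal_pdf_le (x : R) :
  x ^+ 2 * gam x <= 4 * normal_peak 1 / normal_peak 2 * normal_pdf 0 2 x.
Proof.
rewrite normal_pdf_exp normal_pdfE0 ?pnatr_eq0//.
have p1 : 0 < normal_peak (1 : R) by apply: normal_peak_gt0; rewrite oner_eq0.
have p2 : 0 < normal_peak (2 : R) by apply: normal_peak_gt0; rewrite pnatr_eq0.
have e1 : x ^+ 2 / 4 <= expR (x ^+ 2 / 4).
  by rewrite (le_trans _ (expR_ge1Dx _))// lerDr.
have e2 : x ^+ 2 <= 4 * expR (x ^+ 2 / 4) by lra.
have -> : expR (- (x ^+ 2 / (2 ^+ 2 * 2))) = expR (x ^+ 2 / 4) * expR (- (3 * x ^+ 2 / 8)).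
  by rewrite -expRD; congr expR; field.
have -> : 4 * normal_peak 1 / normal_peak 2 *
    (normal_peak 2 * (expR (x ^+ 2 / 4) * expR (- (3 * x ^+ 2 / 8)))) =
    (4 * expR (x ^+ 2 / 4)) * (normal_peak 1 * expR (- (3 * x ^+ 2 / 8))).
  by field; rewrite gt_eqF.
apply: ler_pM => //; first exact: sqr_ge0.
  by rewrite mulr_ge0 ?expR_ge0// ltW.
rewrite ler_pM2l// ler_expR lerN2.
by have := sqr_ge0 x; lra.
Qed.

Lemma integrable_normal_pdf_le (f : R -> R) (C : R) :
  measurable_fun [set: R] f -> (forall x, `|f x| <= C * (1 + x ^+ 2)) ->
  mu.-integrable [set: R] (fun x => (f x * gam x)%:E).
Proof.
move=> mf fC; pose D := 4 * normal_peak (1 : R) / normal_peak 2.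
have C0 : 0 <= C.
  have := fC 0; rewrite expr0n/= addr0 mulr1; exact: le_trans.
have i1 := integrable_normal_pdf (0 : R) 1.
have i2 := integrable_normal_pdf (0 : R) 2.
have i3 := integrableD measurableT (integrableZl measurableT C i1)
  (integrableZl measurableT (C * D) i2).
apply: le_integrable i3 => //.
  by apply/measurable_EFinP; apply: measurable_funM => //; exact: measurable_normal_pdf.
move=> x _ /=; have g0 := normal_pdf_ge0 0 1 x.
have := sqr_mul_normal_pdf_le x; rewrite -/D => h.
rewrite lee_fin [leRHS]ger0_norm; last first.
  by rewrite addr_ge0// !mulr_ge0// ?normal_pdf_ge0// ?invr_ge0 ?normal_peak_ge0.
rewrite normrM (ger0_norm g0) (le_trans (ler_wpM2r g0 (fC x)))//.
have := ler_wpM2l C0 h; lra.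
Qed.

Lemma std_normal_L1 (f : R -> R) (C : R) : measurable_fun [set: R] f ->
  (forall x, `|f x| <= C * (1 + x ^+ 2)) ->
  L1 N f /\ \int[N]_x f x = \int[mu]_x (f x * gam x).
Proof.
by move=> mf fC; apply: std_normal_transfer => //; exact: integrable_normal_pdf_le fC.
Qed.

Lemma std_normal_L2 : L2 N id.
Proof.
split => //.
have h (x : R) : `|x ^+ 2| <= 1 * (1 + x ^+ 2).
  by rewrite mul1r ger0_norm ?sqr_ge0// lerDr.
by have [] := std_normal_L1 (@measurable_sqr R) h.
Qed.

Lemma continuous_sin_affine (t c : R) : continuous (fun x => sin (t * x + c)).
Proof.
rewrite (_ : (fun _ => _) = (fun x => cos (t * x + (c - pi / 2)))).
  exact: continuous_cos_affine.
by apply/funext => x; rewrite addrA cosBpihalf.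
Qed.

Lemma measurable_sin_affine (t c : R) :
  measurable_fun [set: R] (fun x => sin (t * x + c)).
Proof. by apply: continuous_measurable_fun; exact: continuous_sin_affine. Qed.

(** The antiderivative behind Stein's identity; the factor x comes from phi'(x) = - x phi(x) for the
    density phi. *)
Lemma is_derive_sin_normal_pdf (t c x : R) :
  is_derive x 1 (fun y => - (sin (t * y + c) * gam y))
    ((x * sin (t * x + c) - t * cos (t * x + c)) * gam x).
Proof.
have d1 : is_derive x 1 (fun y => t * y + c) t.
  have -> : (fun y : R => t * y + c) = (t \*: @id R) + cst c.
    by apply/funext => y; rewrite !fctE.
  by apply: is_derive_eq; rewrite addr0 /GRing.scale/= mulr1.
have d2 : is_derive x 1 (fun y => sin (t * y + c)) (cos (t * x + c) * t).
  exact: (is_derive1_comp (f := sin)).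
have d3 : is_derive x 1 (fun y : R => - (y ^+ 2 / 2)) (- x).
  have -> : (fun y : R => - (y ^+ 2 / 2)) = - (2^-1 \*: (@id R ^+ 2)).
    by apply/funext => z; rewrite /= !fctE /= mulrC.
  apply: is_derive_eq.
  by rewrite expr1 /GRing.scale/= mulr1 mulKf ?pnatr_eq0.
have d4 : is_derive x 1 gam (- x * gam x).
  have -> : gam = normal_peak 1 \*: (fun y => expR (- (y ^+ 2 / 2))).
    by apply/funext => y; rewrite normal_pdf_exp.
  have d5 : is_derive x 1 (fun y => expR (- (y ^+ 2 / 2))) (expR (- (x ^+ 2 / 2)) * - x).
    exact: (is_derive1_comp (f := expR)).
  by apply: is_derive_eq; rewrite /= /GRing.scale/=; ring.
have -> : (fun y => - (sin (t * y + c) * gam y)) = - ((fun y => sin (t * y + c)) * gam).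
  by apply/funext.
by apply: is_derive_eq; rewrite /GRing.scale/=; ring.
Qed.

Let g_bound (t c x : R) :
  `|x * sin (t * x + c) - t * cos (t * x + c)| <= (1 + `|t|) * (1 + x ^+ 2).
Proof.
rewrite (le_trans (ler_normB _ _))// !normrM.
have h1 : `|x| * `|sin (t * x + c)| <= 1 + x ^+ 2.
  rewrite (@le_trans _ _ `|x|)//; first by rewrite ler_piMr// sin_max.
  rewrite -(real_normK (num_real x)); have := normr_ge0 x; nra.
have h2 : `|t| * `|cos (t * x + c)| <= `|t| by rewrite ler_piMr// cos_max.
by have := mulr_ge0 (normr_ge0 t) (sqr_ge0 x); lra.
Qed.

Let measurable_g (t c : R) :
  measurable_fun [set: R] (fun x => x * sin (t * x + c) - t * cos (t * x + c)).
Proof.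
apply: measurable_funB; apply: measurable_funM => //.
  exact: measurable_sin_affine.
exact: measurable_cos_affine.
Qed.

Lemma normal_pdf_cvg0 : gam n%:R @[n --> \oo] --> (0 : R).
Proof.
apply/cvgrPdist_le => e e0.
have p1 : 0 < normal_peak (1 : R) by apply: normal_peak_gt0; rewrite oner_eq0.
exists (Num.truncn (2 * normal_peak 1 / e)).+1 => // n /= hn.
have n1 : (1 <= n)%N by exact: leq_trans hn.
have n0 : 0 < n%:R :> R by rewrite ltr0n.
rewrite sub0r normrN (ger0_norm (normal_pdf_ge0 0 1 _)) normal_pdf_exp expRN.
rewrite ler_pdivrMr ?expR_gt0//.
have h : 2 * normal_peak 1 / e <= n%:R :> R.
  by rewrite (le_trans (ltW (truncnS_gt _)))// ler_nat.
have h2 : n%:R / 2 <= expR (n%:R ^+ 2 / 2) :> R.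
  rewrite (le_trans _ (expR_ge1Dx _))// (@le_trans _ _ (n%:R ^+ 2 / 2))// ?lerDr//.
  by rewrite ler_wpM2r// expr2 ler_peMr ?ler1n// ltW.
rewrite (@le_trans _ _ (e * (n%:R / 2)))//; last by rewrite ler_wpM2l// ltW.
by move: h; rewrite ler_pdivrMr//; lra.
Qed.

(** Stein's identity E X h(X) = E h'(X) for a sine. Over [-n, n] the difference of the two sides
    integrates to boundary terms, which vanish with the density; dominated convergence identifies
    the limit with the integral over the line. *)
Lemma std_normal_by_parts (t c : R) :
  \int[N]_x (x * sin (t * x + c)) = t * \int[N]_x cos (t * x + c).
Proof.
pose g x := x * sin (t * x + c) - t * cos (t * x + c).
pose A (n : nat) : set R := `[- n%:R, n%:R]%classic.
have C0 : 0 <= 1 + `|t| by rewrite addr_ge0.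
have mgA n : measurable_fun [set: R] (fun x => g x * \1_(A n) x).
  by apply: measurable_funM; [exact: measurable_g|by apply: measurable_indic; exact: measurable_itv].
have gAb n x : `|g x * \1_(A n) x| <= `|g x|.
  by rewrite indicE; case: (x \in A n); rewrite ?mulr1// mulr0 normr0.
have [Lg gE] := std_normal_L1 (measurable_g t c) (g_bound t c).
have lim1 : \int[N]_x (g x * \1_(A n) x) @[n --> \oo] --> \int[N]_x g x.
  apply: (@Ex_dominated_cvg _ _ _ N (fun n x => g x * \1_(A n) x) g (fun x => `|g x|)) => //.
    exact: L1_norm.
  move=> x; apply: cvg_near_cst; near=> n.
  rewrite indicE mem_set ?mulr1// /A /= in_itv/= -ler_norml.
  near: n; exact: nbhs_infty_ger.
have lim2 : \int[N]_x (g x * \1_(A n) x) @[n --> \oo] --> 0.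
  (* The interval of index 0 is a single point, hence the shift to n + 1. *)
  have E n : \int[N]_x (g x * \1_(A n.+1) x) =
     - (sin (t * n.+1%:R + c) * gam n.+1%:R) -
     - (sin (t * (- n.+1%:R) + c) * gam (- n.+1%:R)).
    have [_ ->] := @std_normal_L1 _ (1 + `|t|) (mgA n.+1)
      (fun x => le_trans (gAb n.+1 x) (g_bound t c x)).
    have -> : \int[mu]_x (g x * \1_(A n.+1) x * gam x) =
        \int[mu]_(x in A n.+1) (g x * gam x).
      rewrite [RHS]Rintegral_mkcond; apply: eq_Rintegral => x _.
      rewrite patchE indicE; case: ifPn => _; first by rewrite mulr1.
      by rewrite mulr0 mul0r.
    pose F y := - (sin (t * y + c) * gam y).
    have dF (y : R) : is_derive y 1 F (g y * gam y) by exact: is_derive_sin_normal_pdf.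
    have cF (y : R) : {for y, continuous F}.
      by apply: differentiable_continuous; apply/derivable1_diffP; case: (dF y).
    have cf : continuous (fun x => g x * gam x).
      move=> x; apply: cvgM; last exact/continuous_normal_pdf/oner_neq0.
      apply: cvgB; apply: cvgM;
        [exact: cvg_id|exact: continuous_sin_affine
        |exact: cvg_cst|exact: continuous_cos_affine].
    rewrite /Rintegral (@continuous_FTC2 R (fun x => g x * gam x) F)//.
    - by rewrite -subr_gt0 opprK addr_gt0.
    - exact: continuous_subspaceT.
    - split.
      + by move=> y _; case: (dF y).
      + exact/cvg_at_right_filter/cF.
      + exact/cvg_at_left_filter/cF.
    - by move=> y _; rewrite derive1E; case: (dF y).
  apply/cvgrPdist_le => e e0; have e20 : 0 < e / 2 by rewrite divr_gt0.
  have /cvgrPdist_le/(_ _ e20)[M _ hM] := normal_pdf_cvg0.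
  exists M.+1 => // -[//|n] /= Mn; rewrite sub0r normrN E.
  have even : gam (- n.+1%:R) = gam n.+1%:R by rewrite !normal_pdf_exp sqrrN.
  rewrite even (le_trans (ler_normB _ _))// !normrN !normrM.
  have g1 : `|gam n.+1%:R| <= e / 2.
    by have := hM n.+1 (ltnW Mn); rewrite sub0r normrN.
  have b (a : R) : `|sin a| * `|gam n.+1%:R| <= e / 2.
    by rewrite (le_trans _ g1)// ler_piMl// sin_max.
  by rewrite (splitr e) lerD.
have g0 : \int[N]_x g x = 0 by exact: (cvg_unique _ lim1 lim2).
have b1 (x : R) : `|x * sin (t * x + c)| <= 1 * (1 + x ^+ 2).
  rewrite normrM mul1r (@le_trans _ _ `|x|)//; first by rewrite ler_piMr// sin_max.
  rewrite -(real_normK (num_real x)); have := normr_ge0 x; nra.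
have L1s : L1 N (fun x => x * sin (t * x + c)).
  have m1 : measurable_fun [set: R] (fun x => x * sin (t * x + c)).
    by apply: measurable_funM => //; exact: measurable_sin_affine.
  by have [] := std_normal_L1 m1 b1.
have L1c : L1 N (fun x => cos (t * x + c)).
  apply: (@L1_bounded _ _ _ _ _ 1); first exact: measurable_cos_affine.
  by move=> x; exact: cos_max.
move: g0; rewrite /g ExB//; last exact: L1Z.
by rewrite ExZ// => /eqP; rewrite subr_eq0 => /eqP.
Unshelve. all: by end_near. Qed.

End normal_law.

(** Serves to differentiate under an integral: a quadratic Taylor bound that holds pointwise can be
    integrated and then yields the derivative. *)
Lemma is_derive_quadratic (R : realType) (f : R -> R) (t a C : R) :
  (forall h, `|f (t + h) - f t - h * a| <= C * h ^+ 2) -> is_derive t 1 f a.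
Proof.
move=> fC.
have C0 : 0 <= `|C| + 1 by rewrite addr_ge0.
have lim : h^-1 *: ((f \o shift t) (h *: 1) - f t) @[h --> 0^'] --> a.
  apply/cvgrPdist_le => e e0; near=> h.
  have h0 : h != 0 by near: h; exact: nbhs_dnbhs_neq.
  have hr : `|h| <= e / (`|C| + 1).
    by near: h; apply: dnbhs0_le; rewrite divr_gt0// ltr_wpDl.
  rewrite /= scaler1 [h + t]addrC.
  have -> : a - h^-1 *: (f (t + h) - f t) = - (h^-1 * (f (t + h) - f t - h * a)).
    by rewrite /GRing.scale/=; field.
  rewrite normrN normrM normfV mulrC ler_pdivrMr ?normr_gt0//.
  rewrite (le_trans (fC h))// -(real_normK (num_real h)) expr2 mulrA.
  rewrite ler_wpM2r// (@le_trans _ _ ((`|C| + 1) * `|h|))//.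
    by rewrite ler_wpM2r// (le_trans (ler_norm C))// lerDl.
  by rewrite mulrC -ler_pdivlMr// ltr_wpDl.
by apply: DeriveDef; [apply/cvg_ex; exists a|exact: cvg_lim].
Unshelve. all: by end_near. Qed.

Lemma cos_taylor2 (R : realType) (a b : R) :
  `|cos (a + b) - cos a + b * sin a| <= 3 * b ^+ 2.
Proof.
have -> : cos (a + b) - cos a + b * sin a =
    - ((1 - cos b) * cos a) - (sin b - b) * sin a by rewrite cosD; ring.
have h1 : `|1 - cos b| <= b ^+ 2 / 2.
  by rewrite ger0_norm ?subr_ge0 ?cos_le1// onem_cos_le.
have h2 : `|sin b - b| <= 2 * b ^+ 2.
  have m1 : Num.min 1 `|b| <= 1 by rewrite ge_min lexx.
  rewrite (le_trans (sin_taylor b))// /cub.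
  by have := ler_wpM2l (sqr_ge0 b) m1; lra.
rewrite (le_trans (ler_normB _ _))// normrN !normrM.
have h3 : `|1 - cos b| * `|cos a| <= b ^+ 2 / 2.
  by rewrite (le_trans _ h1)// ler_piMr// cos_max.
have h4 : `|sin b - b| * `|sin a| <= 2 * b ^+ 2.
  by rewrite (le_trans _ h2)// ler_piMr// sin_max.
by have := sqr_ge0 b; lra.
Qed.

(** * The cosine transform of the normal law *)

Section normal_cos_transform.
Context {R : realType}.
Local Notation N := (std_normal R).

Let L1_cos (t c : R) : L1 N (fun x => cos (t * x + c)).
Proof.
apply: (@L1_bounded _ _ _ _ _ 1); first exact: measurable_cos_affine.
by move=> x; exact: cos_max.
Qed.

Let L1_xsin (t c : R) : L1 N (fun x => x * sin (t * x + c)).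
Proof.
apply: L2_mul; first exact: std_normal_L2.
apply: (@L2_bounded _ _ _ _ _ 1); first exact: measurable_sin_affine.
by move=> x; exact: sin_max.
Qed.

(** Differentiation under the integral gives - E X sin (t X + c), which [std_normal_by_parts] turns
    into a linear differential equation in [t]. *)
Lemma is_derive_normal_cos (t c : R) :
  is_derive t 1 (fun t => \int[N]_x cos (t * x + c))
    (- (t * \int[N]_x cos (t * x + c))).
Proof.
apply: (@is_derive_quadratic _ _ _ _ (3 * \int[N]_x (x ^+ 2))) => h.
rewrite -std_normal_by_parts mulrN opprK -ExZ//.
rewrite -ExB// -ExD//; [|exact: L1B|exact: L1Z].
rewrite mulrAC -ExZ; last exact: L2_sqr std_normal_L2.
have i : L1 N (fun x => 3 * h ^+ 2 * x ^+ 2).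
  by apply: L1Z; exact: L2_sqr std_normal_L2.
apply: le_trans (ler_norm_Ex _) _.
  by apply: L1D; [exact: L1B|exact: L1Z].
apply: le_Ex => //.
  by apply: L1_norm; apply: L1D; [exact: L1B|exact: L1Z].
move=> x; have -> : (t + h) * x + c = (t * x + c) + h * x by ring.
rewrite [h * (x * _)]mulrA.
by rewrite (le_trans (cos_taylor2 _ _))// exprMn mulrA.
Qed.

(** The equation u' = - t u makes exp(t^2 / 2) u constant, with value cos c at t = 0. *)
Lemma normal_cos (t c : R) :
  \int[N]_x cos (t * x + c) = expR (- (t ^+ 2 / 2)) * cos c.
Proof.
pose u t := \int[N]_x cos (t * x + c).
pose v t := expR (t ^+ 2 / 2) * u t.
have dv (s : R) : is_derive s 1 v 0.
  have d1 : is_derive s 1 (fun y : R => y ^+ 2 / 2) s.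
    have -> : (fun y : R => y ^+ 2 / 2) = (2^-1 \*: (@id R ^+ 2)).
      by apply/funext => z; rewrite /= !fctE /= mulrC.
    apply: is_derive_eq.
    by rewrite expr1 /GRing.scale/= mulr1 mulKf ?pnatr_eq0.
  have d2 : is_derive s 1 (fun y => expR (y ^+ 2 / 2)) (expR (s ^+ 2 / 2) * s).
    exact: (is_derive1_comp (f := expR)).
  have d3 : is_derive s 1 u (- (s * u s)) := is_derive_normal_cos s c.
  have -> : v = (fun y => expR (y ^+ 2 / 2)) * u by apply/funext.
  by apply: is_derive_eq; rewrite /GRing.scale/=; ring.
have : v t = v 0 by exact: is_derive_0_is_cst.
rewrite /v expr0n/= mul0r expR0 mul1r /u.
under [X in _ = X]eq_Rintegral do rewrite mul0r add0r.
by rewrite Ex_cst expRN => <-; rewrite mulKf// gt_eqF ?expR_gt0.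
Qed.

End normal_cos_transform.

(** * Off-diagonal products *)

Section transfer_of_law.
Context {R : realType} d (T : measurableType d) (P : probability T R)
  d' (T' : measurableType d') (P' : probability T' R).

Lemma eq_law_transfer (X : {RV P >-> R}) (X' : {RV P' >-> R}) (g : R -> R) :
  eq_law (distribution P X) (distribution P' X') ->
  measurable_fun [set: R] g -> L1 P' (fun w => g (X' w)) ->
  L1 P (fun w => g (X w)) /\ \int[P]_w g (X w) = \int[P']_w g (X' w).
Proof.
move=> XX' mg i'.
have mgE : measurable_fun [set: R] (EFin \o g) by exact/measurable_EFinP.
have mgX : measurable_fun [set: T] (fun w => g (X w)).
  exact: (measurableT_comp mg).
have eqm (f : R -> \bar R) :
    (\int[distribution P X]_x f x = \int[distribution P' X']_x f x)%E.
  by apply: eq_measure_integral => S mS _; exact: XX'.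
have i : L1 P (fun w => g (X w)).
  apply/integrableP; split; first exact/measurable_EFinP.
  have mabs : measurable_fun [set: R] (abse \o (EFin \o g)).
    exact: measurableT_comp.
  have abs0 y : (0 <= (abse \o (EFin \o g)) y)%E by exact: abse_ge0.
  rewrite -(@ge0_integral_distribution _ _ _ _ R P X (abse \o (EFin \o g)))//.
  rewrite eqm ge0_integral_distribution//.
  by have /integrableP[] := i'.
split => //; rewrite /Rintegral.
have -> : (\int[P]_w (g (X w))%:E = \int[distribution P X]_x (EFin \o g) x)%E.
  by rewrite integral_distribution.
have -> : (\int[P']_w (g (X' w))%:E = \int[distribution P' X']_x (EFin \o g) x)%E.
  by rewrite integral_distribution.
by rewrite eqm.
Qed.

End transfer_of_law.

Lemma expR_le_quadratic (R : realType) (y : R) : `|y| <= 2^-1 ->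
  expR y <= 1 + y + 2 * y ^+ 2.
Proof.
rewrite ler_norml => /andP[y1 y2].
have h : 1 - y <= expR (- y) by exact: expR_ge1Dx.
have h0 : 0 < 1 - y by lra.
have : expR y <= (1 - y)^-1.
  by rewrite -[y in expR y]opprK expRN lef_pV2 ?posrE ?expR_gt0.
move=> /le_trans; apply; rewrite -[leLHS]mul1r ler_pdivrMr//.
by have := sqr_ge0 y; nra.
Qed.

(** Lets exponential moments of the partial sums bound their sixth moment, which the third moment of
    a quadratic form requires. The constant comes from x / 6 <= exp(x / 6). *)
Lemma pow6_le_expR (R : realType) :
  exists2 C : R, 0 <= C & forall x, x ^+ 6 <= C * (expR x + expR (- x)).
Proof.
exists (6 ^+ 6); first exact: exprn_ge0.
move=> x; wlog x0 : x / 0 <= x => [h|].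
  have [|x0] := leP 0 x; first exact: h.
  have e6 : (- x) ^+ 6 = x ^+ 6 by ring.
  by have := h (- x); rewrite oppr_ge0 e6 opprK [expR (- x) + _]addrC; apply; exact: ltW.
have h : (x / 6) ^+ 6 <= expR x.
  have -> : expR x = expR (x / 6) ^+ 6 by rewrite -expRM_natl; congr expR; field.
  rewrite lerXn2r ?nnegrE ?expR_ge0//; first by rewrite divr_ge0.
  by rewrite (le_trans _ (expR_ge1Dx _))// lerDr.
have c0 : 0 < 6 ^+ 6 :> R by exact: exprn_gt0.
move: h; rewrite exprMn exprVn ler_pdivrMr// mulrC => h.
by rewrite (le_trans h)// ler_pM2l// lerDl expR_ge0.
Qed.

Lemma cube_add_le (R : realType) (p q : R) : 0 <= p -> 0 <= q ->
  (p + q) ^+ 3 <= 4 * (p ^+ 3 + q ^+ 3).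
Proof.
move=> p0 q0.
rewrite -subr_ge0 (_ : _ - _ = 3 * (p + q) * (p - q) ^+ 2); last by ring.
by rewrite mulr_ge0 ?sqr_ge0// mulr_ge0// addr_ge0.
Qed.

(** * Moments of the quadratic form of one column *)

Section column.
Context {R : realType} d (T : measurableType d) (P : probability T R).
Context {I : choiceType} (X : I -> {RV P >-> R}).
Hypothesis indX : mutually_independent X.
Variable e : nat -> I.
Hypothesis inj_e : injective e.
Implicit Types g h : R -> R.

Definition idx (n : nat) : set I := [set e i | i in [set i | (i < n)%N]].

Definition psum g (n : nat) (w : T) : R := \sum_(i < n) g (X (e i) w).

(** Half of the sum of products of distinct terms, ordered so that every increment is a new term
    times a function of the earlier ones. *)
Definition qform g (n : nat) (w : T) : R :=
  \sum_(i < n) g (X (e i) w) * psum g i w.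

Lemma psumS g n w : psum g n.+1 w = psum g n w + g (X (e n) w).
Proof. by rewrite /psum big_ord_recr. Qed.

Lemma qformS g n w :
  qform g n.+1 w = qform g n w + g (X (e n) w) * psum g n w.
Proof. by rewrite /qform big_ord_recr. Qed.

Lemma psum_sqr g n w :
  psum g n w ^+ 2 = \sum_(i < n) g (X (e i) w) ^+ 2 + 2 * qform g n w.
Proof.
elim: n => [|n IH]; first by rewrite /psum /qform !big_ord0 expr0n/= mulr0 addr0.
by rewrite psumS qformS big_ord_recr/= sqrrD IH -mulr_natr; ring.
Qed.

Lemma idx_disj n : idx n `&` [set e n] = set0.
Proof.
apply/seteqP; split => // _ [[i /= ni <-] /= /inj_e ein].
by rewrite ein ltnn in ni.
Qed.

Lemma idx_le m n : (m <= n)%N -> idx m `<=` idx n.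
Proof. by move=> mn _ [i /= im <-]; exists i => //=; exact: leq_trans mn. Qed.

Lemma gen_measurable_last g n : measurable_fun [set: R] g ->
  gen_measurable X [set e n] (fun w => g (X (e n) w)).
Proof. by move=> mg; exact: gen_measurable_comp. Qed.

Lemma gen_measurable_psum g n : measurable_fun [set: R] g ->
  gen_measurable X (idx n) (psum g n).
Proof.
move=> mg; rewrite /psum.
rewrite (_ : (fun _ => _) = (fun w => \sum_(i <- enum 'I_n) g (X (e i) w))).
  apply: gen_measurable_sum => i _; apply: gen_measurable_comp => //.
  by exists i => /=.
by apply/funext => w; rewrite big_enum.
Qed.

Lemma gen_measurable_qform g n : measurable_fun [set: R] g ->
  gen_measurable X (idx n) (qform g n).
Proof.
move=> mg; rewrite /qform.
rewrite (_ : (fun _ => _) =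
  (fun w => \sum_(i <- enum 'I_n) g (X (e i) w) * psum g i w)).
  apply: gen_measurable_sum => i _; apply: gen_measurableM.
    by apply: gen_measurable_comp => //; exists i => /=.
  apply: (gen_measurable_sub _ (gen_measurable_psum mg)).
  exact/idx_le/ltnW.
by apply/funext => w; rewrite big_enum.
Qed.

Lemma indep_last (A : T -> R) g n : measurable_fun [set: R] g ->
  gen_measurable X (idx n) A -> indep P (fun w => g (X (e n) w)) A.
Proof.
move=> mg mA.
by apply: (gen_indep indX _ (gen_measurable_last mg) mA); rewrite setIC idx_disj.
Qed.

(* A centered new factor makes the increment orthogonal to the past. *)
Lemma orth_last (M B : T -> R) g n : measurable_fun [set: R] g ->
  L2 P (fun w => g (X (e n) w)) -> \int[P]_w g (X (e n) w) = 0 ->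
  gen_measurable X (idx n) M -> gen_measurable X (idx n) B ->
  L2 P M -> L2 P B ->
  \int[P]_w (M w * (g (X (e n) w) * B w)) = 0.
Proof.
move=> mg sg g0 mM mB sM sB.
have ind := indep_last mg (gen_measurableM mM mB).
have := indep_ExM ind (L2_L1 sg) (L2_mul sM sB).
rewrite g0 mul0r => <-; apply: eq_Rintegral => w _; ring.
Qed.

Lemma L2_last_mul (B : T -> R) g n : measurable_fun [set: R] g ->
  L2 P (fun w => g (X (e n) w)) -> gen_measurable X (idx n) B -> L2 P B ->
  L2 P (fun w => g (X (e n) w) * B w).
Proof. by move=> mg sg mB sB; exact: indep_L2M (indep_last mg mB) sg sB. Qed.

Let gen_measurable1 n : gen_measurable X (idx n) (fun=> 1).
Proof. exact: gen_measurable_cst. Qed.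

Section moments.
Variables (g : R -> R) (v : R).
Hypothesis mg : measurable_fun [set: R] g.
Hypothesis sg : forall n, L2 P (fun w => g (X (e n) w)).
Hypothesis g0 : forall n, \int[P]_w g (X (e n) w) = 0.
Hypothesis gv : forall n, \int[P]_w (g (X (e n) w) ^+ 2) = v.

Lemma L2_psum n : L2 P (psum g n).
Proof.
rewrite /psum (_ : (fun _ => _) = (fun w => \sum_(i <- enum 'I_n) g (X (e i) w))).
  by apply: L2_sum => i.
by apply/funext => w; rewrite big_enum.
Qed.

Lemma Ex_psum_sqr n : \int[P]_w (psum g n w ^+ 2) = n%:R * v.
Proof.
elim: n => [|n IH].
  under eq_Rintegral do rewrite /psum big_ord0 expr0n.
  by rewrite Ex_cst mul0r.
under eq_Rintegral do rewrite psumS.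
rewrite Ex_sqrD_orth ?IH ?gv//; [by rewrite -natr1 mulrDl mul1r|exact: L2_psum|].
have := orth_last mg (sg n) (g0 n) (@gen_measurable_psum g n mg)
  (@gen_measurable1 n) (L2_psum n) (L2_cst P 1).
by move=> <-; apply: eq_Rintegral => w _; rewrite mulr1.
Qed.

Lemma L2_qform n : L2 P (qform g n).
Proof.
elim: n => [|n IH].
  rewrite (_ : qform g 0 = fun=> 0); first exact: L2_cst.
  by apply/funext => w; rewrite /qform big_ord0.
rewrite (_ : qform g n.+1 = fun w => qform g n w + g (X (e n) w) * psum g n w).
  apply: L2D => //; apply: L2_last_mul => //; last exact: L2_psum.
  exact: gen_measurable_psum.
by apply/funext => w; exact: qformS.
Qed.

Lemma Ex_qform n : \int[P]_w qform g n w = 0.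
Proof.
elim: n => [|n IH].
  under eq_Rintegral do rewrite /qform big_ord0.
  by rewrite Ex_cst.
under eq_Rintegral do rewrite qformS.
have sL := L2_last_mul mg (sg n) (@gen_measurable_psum g n mg) (L2_psum n).
rewrite ExD ?IH ?add0r; [|exact/L2_L1/L2_qform|exact: L2_L1].
have := orth_last mg (sg n) (g0 n) (@gen_measurable1 n)
  (@gen_measurable_psum g n mg) (L2_cst P 1) (L2_psum n).
by move=> <-; apply: eq_Rintegral => w _; rewrite mul1r.
Qed.

(** The increments are orthogonal, and the one at index k has second moment v (k v). *)
Lemma Ex_qform_sqr n :
  \int[P]_w (qform g n w ^+ 2) = v ^+ 2 * (n%:R * (n%:R - 1) / 2).
Proof.
elim: n => [|n IH].
  under eq_Rintegral do rewrite /qform big_ord0 expr0n.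
  by rewrite Ex_cst !mul0r mulr0.
under eq_Rintegral do rewrite qformS.
have sL := L2_last_mul mg (sg n) (@gen_measurable_psum g n mg) (L2_psum n).
rewrite Ex_sqrD_orth//; [|exact: L2_qform|]; last first.
  exact: (orth_last mg (sg n) (g0 n) (@gen_measurable_qform g n mg)
    (@gen_measurable_psum g n mg) (L2_qform n) (L2_psum n)).
rewrite IH (indep_Ex_sqrM (indep_last mg (@gen_measurable_psum g n mg)) (sg n) (L2_psum n)).
by rewrite gv Ex_psum_sqr -natr1; field.
Qed.

End moments.



Section difference.
Variables (g : R -> R) (u v : R).
Let a (x : R) : R := x - g x.
Hypothesis mg : measurable_fun [set: R] g.
Hypothesis sX : forall n, L2 P (X (e n)).
Hypothesis sg : forall n, L2 P (fun w => g (X (e n) w)).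
Hypothesis X0 : forall n, \int[P]_w X (e n) w = 0.
Hypothesis g0 : forall n, \int[P]_w g (X (e n) w) = 0.
Hypothesis Xv : forall n, \int[P]_w (X (e n) w ^+ 2) = 1.
Hypothesis gv : forall n, \int[P]_w (g (X (e n) w) ^+ 2) = v.
Hypothesis au : forall n, \int[P]_w (a (X (e n) w) ^+ 2) = u.

Let ma : measurable_fun [set: R] a.
Proof. exact: measurable_funB. Qed.

Let sa n : L2 P (fun w => a (X (e n) w)).
Proof. exact: L2B. Qed.

Let a0 n : \int[P]_w a (X (e n) w) = 0.
Proof. by rewrite ExB ?X0 ?g0 ?subr0//; exact: L2_L1. Qed.

Let mid : measurable_fun [set: R] (@id R).
Proof. exact: measurable_id. Qed.

Lemma psum_id_sub n w : psum id n w - psum g n w = psum a n w.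
Proof. by rewrite /psum -sumrB. Qed.

(** With a = id - g, the increment of the difference is a(X) T + g(X) T_a, where T and T_a are the
    partial sums of X and of a(X). It is orthogonal to the past, and the second moments of the
    increments, at most 2 u (1 + v) k, add up to at most the bound. *)
Lemma Ex_qform_diff_sqr n :
  \int[P]_w ((qform id n w - qform g n w) ^+ 2) <= u * (1 + v) * n%:R ^+ 2.
Proof.
have u0 : 0 <= u by rewrite -(au 0); apply: Ex_ge0 => w; exact: sqr_ge0.
have v0 : 0 <= v by rewrite -(gv 0); apply: Ex_ge0 => w; exact: sqr_ge0.
elim: n => [|n IH].
  under eq_Rintegral do rewrite /qform !big_ord0 subrr expr0n.
  by rewrite Ex_cst mulr_ge0// ?mulr_ge0 ?addr_ge0// expr0n.
have mT := @gen_measurable_psum id n mid.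
have mTa := @gen_measurable_psum a n ma.
have sT := @L2_psum id sX n.
have sTa := @L2_psum a sa n.
have mD : gen_measurable X (idx n) (fun w => qform id n w - qform g n w).
  under eq_fun do rewrite -mulN1r; apply: gen_measurableD.
    exact: gen_measurable_qform.
  apply: gen_measurableM; first exact: gen_measurable_cst.
  exact: gen_measurable_qform.
have sD : L2 P (fun w => qform id n w - qform g n w).
  by apply: L2B; [exact: (L2_qform mid sX)|exact: (L2_qform mg sg)].
have s1 : L2 P (fun w => a (X (e n) w) * psum id n w) by exact: L2_last_mul.
have s2 : L2 P (fun w => g (X (e n) w) * psum a n w) by exact: L2_last_mul.
rewrite (@eq_Rintegral _ _ _ P _ (fun w => ((qform id n w - qform g n w) +
    (a (X (e n) w) * psum id n w + g (X (e n) w) * psum a n w)) ^+ 2)); last first.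
  by move=> w _; rewrite !qformS -psum_id_sub /a; congr (_ ^+ 2); ring.
rewrite Ex_sqrD_orth//; last 2 first.
- exact: L2D.
- under eq_Rintegral do rewrite mulrDr.
  rewrite ExD; [|exact: L2_mul|exact: L2_mul].
  rewrite (orth_last ma (sa n) (a0 n) mD mT sD sT).
  by rewrite (orth_last mg (sg n) (g0 n) mD mTa sD sTa) addr0.
have h1 : \int[P]_w ((a (X (e n) w) * psum id n w) ^+ 2) = u * n%:R.
  rewrite (indep_Ex_sqrM (indep_last ma mT) (sa n) sT) au.
  by rewrite (Ex_psum_sqr mid sX X0 Xv) mulr1.
have h2 : \int[P]_w ((g (X (e n) w) * psum a n w) ^+ 2) = v * (n%:R * u).
  rewrite (indep_Ex_sqrM (indep_last mg mTa) (sg n) sTa) gv.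
  by rewrite (Ex_psum_sqr ma sa a0 au).
have h3 : \int[P]_w ((a (X (e n) w) * psum id n w +
    g (X (e n) w) * psum a n w) ^+ 2) <= 2 * (u * n%:R) + 2 * (v * (n%:R * u)).
  rewrite -h1 -h2 -!ExZ; [|exact: L2_sqr..].
  rewrite -ExD; [|exact/L1Z/L2_sqr..].
  apply: le_Ex; [exact/L2_sqr/L2D|apply: L1D; exact/L1Z/L2_sqr|].
  by move=> w; rewrite -subr_ge0; set p := a _ * _; set q := g _ * _;
    rewrite (_ : _ - _ = (p - q) ^+ 2) ?sqr_ge0//; ring.
apply: (le_trans (lerD IH h3)); rewrite -natr1.
rewrite -subr_ge0 (_ : _ - _ = u * (1 + v)); last by ring.
by rewrite mulr_ge0// addr_ge0.
Qed.

End difference.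


Section bounded.
Variables (g : R -> R) (K v : R).
Hypothesis mg : measurable_fun [set: R] g.
Hypothesis gK : forall x, `|g x| <= K.
Hypothesis g0 : forall n, \int[P]_w g (X (e n) w) = 0.
Hypothesis gv : forall n, \int[P]_w (g (X (e n) w) ^+ 2) = v.

Let K0 : 0 <= K. Proof. exact: le_trans (gK 0). Qed.

Let mX n : measurable_fun [set: T] (fun w => g (X (e n) w)).
Proof. exact: (measurableT_comp mg). Qed.

Lemma psum_bounded n w : `|psum g n w| <= n%:R * K.
Proof.
rewrite /psum (le_trans (ler_norm_sum _ _ _))//.
rewrite (le_trans (ler_sum _ (fun i _ => gK _)))//.
by rewrite sumr_const card_ord mulr_natl.
Qed.

Lemma measurable_psum n : measurable_fun [set: T] (psum g n).
Proof. exact: gen_measurable_measurable (@gen_measurable_psum g n mg). Qed.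

Lemma L1_expR_psum (a : R) n : L1 P (fun w => expR (a * psum g n w)).
Proof.
apply: (@L1_bounded _ _ _ _ _ (expR (`|a| * (n%:R * K)))).
  apply: (measurableT_comp (@measurable_expR R)).
  by apply: measurable_funM => //; exact: measurable_psum.
move=> w; rewrite ger0_norm ?expR_ge0// ler_expR.
by rewrite (le_trans (ler_norm _))// normrM ler_wpM2l// psum_bounded.
Qed.

(** A centred factor has exponential moment at most 1 + 2 a^2 v, and independent factors
    multiply. *)
Lemma Ex_expR_psum (a : R) n : `|a| * K <= 2^-1 ->
  \int[P]_w expR (a * psum g n w) <= expR (2 * a ^+ 2 * v * n%:R).
Proof.
move=> aK; elim: n => [|n IH].
  under eq_Rintegral do rewrite /psum big_ord0 mulr0 expR0.
  by rewrite Ex_cst mulr0 expR0.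
pose f x := expR (a * g x).
have mf : measurable_fun [set: R] f.
  by apply: (measurableT_comp (@measurable_expR R)); exact: measurable_funM.
have ag x : `|a * g x| <= 2^-1.
  by rewrite normrM (le_trans _ aK)// ler_wpM2l.
have L1f : L1 P (fun w => f (X (e n) w)).
  apply: (@L1_bounded _ _ _ _ _ (expR 2^-1)); first exact: (measurableT_comp mf).
  by move=> w; rewrite ger0_norm ?expR_ge0// ler_expR (le_trans (ler_norm _)).
have mA : gen_measurable X (idx n) (fun w => expR (a * psum g n w)).
  apply: (gen_measurable_fun (g := fun x => expR (a * x))).
    apply: (measurableT_comp (@measurable_expR R)); exact: measurable_funM.
  exact: gen_measurable_psum.
have -> : \int[P]_w expR (a * psum g n.+1 w) =
    \int[P]_w (f (X (e n) w) * expR (a * psum g n w)).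
  by apply: eq_Rintegral => w _; rewrite psumS mulrDr expRD mulrC.
rewrite (indep_ExM (indep_last mf mA) L1f (L1_expR_psum a n)).
have sg : L2 P (fun w => g (X (e n) w)) by exact: (@L2_bounded _ _ _ _ _ K (@mX n) (fun w => gK _)).
have fv : \int[P]_w f (X (e n) w) <= expR (2 * a ^+ 2 * v).
  apply: (@le_trans _ _ (1 + 2 * a ^+ 2 * v)); last exact: expR_ge1Dx.
  have L1g : L1 P (fun w => 1 + a * g (X (e n) w)).
    by apply: L1D; [exact: L1_cst|exact/L1Z/L2_L1].
  have L1g2 : L1 P (fun w => 2 * a ^+ 2 * g (X (e n) w) ^+ 2).
    exact/L1Z/L2_sqr.
  have -> : 1 + 2 * a ^+ 2 * v =
      \int[P]_w (1 + a * g (X (e n) w) + 2 * a ^+ 2 * g (X (e n) w) ^+ 2).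
    rewrite ExD// ExD; [|exact: L1_cst|exact/L1Z/L2_L1].
    rewrite Ex_cst ExZ ?g0 ?mulr0 ?addr0; last exact: L2_L1.
    by rewrite ExZ ?gv//; exact: L2_sqr.
  apply: le_Ex => //; first exact: L1D.
  by move=> w; rewrite (le_trans (expR_le_quadratic (ag _)))// exprMn mulrA.
rewrite -[n.+1%:R]natr1 mulrDr mulr1 expRD mulrC ler_pM// ?Ex_ge0// => w; exact: expR_ge0.
Qed.

(** For the form Q and the partial sum T, 2 Q / n is (T / sqrt n)^2 minus the mean of the squares,
    which lies in [0, K^2]. So its cube is controlled by the sixth power of T / sqrt n, and that by
    the exponential moments at 1 / sqrt n and - 1 / sqrt n. The condition 4 K^2 <= n makes these
    arguments admissible in [Ex_expR_psum]; the resulting bound is free of [n]. *)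
Lemma Ex_cube_qform (C : R) n : 0 <= C ->
  (forall x, x ^+ 6 <= C * (expR x + expR (- x))) ->
  (0 < n)%N -> 4 * K ^+ 2 <= n%:R ->
  L1 P (fun w => `|2 * qform g n w / n%:R| ^+ 3) /\
  \int[P]_w (`|2 * qform g n w / n%:R| ^+ 3) <=
  4 * (C * (2 * expR (2 * v)) + K ^+ 6).
Proof.
move=> C0 hC n0 nK; have n0' : 0 < n%:R :> R by rewrite ltr0n.
pose r : R := Num.sqrt n%:R.
have r0 : 0 < r by rewrite sqrtr_gt0.
have r2 : r ^+ 2 = n%:R by rewrite sqr_sqrtr// ltW.
pose G w := 4 * (C * (expR (r^-1 * psum g n w) + expR (- r^-1 * psum g n w)) + K ^+ 6).
have LG : L1 P G.
  apply/L1Z/L1D; last exact: L1_cst.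
  by apply/L1Z/L1D; exact: L1_expR_psum.
have UG w : `|2 * qform g n w / n%:R| ^+ 3 <= G w.
  set U := 2 * qform g n w / n%:R; pose y := r^-1 * psum g n w.
  have e1 : U = y ^+ 2 - (\sum_(i < n) g (X (e i) w) ^+ 2) / n%:R.
    rewrite /U /y exprMn exprVn r2 psum_sqr; field; exact: lt0r_neq0.
  have S0 : 0 <= (\sum_(i < n) g (X (e i) w) ^+ 2) / n%:R.
    by rewrite divr_ge0 ?sumr_ge0// => i _; exact: sqr_ge0.
  have SK : (\sum_(i < n) g (X (e i) w) ^+ 2) / n%:R <= K ^+ 2.
    rewrite ler_pdivrMr//.
    rewrite (@le_trans _ _ (\sum_(i < n) K ^+ 2))//.
      apply: ler_sum => i _; rewrite -(real_normK (num_real (g _))).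
      by rewrite lerXn2r ?nnegrE.
    by rewrite sumr_const card_ord mulr_natr.
  have h : `|U| <= y ^+ 2 + K ^+ 2.
    rewrite e1 (le_trans (ler_normB _ _))// (ger0_norm (sqr_ge0 _)) (ger0_norm S0).
    by rewrite lerD2l.
  have y2 := sqr_ge0 y; have K2 := sqr_ge0 K.
  rewrite (@le_trans _ _ ((y ^+ 2 + K ^+ 2) ^+ 3))//.
    by rewrite lerXn2r ?nnegrE// addr_ge0.
  rewrite (@le_trans _ _ (4 * (y ^+ 6 + K ^+ 6)))//.
    have y6 : y ^+ 6 = (y ^+ 2) ^+ 3 by rewrite -exprM.
    have K6 : K ^+ 6 = (K ^+ 2) ^+ 3 by rewrite -exprM.
    by rewrite y6 K6 cube_add_le.
  rewrite /G ler_wpM2l// lerD2r (le_trans (hC _))//.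
  by rewrite /y mulNr.
have mQ : measurable_fun [set: T] (fun w => `|2 * qform g n w / n%:R| ^+ 3).
  apply: measurable_funX; apply: measurableT_comp => //.
  apply: measurable_funM => //; apply: measurable_funM => //.
  exact: gen_measurable_measurable (@gen_measurable_qform g n mg).
have LQ : L1 P (fun w => `|2 * qform g n w / n%:R| ^+ 3).
  by apply: L1_le LG _ => // w; rewrite ger0_norm ?exprn_ge0.
split => //; apply: (le_trans (le_Ex LQ LG UG)).
have Le := L1_expR_psum.
rewrite /G ExZ; last by apply: L1D; [apply/L1Z/L1D; exact: Le|exact: L1_cst].
rewrite ler_wpM2l// ExD; [|by apply/L1Z/L1D; exact: Le|exact: L1_cst].
rewrite Ex_cst lerD2r ExZ; last by apply: L1D; exact: Le.
rewrite ler_wpM2l// ExD; [|exact: Le..].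
have rK : r^-1 * K <= 2^-1.
  rewrite mulrC ler_pdivrMr// -ler_sqr ?nnegrE ?mulr_ge0//; last by rewrite ltW.
  by rewrite exprMn r2 exprVn; lra.
have ra : r^-1 ^+ 2 * n%:R = 1 by rewrite exprVn r2 mulVf// gt_eqF.
have bd (a : R) : `|a| = r^-1 -> \int[P]_w expR (a * psum g n w) <= expR (2 * v).
  move=> ar; rewrite (le_trans (Ex_expR_psum _ _)) ?ar// ler_expR.
  rewrite -(real_normK (num_real a)) ar.
  have -> : 2 * r^-1 ^+ 2 * v * n%:R = 2 * v * (r^-1 ^+ 2 * n%:R) by ring.
  by rewrite ra mulr1.
rewrite mulr_natl mulr2n lerD// bd//.
  by rewrite ger0_norm// invr_ge0 ltW.
by rewrite normrN ger0_norm// invr_ge0 ltW.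
Qed.

End bounded.

End column.

Lemma measurable_clamp (R : realType) (K : R) : measurable_fun [set: R] (clamp K).
Proof.
apply: measurable_maxr => //.
by apply: measurable_minr => //; exact: measurable_id.
Qed.

(** [xi] is clamped and then recentred. As [xi] has mean 0, recentring only lowers the squared L2
    distance, by the square of the mean of the clamped variable. *)
Lemma truncation (R : realType) d (T : measurableType d) (P : probability T R)
    (xi : {RV P >-> R}) (eps : R) :
  L2 P xi -> \int[P]_w xi w = 0 -> 0 < eps ->
  exists g : R -> R, exists K : R, [/\ measurable_fun [set: R] g,
    forall x, `|g x| <= K, \int[P]_w g (xi w) = 0 &
    \int[P]_w ((xi w - g (xi w)) ^+ 2) <= eps].
Proof.
move=> sxi xi0 eps0.
have mc K : measurable_fun [set: T] (fun w => clamp K (xi w)).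
  exact: (measurableT_comp (measurable_clamp K)).
have cK K x : 0 <= K -> `|clamp K x| <= K by exact: clamp_norm.
have dK K x : 0 <= K -> `|x - clamp K x| <= `|x|.
  move=> K0; have h1 := ler_norm x; have h2 := ler_norm (- x).
  rewrite normrN in h2; rewrite /clamp; have [Kx|xK] := leP K x.
    by rewrite max_r; [rewrite ger0_norm; lra|lra].
  have [hx|hx] := leP (- K) x; first by rewrite subrr normr0.
  by rewrite ler0_norm; lra.
have /cvgrPdist_le/(_ _ eps0)[N _ hN] :
    \int[P]_w ((xi w - clamp n%:R (xi w)) ^+ 2) @[n --> \oo] -->
    \int[P]_w (fun=> 0 : R) w.
  apply: (@Ex_dominated_cvg _ _ _ P
    (fun (n : nat) w => (xi w - clamp n%:R (xi w)) ^+ 2) _ (fun w => xi w ^+ 2)).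
  - by move=> n; apply: measurable_funX; exact: measurable_funB.
  - exact: L2_sqr.
  - move=> n w; rewrite ger0_norm ?sqr_ge0// -(real_normK (num_real (xi w))).
    rewrite -(real_normK (num_real (xi w - _))).
    by rewrite lerXn2r ?nnegrE// dK.
  - move=> w; apply: cvg_near_cst; near=> n.
    have : `|xi w| <= n%:R by near: n; exact: nbhs_infty_ger.
    rewrite ler_norml => /andP[h1 h2].
    by rewrite /clamp min_r// max_r// subrr expr0n.
have := hN N (leqnn N); rewrite Ex_cst sub0r normrN ger0_norm; last first.
  by apply: Ex_ge0 => w; exact: sqr_ge0.
move=> {}hN; pose m := \int[P]_w clamp N%:R (xi w).
have N0 : 0 <= N%:R :> R by [].
have sc : L2 P (fun w => clamp N%:R (xi w)).
  by apply: (@L2_bounded _ _ _ _ _ N%:R) => // w; exact: cK.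
have mN : `|m| <= N%:R.
  by apply: ler_norm_Ex_bounded => // w; exact: cK.
exists (fun x => clamp N%:R x - m), (N%:R + N%:R); split.
- by apply: measurable_funB => //; exact: measurable_clamp.
- by move=> x; rewrite (le_trans (ler_normB _ _))// lerD// cK.
- by rewrite ExB ?Ex_cst ?subrr//; [exact: L2_L1|exact: L1_cst].
apply: le_trans hN.
set a := fun w => xi w - clamp N%:R (xi w).
have sa : L2 P a by exact: L2B.
have a0 : \int[P]_w a w = - m by rewrite ExB ?xi0 ?sub0r//; exact: L2_L1.
have -> : \int[P]_w ((xi w - (clamp N%:R (xi w) - m)) ^+ 2) =
    \int[P]_w (a w ^+ 2) - m ^+ 2.
  transitivity (\int[P]_w ((a w ^+ 2 + (2 * m) * a w) + m ^+ 2)).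
    by apply: eq_Rintegral => w _; rewrite /a; ring.
  rewrite ExD; [|by apply: L1D; [exact: L2_sqr|exact/L1Z/L2_L1]|exact: L1_cst].
  rewrite ExD; [|exact: L2_sqr|exact/L1Z/L2_L1].
  rewrite ExZ; last exact: L2_L1.
  by rewrite Ex_cst a0; ring.
by rewrite lerBlDr lerDl sqr_ge0.
Unshelve. all: by end_near. Qed.

(** Either |x| <= 2 |x - y|, where the minimum is bounded by 1, or |x| <= 2 |y|, where it is bounded
    by s |x|; the constants are 2^2 and 2^3. *)
Lemma min_sqr_split (R : realType) (x y s : R) : 0 <= s ->
  x ^+ 2 * Num.min 1 (s * `|x|) <= 4 * (x - y) ^+ 2 + 8 * s * `|y| ^+ 3.
Proof.
move=> s0; have x0 := normr_ge0 x; have y0 := normr_ge0 y.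
have m0 : 0 <= Num.min 1 (s * `|x|) by rewrite le_min ler01 mulr_ge0.
have m1 : Num.min 1 (s * `|x|) <= 1 by rewrite ge_min lexx.
have m2 : Num.min 1 (s * `|x|) <= s * `|x| by rewrite ge_min lexx orbT.
have xy : `|x| <= `|x - y| + `|y| by rewrite -{1}(subrK y x) ler_normD.
have d0 := normr_ge0 (x - y).
rewrite -(real_normK (num_real x)) -(real_normK (num_real (x - y))).
have y3 : 0 <= s * `|y| ^+ 3 by rewrite mulr_ge0// exprn_ge0.
have [h|h] := leP `|y| `|x - y|.
  have : `|x| ^+ 2 * Num.min 1 (s * `|x|) <= `|x| ^+ 2.
    by rewrite ler_piMr// exprn_ge0.
  have : `|x| ^+ 2 <= (2 * `|x - y|) ^+ 2.
    by rewrite lerXn2r ?nnegrE ?mulr_ge0//; lra.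
  by rewrite exprMn; lra.
have h2 : `|x| <= 2 * `|y| by lra.
have h3 : `|x| ^+ 2 * Num.min 1 (s * `|x|) <= s * `|x| ^+ 3.
  by have := ler_wpM2l (exprn_ge0 2 x0) m2; lra.
have h4 : `|x| ^+ 3 <= (2 * `|y|) ^+ 3 by rewrite lerXn2r ?nnegrE ?mulr_ge0.
have h5 := ler_wpM2l s0 h4; rewrite exprMn in h5.
have := sqr_ge0 `|x - y|; lra.
Qed.

(** * Uniform square integrability of the columns *)

Section iid_column.
Context {R : realType} d0 (T0 : measurableType d0) (P0 : probability T0 R)
  (xi : {RV P0 >-> R}).
Hypothesis sxi : L2 P0 xi.
Hypothesis xi0 : \int[P0]_w xi w = 0.
Hypothesis xi1 : \int[P0]_w (xi w ^+ 2) = 1.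
Context d (T : measurableType d) (P : probability T R).
Context {I : choiceType} (X : I -> {RV P >-> R}).
Hypothesis copies : independent_copies xi X.

Let transfer (g : R -> R) i : measurable_fun [set: R] g ->
  L1 P0 (fun w => g (xi w)) ->
  L1 P (fun w => g (X i w)) /\ \int[P]_w g (X i w) = \int[P0]_w g (xi w).
Proof. by move=> mg; apply: eq_law_transfer => //; exact: copies.2. Qed.

Lemma copy_L2 (g : R -> R) i : measurable_fun [set: R] g ->
  L2 P0 (fun w => g (xi w)) -> L2 P (fun w => g (X i w)).
Proof.
move=> mg sg; split; first exact: (measurableT_comp mg).
have mg2 : measurable_fun [set: R] (fun x => g x ^+ 2) by exact: measurable_funX.
by have [] := transfer i mg2 (L2_sqr sg).
Qed.

Lemma copy_Ex (g : R -> R) i : measurable_fun [set: R] g ->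
  L1 P0 (fun w => g (xi w)) -> \int[P]_w g (X i w) = \int[P0]_w g (xi w).
Proof. by move=> mg ig; have [] := transfer i mg ig. Qed.

Lemma copy_Ex_sqr (g : R -> R) i : measurable_fun [set: R] g ->
  L2 P0 (fun w => g (xi w)) ->
  \int[P]_w (g (X i w) ^+ 2) = \int[P0]_w (g (xi w) ^+ 2).
Proof.
move=> mg sg; apply: (copy_Ex i (g := fun x => g x ^+ 2)); last exact: L2_sqr.
exact: measurable_funX.
Qed.

Let mid : measurable_fun [set: R] (@id R). Proof. exact: measurable_id. Qed.

Lemma copies_L2 i : L2 P (X i).
Proof. exact: (copy_L2 i mid sxi). Qed.

Lemma copies_mean i : \int[P]_w X i w = 0.
Proof. by rewrite (copy_Ex i mid (L2_L1 sxi)). Qed.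

Lemma copies_var i : \int[P]_w (X i w ^+ 2) = 1.
Proof. by rewrite (copy_Ex_sqr i mid sxi). Qed.

(* This is ((X (e 0) + ... + X (e n.-1)) ^ 2 - (the sum of the squares)) / n. *)
Definition column_form (e : nat -> I) (n : nat) (w : T) : R :=
  2 * qform X e id n w / n%:R.

(** The left side is the shape in which the Taylor remainder of the transform meets a column. The
    form of the truncated entries contributes C s through its third moment, the remaining part
    contributes [eps] in L2; [C] and [N] depend neither on [n] nor on the column. *)
Lemma column_form_unif_int (eps : R) : 0 < eps ->
  exists2 C : R, 0 <= C & exists N : nat, forall (e : nat -> I) (n : nat) (s : R),
  injective e -> (N <= n)%N -> 0 <= s ->
  \int[P]_w (column_form e n w ^+ 2 * Num.min 1 (s * `|column_form e n w|)) <=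
    eps + C * s.
Proof.
(* The L2 part is at most 16 u (1 + v) with u <= [del] and v <= 4, whence the 80. *)
move=> eps0; pose del := Num.min 1 (eps / 80).
have del0 : 0 < del by rewrite lt_min ltr01 divr_gt0.
have del1 : del <= 1 by rewrite ge_min lexx.
have del2 : del <= eps / 80 by rewrite ge_min lexx orbT.
have [g [K [mg gK g0 gdel]]] := truncation sxi xi0 del0.
have [C6 C60 hC6] := pow6_le_expR R.
have sg0 : L2 P0 (fun w => g (xi w)).
  apply: (@L2_bounded _ _ _ _ _ K) => //; exact: (measurableT_comp mg).
pose v := \int[P0]_w (g (xi w) ^+ 2).
pose u := \int[P0]_w ((xi w - g (xi w)) ^+ 2).
have ma : measurable_fun [set: R] (fun x => x - g x) by exact: measurable_funB.
have sa0 : L2 P0 (fun w => xi w - g (xi w)) by exact: L2B.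
have v4 : v <= 4.
  apply: (@le_trans _ _ (2 * 1 + 2 * u)); last by rewrite /u; lra.
  have i1 := L1Z 2 (L2_sqr sxi); have i2 := L1Z 2 (L2_sqr sa0).
  have <- : \int[P0]_w (2 * xi w ^+ 2 + 2 * (xi w - g (xi w)) ^+ 2) = 2 * 1 + 2 * u.
    by rewrite ExD// !ExZ ?xi1//; exact: L2_sqr.
  apply: le_Ex; [exact: L2_sqr|exact: L1D|].
  by move=> w; have := sqr_ge0 (2 * xi w - g (xi w)); lra.
have v0 : 0 <= v by apply: Ex_ge0 => w; exact: sqr_ge0.
have u0 : 0 <= u by apply: Ex_ge0 => w; exact: sqr_ge0.
have K0 : 0 <= K by exact: le_trans (gK 0).
pose C3 := 4 * (C6 * (2 * expR (2 * v)) + K ^+ 6).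
have C30 : 0 <= C3.
  by rewrite mulr_ge0// addr_ge0 ?exprn_ge0// !mulr_ge0// expR_ge0.
exists (8 * C3); first by rewrite mulr_ge0.
exists (Num.truncn (4 * K ^+ 2)).+1 => e n s inj_e Nn s0.
have n0 : (0 < n)%N by exact: leq_trans Nn.
have n0' : 0 < n%:R :> R by rewrite ltr0n.
have nK : 4 * K ^+ 2 <= n%:R.
  by rewrite (le_trans (ltW (truncnS_gt _)))// ler_nat.
have sX k := copies_L2 (e k).
have sg k := copy_L2 (e k) mg sg0.
have Eg k : \int[P]_w g (X (e k) w) = 0 by rewrite copy_Ex//; exact: L2_L1.
have Eg2 k : \int[P]_w (g (X (e k) w) ^+ 2) = v by exact: copy_Ex_sqr.
have Ea2 k : \int[P]_w ((X (e k) w - g (X (e k) w)) ^+ 2) = u.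
  exact: (copy_Ex_sqr (e k) ma sa0).
have X0 k := copies_mean (e k).
have X1 k := copies_var (e k).
have [L3 E3] := Ex_cube_qform copies.1 inj_e mg gK Eg Eg2 C60 hC6 n0 nK.
have E2 := Ex_qform_diff_sqr copies.1 inj_e mg sX sg X0 Eg X1 Eg2 Ea2 n.
pose U' w := 2 * qform X e g n w / n%:R.
have sQ : L2 P (qform X e id n) by exact: (L2_qform copies.1 inj_e mid sX).
have sQ' : L2 P (qform X e g n) by exact: (L2_qform copies.1 inj_e mg sg).
have sD : L2 P (fun w => qform X e id n w - qform X e g n w) by exact: L2B.
have sU : L2 P (column_form e n).
  rewrite (_ : column_form e n = fun w => 2 / n%:R * qform X e id n w).
    exact: L2Z.
  by apply/funext => w; rewrite /column_form mulrAC.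
have dU w : (column_form e n w - U' w) ^+ 2 =
    4 / n%:R ^+ 2 * (qform X e id n w - qform X e g n w) ^+ 2.
  by rewrite /column_form /U'; field; rewrite gt_eqF.
have Lmin : L1 P (fun w => column_form e n w ^+ 2 * Num.min 1 (s * `|column_form e n w|)).
  apply: L1_le (L2_sqr sU) _ => //.
    apply: measurable_funM; first by apply: measurable_funX; exact: L2_measurable sU.
    apply: measurable_minr => //; apply: measurable_funM => //.
    by apply: measurableT_comp => //; exact: L2_measurable sU.
  move=> w; have m0 : 0 <= Num.min 1 (s * `|column_form e n w|).
    by rewrite le_min ler01 mulr_ge0.
  rewrite ger0_norm; last by rewrite mulr_ge0 ?sqr_ge0.
  by rewrite ler_piMr ?sqr_ge0// ge_min lexx.
have L1a : L1 P (fun w => 4 * (4 / n%:R ^+ 2 * (qform X e id n w - qform X e g n w) ^+ 2)).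
  exact/L1Z/L1Z/L2_sqr.
have L1b : L1 P (fun w => 8 * s * `|U' w| ^+ 3) by exact: L1Z.
apply: (@le_trans _ _ (\int[P]_w (4 * (4 / n%:R ^+ 2 *
    (qform X e id n w - qform X e g n w) ^+ 2) + 8 * s * `|U' w| ^+ 3))).
  apply: le_Ex => //; first exact: L1D.
  by move=> w; rewrite -dU; exact: min_sqr_split.
rewrite ExD//; apply: lerD.
  rewrite ExZ; last exact/L1Z/L2_sqr.
  rewrite ExZ; last exact: L2_sqr.
  have h : 4 / n%:R ^+ 2 * \int[P]_w ((qform X e id n w - qform X e g n w) ^+ 2) <=
      4 * (u * (1 + v)).
    rewrite mulrAC ler_pdivrMr ?exprn_gt0// -mulrA ler_wpM2l//.
  have uv : u * (1 + v) <= eps / 80 * 5.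
    by apply: ler_pM => //; [rewrite addr_ge0|exact: le_trans del2|lra].
  by lra.
rewrite ExZ//; have E3' : \int[P]_w (`|U' w| ^+ 3) <= C3 by exact: E3.
by have := ler_wpM2l s0 E3'; lra.
Qed.

End iid_column.

Lemma expRN_taylor (R : realType) (y : R) : 0 <= y ->
  `|expR (- y) - 1 + y| <= y ^+ 2.
Proof.
move=> y0; have h : 1 - y <= expR (- y) by exact: expR_ge1Dx.
have h2 : expR (- y) <= (1 + y)^-1.
  rewrite expRN lef_pV2 ?posrE ?expR_gt0 ?expR_ge1Dx//.
  by rewrite (lt_le_trans ltr01)// lerDl.
have h3 : (1 + y)^-1 <= 1 - y + y ^+ 2.
  rewrite -[leLHS]mul1r ler_pdivrMr; last by lra.
  by have := exprn_ge0 3 y0; lra.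
by rewrite ger0_norm; lra.
Qed.

(** * Central limit theorem for the sum of the columns *)

Section column_sums.
Context {R : realType} d0 (T0 : measurableType d0) (P0 : probability T0 R)
  (xi : {RV P0 >-> R}).
Hypothesis sxi : L2 P0 xi.
Hypothesis xi0 : \int[P0]_w xi w = 0.
Hypothesis xi1 : \int[P0]_w (xi w ^+ 2) = 1.
Context d (T : measurableType d) (P : probability T R).
Context (X : nat * nat -> {RV P >-> R}).
Hypothesis copies : independent_copies xi X.

(** Pairs are (step, coordinate): a column gathers one coordinate of all the steps. *)
Definition col (j i : nat) : nat * nat := (i, j).

Lemma inj_col j : injective (col j).
Proof. by move=> i i' []. Qed.

Definition scaled_column (m n j : nat) (w : T) : R :=
  (Num.sqrt (2 * m%:R))^-1 * column_form X (col j) n w.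

(** The number [k] of summed columns is kept apart from the number [m] in the normalization, so that
    induction on [k] leaves the scale fixed. *)
Definition column_sum (m n k : nat) (w : T) : R :=
  \sum_(j < k) scaled_column m n j w.

Lemma column_sumS m n k w :
  column_sum m n k.+1 w = column_sum m n k w + scaled_column m n k w.
Proof. by rewrite /column_sum big_ord_recr. Qed.

Definition in_col (j : nat) : set (nat * nat) := [set ij | ij.2 = j].
Definition before_col (k : nat) : set (nat * nat) := [set ij | (ij.2 < k)%N].

Let mid : measurable_fun [set: R] (@id R). Proof. exact: measurable_id. Qed.

Lemma gen_measurable_column m n j :
  gen_measurable X (in_col j) (scaled_column m n j).
Proof.
apply: gen_measurableM; first exact: gen_measurable_cst.
rewrite /column_form; apply: gen_measurableM; last exact: gen_measurable_cst.
apply: gen_measurableM; first exact: gen_measurable_cst.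
apply: (gen_measurable_sub _ (@gen_measurable_qform _ _ _ _ _ X (col j) id n mid)).
by move=> _ [i _ <-].
Qed.

Lemma gen_measurable_column_sum m n k :
  gen_measurable X (before_col k) (column_sum m n k).
Proof.
rewrite /column_sum.
rewrite (_ : (fun _ => _) = (fun w => \sum_(j <- enum 'I_k) scaled_column m n j w)).
  apply: gen_measurable_sum => j _.
  apply: (gen_measurable_sub _ (@gen_measurable_column m n j)).
  by move=> ij; rewrite /in_col /before_col /= => ->.
by apply/funext => w; rewrite big_enum.
Qed.

Lemma indep_column m n k :
  indep P (column_sum m n k) (scaled_column m n k).
Proof.
apply: (gen_indep copies.1 _ (@gen_measurable_column_sum m n k)
  (@gen_measurable_column m n k)).
apply/seteqP; split => // ij []; rewrite /before_col /in_col /= => + e.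
by rewrite e ltnn.
Qed.

Lemma L2_column_form n j : L2 P (column_form X (col j) n).
Proof.
have sX i := copies_L2 sxi copies (col j i).
have := L2_qform copies.1 (@inj_col j) mid sX n.
move/(L2Z (2 / n%:R)); congr (L2 P _).
by apply/funext => w; rewrite /column_form mulrAC.
Qed.

Lemma column_form_mean n j : \int[P]_w column_form X (col j) n w = 0.
Proof.
have sX i := copies_L2 sxi copies (col j i).
have X0 i := copies_mean sxi xi0 copies (col j i).
have sQ := L2_qform copies.1 (@inj_col j) mid sX n.
rewrite (_ : \int[P]_w _ = \int[P]_w (2 / n%:R * qform X (col j) id n w)).
  rewrite ExZ; last exact: L2_L1.
  by rewrite (Ex_qform copies.1 (@inj_col j) mid sX X0) mulr0.
by apply: eq_Rintegral => w _; rewrite /column_form mulrAC.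
Qed.

Lemma column_form_var n j : (0 < n)%N ->
  \int[P]_w (column_form X (col j) n w ^+ 2) = 2 * (1 - n%:R^-1).
Proof.
move=> n0; have n0' : n%:R != 0 :> R by rewrite pnatr_eq0 -lt0n.
have sX i := copies_L2 sxi copies (col j i).
have X0 i := copies_mean sxi xi0 copies (col j i).
have X1 i := copies_var sxi xi1 copies (col j i).
have sQ := L2_qform copies.1 (@inj_col j) mid sX n.
rewrite (_ : \int[P]_w _ = \int[P]_w (4 / n%:R ^+ 2 * qform X (col j) id n w ^+ 2)).
  rewrite ExZ; last exact: L2_sqr.
  by rewrite (Ex_qform_sqr copies.1 (@inj_col j) mid sX X0 X1); field.
by apply: eq_Rintegral => w _; rewrite /column_form; field.
Qed.

Lemma L2_scaled_column m n j : L2 P (scaled_column m n j).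
Proof. exact/L2Z/L2_column_form. Qed.

Lemma scaled_column_mean m n j : \int[P]_w scaled_column m n j w = 0.
Proof.
rewrite /scaled_column ExZ; last exact/L2_L1/L2_column_form.
by rewrite column_form_mean mulr0.
Qed.

Lemma scaled_column_var m n j : (0 < n)%N -> (0 < m)%N ->
  \int[P]_w (scaled_column m n j w ^+ 2) = (1 - n%:R^-1) / m%:R.
Proof.
move=> n0 m0; have m0' : 0 < m%:R :> R by rewrite ltr0n.
under eq_Rintegral do rewrite /scaled_column exprMn.
rewrite ExZ; last exact/L2_sqr/L2_column_form.
rewrite column_form_var// exprVn sqr_sqrtr ?mulr_ge0//.
by field; rewrite !pnatr_eq0 -!lt0n n0 m0.
Qed.

Lemma L2_column_sum m n k : L2 P (column_sum m n k).
Proof.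
rewrite /column_sum.
rewrite (_ : (fun _ => _) = (fun w => \sum_(j <- enum 'I_k) scaled_column m n j w)).
  by apply: L2_sum => j; exact: L2_scaled_column.
by apply/funext => w; rewrite big_enum.
Qed.

Lemma column_sum_var m n k : (0 < n)%N -> (0 < m)%N ->
  \int[P]_w (column_sum m n k w ^+ 2) <= k%:R / m%:R.
Proof.
move=> n0 m0; elim: k => [|k IH].
  under eq_Rintegral do rewrite /column_sum big_ord0 expr0n.
  by rewrite Ex_cst mul0r.
under eq_Rintegral do rewrite column_sumS.
rewrite Ex_sqrD_orth; [|exact: L2_column_sum|exact: L2_scaled_column|].
  rewrite -[k.+1%:R]natr1 mulrDl lerD// scaled_column_var//.
  by rewrite ler_wpM2r ?invr_ge0// gerBl invr_ge0.
rewrite (indep_ExM (indep_column m n k)).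
- by rewrite scaled_column_mean mulr0.
- exact/L2_L1/L2_column_sum.
- exact/L2_L1/L2_scaled_column.
Qed.

Let L1_cos_comp (A : T -> R) (t c : R) : measurable_fun [set: T] A ->
  L1 P (fun w => cos (t * A w + c)).
Proof.
move=> mA; apply: (@L1_bounded _ _ _ _ _ 1) => [|w]; last exact: cos_max.
exact: (measurableT_comp (measurable_cos_affine t c)).
Qed.

Let L1_sin_comp (A : T -> R) (t c : R) : measurable_fun [set: T] A ->
  L1 P (fun w => sin (t * A w + c)).
Proof.
move=> mA; apply: (@L1_bounded _ _ _ _ _ 1) => [|w]; last exact: sin_max.
exact: (measurableT_comp (measurable_sin_affine t c)).
Qed.

(* Each column multiplies the transform by about [rho]; the errors add up. *)
Lemma column_sum_cos (m n k : nat) (t c rho del : R) : 0 <= rho <= 1 ->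
  (forall j, `|\int[P]_w cos (t * scaled_column m n j w + 0) - rho| +
             `|\int[P]_w sin (t * scaled_column m n j w + 0)| <= del) ->
  `|\int[P]_w cos (t * column_sum m n k w + c) - rho ^+ k * cos c| <= k%:R * del.
Proof.
move=> /andP[rho0 rho1] hdel; elim: k => [|k IH].
  under eq_Rintegral do rewrite /column_sum big_ord0 mulr0 add0r.
  by rewrite Ex_cst expr0 mul1r subrr normr0 mul0r.
have mZ := L2_measurable (L2_column_sum m n k).
have mV := L2_measurable (L2_scaled_column m n k).
have ind f g : measurable_fun [set: R] f -> measurable_fun [set: R] g ->
    indep P (fun w => f (column_sum m n k w)) (fun w => g (scaled_column m n k w)).
  by move=> mf mg; exact: (indep_comp mf mg (indep_column m n k)).
have iC := L1_cos_comp t 0 mV; have iS := L1_sin_comp t 0 mV.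
have iCZ := L1_cos_comp t c mZ; have iSZ := L1_sin_comp t c mZ.
have indC := ind _ _ (measurable_cos_affine t c) (measurable_cos_affine t 0).
have indS := ind _ _ (measurable_sin_affine t c) (measurable_sin_affine t 0).
have -> : \int[P]_w cos (t * column_sum m n k.+1 w + c) =
    \int[P]_w cos (t * column_sum m n k w + c) *
      \int[P]_w cos (t * scaled_column m n k w + 0) -
    \int[P]_w sin (t * column_sum m n k w + c) *
      \int[P]_w sin (t * scaled_column m n k w + 0).
  rewrite -(indep_ExM indC iCZ iC) -(indep_ExM indS iSZ iS).
  rewrite -ExB; [|exact: indep_L1M indC iCZ iC|exact: indep_L1M indS iSZ iS].
  apply: eq_Rintegral => w _; rewrite -cosD column_sumS; congr cos; ring.
have bC : `|\int[P]_w cos (t * column_sum m n k w + c)| <= 1.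
  by apply: ler_norm_Ex_bounded => [|w]; [exact: L1_measurable iCZ|exact: cos_max].
have bS : `|\int[P]_w sin (t * column_sum m n k w + c)| <= 1.
  by apply: ler_norm_Ex_bounded => [|w]; [exact: L1_measurable iSZ|exact: sin_max].
have := hdel k; move: IH bC bS.
set Cz := Rintegral _ _ _; set Sz := \int[P]_w sin (t * column_sum _ _ _ _ + _).
set Cv := \int[P]_w cos (t * scaled_column _ _ _ _ + _).
set Sv := \int[P]_w sin (t * scaled_column _ _ _ _ + _).
move=> IH bC bS hk.
have -> : Cz * Cv - Sz * Sv - rho ^+ k.+1 * cos c =
    Cz * (Cv - rho) + (- (Sz * Sv) + rho * (Cz - rho ^+ k * cos c)).
  by rewrite exprS; ring.
rewrite (le_trans (ler_normD _ _))//.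
have e1 : `|Cz * (Cv - rho)| <= `|Cv - rho| by rewrite normrM ler_piMl.
have e2 : `|- (Sz * Sv) + rho * (Cz - rho ^+ k * cos c)| <= `|Sv| + k%:R * del.
  rewrite (le_trans (ler_normD _ _))// lerD//.
    by rewrite normrN normrM ler_piMl.
  by rewrite normrM (ger0_norm rho0) (le_trans _ IH)// ler_piMl.
by rewrite -natr1; lra.
Qed.

(** With y = t^2 / (2 m), the cosine transform is 1 - y (1 - 1/n) up to a remainder. The term y / n
    is the deficit of the variance, y^2 the cost of passing from 1 - y to exp(- y), and the factor 3
    counts one remainder for the cosine and two for the sine. *)
Lemma scaled_column_transform (m n j : nat) (t eps C : R) :
  (0 < n)%N -> (0 < m)%N ->
  \int[P]_w (column_form X (col j) n w ^+ 2 *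
    Num.min 1 (`|t| / Num.sqrt (2 * m%:R) * `|column_form X (col j) n w|)) <=
    eps + C * (`|t| / Num.sqrt (2 * m%:R)) ->
  `|\int[P]_w cos (t * scaled_column m n j w + 0) -
     expR (- (t ^+ 2 / (2 * m%:R)))| +
  `|\int[P]_w sin (t * scaled_column m n j w + 0)| <=
  t ^+ 2 / (2 * m%:R) * (3 * (eps + C * (`|t| / Num.sqrt (2 * m%:R))) +
    n%:R^-1 + t ^+ 2 / (2 * m%:R)).
Proof.
move=> n0 m0; set s := `|t| / _; set y := t ^+ 2 / _ => hU.
have m0' : 0 < m%:R :> R by rewrite ltr0n.
have r0 : 0 < Num.sqrt (2 * m%:R) :> R by rewrite sqrtr_gt0 mulr_gt0.
have r2 : Num.sqrt (2 * m%:R) ^+ 2 = 2 * m%:R :> R by rewrite sqr_sqrtr// mulr_ge0.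
have y0 : 0 <= y by rewrite mulr_ge0 ?sqr_ge0// invr_ge0 mulr_ge0.
pose V := scaled_column m n j; pose U := column_form X (col j) n.
have sV : L2 P V := L2_scaled_column m n j.
have mV := L2_measurable sV.
have cubV w : cub (t * V w) = y * (U w ^+ 2 * Num.min 1 (s * `|U w|)).
  rewrite /cub /V /scaled_column -/(U w) !exprMn exprVn r2 !normrM normfV (gtr0_norm r0).
  by rewrite !mulrA /y /s; congr (_ * _); rewrite mulrAC.
have Lcub : L1 P (fun w => cub (t * V w)).
  apply: L1_le (L1Z (t ^+ 2) (L2_sqr sV)) _.
    apply: measurable_funM.
      by apply: measurable_funX; exact: measurable_funM.
    by apply: measurable_minr => //; apply: measurableT_comp => //; exact: measurable_funM.
  move=> w; rewrite ger0_norm ?cub_ge0// /cub exprMn ler_piMr ?ge_min ?lexx//.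
  by rewrite mulr_ge0 ?sqr_ge0.
have Ecub : \int[P]_w cub (t * V w) <= y * (eps + C * s).
  under eq_Rintegral do rewrite cubV.
  (* Integrability of the factor behind [y] is obtained from [Lcub] by dividing by [y], so the value
     0 is treated apart. *)
  have [y00|yn0] := eqVneq y 0.
    by under eq_Rintegral do rewrite y00 mul0r; rewrite Ex_cst y00 mul0r.
  rewrite ExZ ?ler_wpM2l//.
  have := L1Z y^-1 Lcub; congr (L1 P _); apply/funext => w.
  by rewrite cubV mulKf.
have EV2 : \int[P]_w (V w ^+ 2) = (1 - n%:R^-1) / m%:R by exact: scaled_column_var.
have iC := L1_cos_comp t 0 mV; have iS := L1_sin_comp t 0 mV.
have iV := L2_L1 sV; have iV2 := L2_sqr sV.
have cE : `|\int[P]_w cos (t * V w + 0) - (1 - y * (1 - n%:R^-1))| <= y * (eps + C * s).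
  have -> : 1 - y * (1 - n%:R^-1) = \int[P]_w (1 - t ^+ 2 / 2 * V w ^+ 2).
    rewrite (ExB (L1_cst P 1) (L1Z (t ^+ 2 / 2) iV2)) Ex_cst ExZ// EV2.
    by rewrite /y; field; rewrite !pnatr_eq0 -!lt0n n0 m0.
  apply: (le_trans (Ex_dist_le iC _ Lcub _)) => //.
    by apply: L1B; [exact: L1_cst|exact: L1Z].
  move=> w; rewrite addr0; have := cos_taylor (t * V w).
  have -> // : cos (t * V w) - (1 - t ^+ 2 / 2 * V w ^+ 2) =
    cos (t * V w) - 1 + (t * V w) ^+ 2 / 2.
  by field.
have sE : `|\int[P]_w sin (t * V w + 0)| <= 2 * (y * (eps + C * s)).
  have E0 : \int[P]_w (t * V w) = 0 by rewrite ExZ// scaled_column_mean mulr0.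
  have h w : `|sin (t * V w + 0) - t * V w| <= 2 * cub (t * V w).
    by rewrite addr0; exact: sin_taylor.
  have := Ex_dist_le iS (L1Z t iV) (L1Z 2 Lcub) h.
  by rewrite E0 subr0 => /le_trans; apply; rewrite ExZ// ler_wpM2l.
have rE := expRN_taylor y0.
have n1 : 0 <= n%:R^-1 :> R by rewrite invr_ge0.
have yn := mulr_ge0 y0 n1.
apply: (@le_trans _ _ ((y * (eps + C * s) + y * n%:R^-1 + y ^+ 2) + 2 * (y * (eps + C * s)))).
  apply: lerD => //.
  have -> : \int[P]_w cos (t * scaled_column m n j w + 0) - expR (- y) =
    (\int[P]_w cos (t * V w + 0) - (1 - y * (1 - n%:R^-1))) + y * n%:R^-1 -
    (expR (- y) - 1 + y) by rewrite /V; ring.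
  rewrite (le_trans (ler_normB _ _))// lerD// (le_trans (ler_normD _ _))// lerD//.
  by rewrite ger0_norm.
by rewrite expr2; lra.
Qed.

End column_sums.

Section column_clt.
Context {R : realType} d0 (T0 : measurableType d0) (P0 : probability T0 R)
  (xi : {RV P0 >-> R}).
Hypothesis sxi : L2 P0 xi.
Hypothesis xi0 : \int[P0]_w xi w = 0.
Hypothesis xi1 : \int[P0]_w (xi w ^+ 2) = 1.
Context d (T : measurableType d) (P : probability T R).
Context (X : nat * nat -> {RV P >-> R}).
Hypothesis copies : independent_copies xi X.
Variable n : nat -> nat.
Hypothesis n_gt0 : forall m, (0 < m)%N -> (0 < n m)%N.
Hypothesis n_cvg : n m @[m --> \oo] --> \oo.

Lemma cvgnyV (e : R) : 0 < e -> \forall m \near \oo, (n m)%:R^-1 <= e.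
Proof.
move=> e0.
have : \forall m \near \oo, ((Num.truncn e^-1).+1 <= n m)%N.
  exact: (n_cvg (nbhs_infty_ge _)).
apply: filterS => m hm.
have h : e^-1 <= (n m)%:R.
  by rewrite (le_trans (ltW (truncnS_gt _)))// ler_nat.
rewrite -[leRHS]invrK lef_pV2 ?posrE ?invr_gt0//.
by rewrite (lt_le_trans _ h) ?invr_gt0.
Qed.

(** The errors of the [m] columns add up to m y = t^2 / 2, a constant, times a bracket that becomes
    arbitrarily small. *)
Lemma column_sum_cos_cvg (t c : R) :
  \int[P]_w cos (t * column_sum X m (n m) m w + c) @[m --> \oo] -->
  \int[std_normal R]_x cos (t * x + c).
Proof.
rewrite normal_cos; apply/cvgrPdist_le => e e0.
pose A := t ^+ 2 / 2.
have A0 : 0 <= A by rewrite mulr_ge0 ?sqr_ge0.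
(* [A] vanishes when [t] does, so the constants divide by [A + 1]; [eps] and [eta] each account for
   half of [e]. *)
have A1 : 0 < A + 1 by rewrite ltr_wpDl.
pose eps := e / (6 * (A + 1)).
have eps0 : 0 < eps by rewrite divr_gt0// mulr_gt0.
have [C C0 [N hN]] := column_form_unif_int sxi xi0 xi1 copies eps0.
have C1 : 0 < 3 * C + 2 by rewrite ltr_wpDl// mulr_ge0.
pose eta := e / (2 * (A + 1) * (3 * C + 2)).
have eta0 : 0 < eta by rewrite divr_gt0// !mulr_gt0.
near=> m.
have m0 : (0 < m)%N by near: m; exact: nbhs_infty_gt.
have m0' : 0 < m%:R :> R by rewrite ltr0n.
have n0 := n_gt0 m0.
have Nn : (N <= n m)%N by near: m; exact: (n_cvg (nbhs_infty_ge N)).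
have nV : (n m)%:R^-1 <= eta by near: m; exact: cvgnyV.
(* The bound by [eta ^+ 2] is used for the square root of the left side, which is [s] below. *)
have y_le : t ^+ 2 / (2 * m%:R) <= Num.min eta (eta ^+ 2).
  have -> : t ^+ 2 / (2 * m%:R) = A / m%:R by rewrite /A invfM mulrA.
  rewrite ler_pdivrMr// mulrC -ler_pdivrMr; last first.
    by rewrite lt_min eta0 exprn_gt0.
  by near: m; exact: nbhs_infty_ger.
have y1 : t ^+ 2 / (2 * m%:R) <= eta by rewrite (le_trans y_le)// ge_min lexx.
have s1 : `|t| / Num.sqrt (2 * m%:R) <= eta.
  rewrite -ler_sqr; [|by rewrite nnegrE divr_ge0 ?sqrtr_ge0|by rewrite nnegrE ltW].
  rewrite exprMn exprVn sqr_sqrtr ?mulr_ge0// real_normK ?num_real//.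
  by rewrite (le_trans y_le)// ge_min lexx orbT.
set s := `|t| / _ in s1; set y := t ^+ 2 / _ in y1.
have s0 : 0 <= s by rewrite divr_ge0// sqrtr_ge0.
pose del := y * (3 * (eps + C * s) + (n m)%:R^-1 + y).
have rho01 : 0 <= expR (- y) <= 1.
  have y0 : 0 <= y by rewrite /y divr_ge0 ?sqr_ge0 ?mulr_ge0.
  by rewrite expR_ge0 -expR0 ler_expR oppr_le0.
have hdel j : `|\int[P]_w cos (t * scaled_column X m (n m) j w + 0) - expR (- y)| +
    `|\int[P]_w sin (t * scaled_column X m (n m) j w + 0)| <= del.
  apply: (scaled_column_transform sxi xi0 xi1 copies n0 m0).
  by apply: hN => //; exact: inj_col.
have := column_sum_cos sxi copies m c rho01 hdel.
have -> : expR (- y) ^+ m = expR (- A).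
  by rewrite -expRM_natl; congr expR; rewrite /y /A; field; rewrite gt_eqF.
rewrite distrC => /le_trans; apply.
have ym : m%:R * y = A by rewrite /y /A; field; rewrite gt_eqF.
rewrite /del mulrA ym.
have b : 3 * (eps + C * s) + (n m)%:R^-1 + y <= 3 * eps + (3 * C + 2) * eta.
  by have := ler_wpM2l C0 s1; lra.
apply: (le_trans (ler_wpM2l A0 b)).
apply: (@le_trans _ _ ((A + 1) * (3 * eps + (3 * C + 2) * eta))).
  rewrite ler_wpM2r// ?lerDl//.
  by rewrite addr_ge0// mulr_ge0// ltW.
rewrite le_eqVlt; apply/orP; left; apply/eqP.
by rewrite /eps /eta; field; rewrite !gt_eqF.
Unshelve. all: by end_near. Qed.

Lemma column_sum_clt (f : R -> R) (L M : R) :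
  (forall x y, `|f x - f y| <= L * `|x - y|) -> (forall x, `|f x| <= M) ->
  \int[P]_w f (column_sum X m (n m) m w) @[m --> \oo] -->
  \int[std_normal R]_x f x.
Proof.
have s2 m : L2 P (column_sum X m (n m) m) := L2_column_sum sxi copies m (n m) m.
have N0 : 0 <= \int[std_normal R]_x (x ^+ 2) by apply: Ex_ge0 => x; exact: sqr_ge0.
apply: (@trig_cvg_lipschitz _ _ _ P (fun m => column_sum X m (n m) m) _ _ _
  (1 + \int[std_normal R]_x (x ^+ 2))) => //.
- by move=> m; exact: L2_measurable (s2 m).
- exact: column_sum_cos_cvg.
- case=> [|m].
    under eq_Rintegral do rewrite /column_sum big_ord0 expr0n.
    by rewrite Ex_cst addr_ge0.
  apply: (le_trans (column_sum_var sxi xi0 xi1 copies m.+1 (n_gt0 _) _)) => //.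
  by rewrite divff ?pnatr_eq0// lerDl.
- exact: std_normal_L2.
- by rewrite lerDr.
Qed.

End column_clt.

(** * Growth of the normalizing sequence *)

(** The squared modulus of the characteristic function. It is multiplicative on independent sums and
    stays in [0, 1], so its powers decrease. *)
Definition sqr_cf (R : realType) d (T : measurableType d)
    (P : probability T R) (A : T -> R) (t : R) : R :=
  (\int[P]_w cos (t * A w)) ^+ 2 + (\int[P]_w sin (t * A w)) ^+ 2.

Lemma measurable_cos_comp (R : realType) d (T : measurableType d)
    (A : T -> R) (t : R) : measurable_fun [set: T] A ->
  measurable_fun [set: T] (fun w => cos (t * A w)).
Proof.
move=> mA; rewrite (_ : (fun _ => _) = (fun w => cos (t * A w + 0))).
  exact: (measurableT_comp (measurable_cos_affine t 0)).
by apply/funext => w; rewrite addr0.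
Qed.

Lemma measurable_sin_comp (R : realType) d (T : measurableType d)
    (A : T -> R) (t : R) : measurable_fun [set: T] A ->
  measurable_fun [set: T] (fun w => sin (t * A w)).
Proof.
move=> mA; rewrite (_ : (fun _ => _) = (fun w => sin (t * A w + 0))).
  exact: (measurableT_comp (measurable_sin_affine t 0)).
by apply/funext => w; rewrite addr0.
Qed.

Section squared_modulus.
Context {R : realType} d (T : measurableType d) (P : probability T R).

Lemma L2_cos_comp (A : T -> R) (t : R) : measurable_fun [set: T] A ->
  L2 P (fun w => cos (t * A w)).
Proof.
move=> mA; apply: (@L2_bounded _ _ _ _ _ 1) => [|w]; last exact: cos_max.
exact: measurable_cos_comp.
Qed.

Lemma L2_sin_comp (A : T -> R) (t : R) : measurable_fun [set: T] A ->
  L2 P (fun w => sin (t * A w)).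
Proof.
move=> mA; apply: (@L2_bounded _ _ _ _ _ 1) => [|w]; last exact: sin_max.
exact: measurable_sin_comp.
Qed.

Lemma sqr_cf_ge0 (A : T -> R) t : 0 <= sqr_cf P A t.
Proof. by rewrite addr_ge0 ?sqr_ge0. Qed.

Lemma sqr_cf_le1 (A : T -> R) t : measurable_fun [set: T] A -> sqr_cf P A t <= 1.
Proof.
move=> mA; have sc := L2_cos_comp t mA; have ss := L2_sin_comp t mA.
apply: (le_trans (lerD (Ex_sqr_le sc) (Ex_sqr_le ss))).
rewrite -ExD; [|exact: L2_sqr..].
by under eq_Rintegral do rewrite cos2Dsin2; rewrite Ex_cst.
Qed.

Lemma sqr_cfZ (A : T -> R) (k t : R) :
  sqr_cf P (fun w => k * A w) t = sqr_cf P A (t * k).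
Proof.
by rewrite /sqr_cf; congr (_ ^+ 2 + _ ^+ 2); apply: eq_Rintegral => w _;
  rewrite mulrA.
Qed.

Lemma sqr_cf_add (A B : T -> R) t : measurable_fun [set: T] A ->
  measurable_fun [set: T] B -> indep P A B ->
  sqr_cf P (fun w => A w + B w) t = sqr_cf P A t * sqr_cf P B t.
Proof.
move=> mA mB AB.
have mc : measurable_fun [set: R] (fun x => cos (t * x)).
  exact: measurable_cos_comp (@measurable_id _ R setT).
have ms : measurable_fun [set: R] (fun x => sin (t * x)).
  exact: measurable_sin_comp (@measurable_id _ R setT).
have cA := L2_L1 (L2_cos_comp t mA); have sA := L2_L1 (L2_sin_comp t mA).
have cB := L2_L1 (L2_cos_comp t mB); have sB := L2_L1 (L2_sin_comp t mB).
have cc := indep_comp mc mc AB; have ss := indep_comp ms ms AB.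
have sc := indep_comp ms mc AB; have cs := indep_comp mc ms AB.
rewrite /sqr_cf.
have -> : \int[P]_w cos (t * (A w + B w)) =
    \int[P]_w cos (t * A w) * \int[P]_w cos (t * B w) -
    \int[P]_w sin (t * A w) * \int[P]_w sin (t * B w).
  rewrite -(indep_ExM cc cA cB) -(indep_ExM ss sA sB).
  rewrite -(ExB (indep_L1M cc cA cB) (indep_L1M ss sA sB)).
  by apply: eq_Rintegral => w _; rewrite mulrDr cosD.
have -> : \int[P]_w sin (t * (A w + B w)) =
    \int[P]_w sin (t * A w) * \int[P]_w cos (t * B w) +
    \int[P]_w cos (t * A w) * \int[P]_w sin (t * B w).
  rewrite -(indep_ExM sc sA cB) -(indep_ExM cs cA sB).
  rewrite -(ExD (indep_L1M sc sA cB) (indep_L1M cs cA sB)).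
  by apply: eq_Rintegral => w _; rewrite mulrDr sinD.
by ring.
Qed.

End squared_modulus.

(* If the modulus is 1 at every 1/(k+1), then x/(k+1) is a.s. constant modulo
   2 pi for all k, hence x is a.s. constant. *)
Lemma nondegenerate_sqr_cf (R : realType) (mu : probability R R) :
  nondegenerate_law mu -> exists2 u : R, 0 < u & sqr_cf mu id u < 1.
Proof.
move=> nd; apply: contrapT => H.
have mid : measurable_fun [set: R] (@id R) by exact: measurable_id.
have cf1 u : 0 < u -> sqr_cf mu id u = 1.
  move=> u0; apply/eqP; rewrite eq_le sqr_cf_le1//= leNgt.
  by apply/negP => h; apply: H; exists u.
pose u (k : nat) : R := k.+1%:R^-1.
have u0 k : 0 < u k by rewrite invr_gt0.
pose C k := \int[mu]_x cos (u k * x); pose S k := \int[mu]_x sin (u k * x).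
have CS k : C k ^+ 2 + S k ^+ 2 = 1 by exact: cf1 (u0 k).
(* As phi(u) has modulus 1, [f k] is half of |phi(u) - exp(i u x)|^2, where u stands for [u k]; its
   integral is 1 - |phi(u)|^2 = 0. *)
pose f k x := 1 - (C k * cos (u k * x) + S k * sin (u k * x)).
have f2 k x : 2 * f k x = (C k - cos (u k * x)) ^+ 2 + (S k - sin (u k * x)) ^+ 2.
  rewrite /f; have := CS k; have := cos2Dsin2 (u k * x).
  by move: (cos _) (sin _) (C k) (S k) => a b p q h1 h2; lra.
have f0 k x : 0 <= f k x.
  by rewrite -(pmulr_rge0 _ (ltr0n R 2)) f2 addr_ge0 ?sqr_ge0.
have iC k := L2_L1 (L2_cos_comp mu (u k) mid).
have iS k := L2_L1 (L2_sin_comp mu (u k) mid).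
have if_ k : L1 mu (f k).
  by apply: L1B; [exact: L1_cst|apply: L1D; exact: L1Z].
have Ef k : \int[mu]_x f k x = 0.
  rewrite ExB; [|exact: L1_cst|by apply: L1D; exact: L1Z].
  rewrite Ex_cst (ExD (L1Z _ (iC k)) (L1Z _ (iS k))) !ExZ//.
  by rewrite -!expr2 CS subrr.
have ae k : \forall x \ae mu, f k x = 0.
  have mfk : measurable_fun [set: R] (EFin \o f k).
    exact/measurable_EFinP/L1_measurable/if_.
  have : (\int[mu]_x `|(EFin \o f k) x| = 0)%E.
    rewrite (eq_integral (fun x => (f k x)%:E)); last first.
      by move=> x _; rewrite gee0_abs// lee_fin.
    by rewrite (EFin_Ex (if_ k)) Ef.
  move/(ae_eq_integral_abs mu measurableT mfk).
  by apply: filterS => x /(_ I) [].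
have /(@ae_foralln _ _ _ mu) aeA : forall k, \forall x \ae mu, f k x = 0 by exact: ae.
case: aeA => N [mN N0 hN].
have muT : mu [set: R] = 1%E := probability_setT mu.
have [x0 x0N] : exists x0, (~` N) x0.
  apply: contrapT => h; have NT : N = setT.
    by apply/seteqP; split => // x _; apply: contrapT => xN; apply: h; exists x.
  have muN : mu N = 1%E by rewrite NT.
  by move: muN; rewrite N0 => /eqP; rewrite eq_sym onee_eq0.
have good x : (~` N) x -> forall k, f k x = 0.
  by move=> xN; apply: contrapT => h; apply: xN; apply: hN.
have sub : ~` N `<=` [set x0].
  move=> x xN; apply: contrapT => xx0.
  pose D := x - x0.
  have D0 : D != 0 by rewrite subr_eq0; apply/eqP.
  (* Large enough for |D| / (k + 1) < 1, a range where the sine vanishes only at 0. *)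
  pose k := Num.truncn `|D|.
  have Dk : `|u k * D| < 1.
    by rewrite normrM (gtr0_norm (u0 k)) /u mulrC ltr_pdivrMr// mul1r truncnS_gt.
  have cos_eq y : (~` N) y -> cos (u k * y) = C k /\ sin (u k * y) = S k.
    move=> yN; have := f2 k y; rewrite (good _ yN k) mulr0 => /esym/eqP.
    rewrite paddr_eq0 ?sqr_ge0// !sqrf_eq0 !subr_eq0.
    by move=> /andP[/eqP -> /eqP ->].
  have [cx sx] := cos_eq _ xN; have [cx0 sx0] := cos_eq _ x0N.
  have sD : sin (u k * D) = 0.
    by rewrite /D mulrBr sinB cx sx cx0 sx0 mulrC subrr.
  have := @sin_lower_lipschitz R (u k * D) 0 (ltW Dk).
  rewrite normr0 sin0 sD !subr0 normr0 => /(_ (ler01)).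
  rewrite pmulr_rle0 ?cos1_gt0// normr_le0 mulf_eq0 (negbTE D0) orbF.
  by rewrite gt_eqF.
apply: (nd x0); apply/eqP; rewrite eq_le probability_le1//=.
rewrite (@le_trans _ _ (mu (~` N)))//.
  by rewrite probability_setC// N0 sube0.
by apply: le_measure => //; rewrite inE//; exact: measurableC.
Qed.

Lemma min_lipschitz (R : realType) (c t x y : R) : 0 <= t ->
  `|Num.min c (t * `|x|) - Num.min c (t * `|y|)| <= t * `|x - y|.
Proof.
move=> t0.
have h (u v : R) : `|Num.min c u - Num.min c v| <= `|u - v|.
  wlog uv : u v / u <= v => [H|].
    by have [/H//|/ltW/H] := leP u v; rewrite distrC [leRHS]distrC.
  have [u2|u2] := leP c u.
    by rewrite min_l ?subrr ?normr0//; lra.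
  have [v2|v2] := leP c v; last by [].
  by rewrite !ler0_norm; lra.
rewrite (le_trans (h _ _))// -mulrBr normrM (ger0_norm t0) ler_wpM2l//.
exact: ler_dist_dist.
Qed.

Lemma onem_cos_le_min (R : realType) (t x : R) : 0 <= t ->
  1 - cos (t * x) <= Num.min 2 (t * `|x|).
Proof.
move=> t0; rewrite le_min; apply/andP; split.
  by have := cos_geN1 (t * x); lra.
have := @mvt_le R cos (fun y => - sin y) 0 (t * x) 1 (@is_derive_cos R).
rewrite cos0 subr0 mul1r normrM (ger0_norm t0) distrC => h.
by rewrite (le_trans (ler_norm _))// h// => y _; rewrite normrN sin_max.
Qed.

Section normalizing_sequence.
Context {R : realType} d (T : measurableType d) (P : probability T R).
Context (X : nat -> {RV P >-> R}) (g : R -> R) (q : R -> R).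
Hypothesis indX : mutually_independent X.
Hypothesis mg : measurable_fun [set: R] g.
Hypothesis qE : forall i t, sqr_cf P (fun w => g (X i w)) t = q t.

Local Notation S := (psum X id g).

Let inj_id : injective (@id nat). Proof. by []. Qed.

Let mgX i : measurable_fun [set: T] (fun w => g (X i w)).
Proof. exact: (measurableT_comp mg). Qed.

Let mS m : measurable_fun [set: T] (S m).
Proof. exact: gen_measurable_measurable (@gen_measurable_psum _ _ _ P _ X id g m mg). Qed.

Lemma sqr_cf_psum m t : sqr_cf P (S m) t = q t ^+ m.
Proof.
elim: m => [|m IH].
  rewrite /sqr_cf /psum; under eq_Rintegral do rewrite big_ord0 mulr0 cos0.
  under [X in _ + X ^+ 2]eq_Rintegral do rewrite big_ord0 mulr0 sin0.
  by rewrite !Ex_cst expr0 expr1n expr0n addr0.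
rewrite (_ : S m.+1 = fun w => g (X m w) + S m w); last first.
  by apply/funext => w; rewrite psumS addrC.
rewrite sqr_cf_add//; last first.
  exact: (indep_last indX inj_id mg (@gen_measurable_psum _ _ _ P _ X id g m mg)).
by rewrite IH qE exprS.
Qed.

Variables (b : nat -> R) (mu : probability R R).
Hypothesis b_gt0 : forall m, (0 < m)%N -> 0 < b m.
Hypothesis cvgY : cvg_in_distribution P (fun m w => S m w / b m) mu.
Hypothesis nd : nondegenerate_law mu.

Let cos_cont t : continuous (fun x : R => cos (t * x)).
Proof.
have := @continuous_cos_affine R t 0.
by under eq_fun do rewrite addr0.
Qed.

Let sin_cont t : continuous (fun x : R => sin (t * x)).
Proof.
have := @continuous_sin_affine R t 0.
by under eq_fun do rewrite addr0.
Qed.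

Let sqr_cf_cvg u :
  sqr_cf P (fun w => S m w / b m) u @[m --> \oo] --> sqr_cf mu id u.
Proof.
have hc : \int[P]_w cos (u * (S m w / b m)) @[m --> \oo] --> \int[mu]_x cos (u * x).
  exact: (cvg_in_distribution_Ex cvgY (@cos_cont u) (fun x => cos_max (u * x))).
have hs : \int[P]_w sin (u * (S m w / b m)) @[m --> \oo] --> \int[mu]_x sin (u * x).
  exact: (cvg_in_distribution_Ex cvgY (@sin_cont u) (fun x => sin_max (u * x))).
rewrite /sqr_cf expr2 [X in _ --> _ + X]expr2.
under eq_fun do rewrite expr2 [X in _ + X]expr2.
by apply: cvgD; apply: cvgM.
Qed.

Let sqr_cf_norm m u : sqr_cf P (fun w => S m w / b m) u = q (u / b m) ^+ m.
Proof.
rewrite -sqr_cf_psum -sqr_cfZ.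
congr (sqr_cf P _ _); apply/funext => w; exact: mulrC.
Qed.

(* Otherwise |phi_N| <= 1 - eta/2 at a point where |phi_M| >= 1 - eta/8, while
   |phi|^M <= |phi|^N. *)
Lemma normalizing_almost_monotone : exists2 C : R, 0 < C &
  exists N0 : nat, forall N M, (N0 <= N)%N -> (N <= M)%N -> b N <= C * b M.
Proof.
have [u u0 hu] := nondegenerate_sqr_cf nd.
pose eta := 1 - sqr_cf mu id u.
have eta0 : 0 < eta by rewrite subr_gt0.
have eta1 : eta <= 1 by rewrite gerBl sqr_cf_ge0.
have eta2 : 0 < eta / 2 by rewrite divr_gt0.
(* The bound eta / 32 on the limit gives eta / 16 before the limit, and (1 - eta / 16)^2 > 1 - eta /
   2. *)
have eta32 : 0 < eta / 32 by rewrite divr_gt0.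
have mid : measurable_fun [set: R] (@id R) by exact: measurable_id.
have [tau tau0 htau] := Ex_min_cvg0 mu mid (ler0n R 2) eta32.
have /cvgrPdist_le/(_ _ eta2)[N1 _ hN1] := @sqr_cf_cvg u.
have min_cont : continuous (fun x : R => Num.min 2 (tau * `|x|)).
  by apply: (@lipschitz_continuous _ _ tau) => x y; apply/min_lipschitz/ltW.
have min_bd (x : R) : `|Num.min 2 (tau * `|x|)| <= 2.
  have h : 0 <= Num.min 2 (tau * `|x|) by rewrite le_min ler0n mulr_ge0// ltW.
  by rewrite ger0_norm// ge_min lexx.
have := cvg_in_distribution_Ex cvgY min_cont min_bd.
move=> /cvgrPdist_le/(_ _ eta32)[N2 _ hN2].
(* This constant puts t = u b_M / b_N below [tau] as soon as b_N > C b_M; there E min(2, tau |S_M /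
   b_M|) bounds 1 - E cos (t S_M / b_M). *)
exists (u / tau); first by rewrite divr_gt0.
exists (maxn 1 (maxn N1 N2)) => N M; rewrite !geq_max => /and3P[N_gt0 hN1N hN2N] NM.
have M_gt0 : (0 < M)%N by exact: leq_trans NM.
have bN := b_gt0 N_gt0; have bM := b_gt0 M_gt0.
rewrite leNgt; apply/negP => lt_b.
(* Chosen so that t / b_M = u / b_N: both sums then involve [q] at the same point. *)
pose t := u * b M / b N.
have t0 : 0 < t by rewrite divr_gt0// mulr_gt0.
have t_tau : t <= tau.
  rewrite ler_pdivrMr//; move: lt_b; rewrite mulrAC ltr_pdivrMr// => h.
  by rewrite [leRHS]mulrC ltW.
have qN : q (u / b N) ^+ N <= 1 - eta / 2.
  have := hN1 N hN1N; rewrite sqr_cf_norm /eta ler_norml => /andP[h1 h2].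
  by lra.
have q01 : 0 <= q (u / b N) <= 1.
  by rewrite -(qE 0) sqr_cf_ge0 sqr_cf_le1.
have qM : q (u / b N) ^+ M <= 1 - eta / 2.
  by apply: le_trans qN; case/andP: q01 => q0 q1; exact: ler_wiXn2l.
have := hN2 M (leq_trans hN2N NM).
set E := \int[P]_w _ => hE.
have E16 : E <= eta / 16.
  by move: hE htau; rewrite ler_norml => /andP[h1 h2] h3; lra.
have mY : measurable_fun [set: T] (fun w => S M w / b M).
  by apply: measurable_funM.
have iC := L2_L1 (L2_cos_comp P t mY).
have iE : L1 P (fun w => Num.min 2 (tau * `|S M w / b M|)).
  apply: (@L1_bounded _ _ _ _ _ 2) => [|w]; last exact: min_bd.
  have mmin := continuous_measurable_fun min_cont.
  exact: (measurableT_comp mmin mY).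
have cos_big : 1 - eta / 16 <= \int[P]_w cos (t * (S M w / b M)).
  apply: (@le_trans _ _ (1 - E)); first by lra.
  rewrite -[X in X - _](Ex_cst P) -ExB//; last exact: L1_cst.
  apply: le_Ex => //; first by apply: L1B => //; exact: L1_cst.
  move=> w; have := @onem_cos_le_min R t (S M w / b M) (ltW t0).
  have : Num.min 2 (t * `|S M w / b M|) <= Num.min 2 (tau * `|S M w / b M|).
    by rewrite le_min2// ler_wpM2r.
  by lra.
have : (1 - eta / 16) ^+ 2 <= sqr_cf P (fun w => S M w / b M) t.
  rewrite /sqr_cf -[leLHS]addr0 lerD ?sqr_ge0//.
  by rewrite lerXn2r ?nnegrE//; lra.
rewrite sqr_cf_norm.
have -> : t / b M = u / b N by rewrite /t; field; rewrite !gt_eqF.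
by move: qM; set Q := _ ^+ M; have := sqr_ge0 eta; nra.
Qed.

End normalizing_sequence.

Lemma le_powR_nat (R : realType) (r : R) (m n : nat) : 0 <= r -> (m <= n)%N ->
  m%:R `^ r <= n%:R `^ r.
Proof. by move=> r0 mn; apply: ge0_ler_powR; rewrite ?nnegrE// ler_nat. Qed.

(** * Growth bounds, from the powers of 2 to all integers *)

Section growth.
Context {R : realType} (b : nat -> R) (p C : R) (N0 : nat).
Hypothesis b_gt0 : forall m, (0 < m)%N -> 0 < b m.
Hypothesis C_gt0 : 0 < C.
Hypothesis b_mono : forall N M, (N0 <= N)%N -> (N <= M)%N -> b N <= C * b M.
Hypothesis b_double : b (2 ^ k.+1) / b (2 ^ k) @[k --> \oo] --> 2 `^ p.

Let pow2_gt0 k : 0 < b (2 ^ k). Proof. by rewrite b_gt0// expn_gt0. Qed.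

Let powR2S (r : R) k : (2 ^ k.+1)%:R `^ r = 2 `^ r * (2 ^ k)%:R `^ r :> R.
Proof. by rewrite expnS natrM powRM. Qed.

(** Once the doubling ratio stays between 2^(p - eta) and 2^(p + eta), the bounds propagate from
    [k0], where [B1] and [B2] make them equalities. *)
Lemma pow2_growth (eta : R) : 0 < eta -> exists B1 B2 : R, exists k0 : nat,
  [/\ 0 < B1, 0 < B2 & forall k, (k0 <= k)%N ->
    B1 * (2 ^ k)%:R `^ (p - eta) <= b (2 ^ k) <= B2 * (2 ^ k)%:R `^ (p + eta)].
Proof.
move=> eta0.
have up : 2 `^ p < 2 `^ (p + eta) :> R.
  by rewrite /powR pnatr_eq0/= ltr_expR ltr_pM2r ?ltrDl// ln_gt0// ltr1n.
have lo : 2 `^ (p - eta) < 2 `^ p :> R.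
  by rewrite /powR pnatr_eq0/= ltr_expR ltr_pM2r ?gtrBl// ln_gt0// ltr1n.
have e0 : 0 < Num.min (2 `^ (p + eta) - 2 `^ p) (2 `^ p - 2 `^ (p - eta)) :> R.
  by rewrite lt_min !subr_gt0 up.
have /cvgrPdist_le/(_ _ e0)[k0 _ hk0] := b_double.
have ratio k : (k0 <= k)%N ->
    2 `^ (p - eta) * b (2 ^ k) <= b (2 ^ k.+1) <= 2 `^ (p + eta) * b (2 ^ k).
  move=> hk; have := hk0 k hk; rewrite le_min => /andP[a1 a2].
  move: a1; rewrite ler_norml => /andP[h1 _].
  move: a2; rewrite ler_norml => /andP[_ h2].
  by apply/andP; split; [rewrite -ler_pdivlMr//; lra|rewrite -ler_pdivrMr//; lra].
have P0 (r : R) : 0 < (2 ^ k0)%:R `^ r by rewrite powR_gt0// ltr0n expn_gt0.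
exists (b (2 ^ k0) / (2 ^ k0)%:R `^ (p - eta)).
exists (b (2 ^ k0) / (2 ^ k0)%:R `^ (p + eta)), k0; split; rewrite ?divr_gt0//.
move=> k; elim: k => [|k IH]; first by rewrite leqn0 => /eqP <-; rewrite !divfK ?gt_eqF// !lexx.
rewrite leq_eqVlt => /predU1P[<-|hk]; first by rewrite !divfK ?gt_eqF// !lexx.
have /andP[h1 h2] := ratio k hk; have /andP[h3 h4] := IH hk.
rewrite !powR2S !mulrA ![_ / _ * 2 `^ _]mulrC -!mulrA.
rewrite (le_trans _ h1) ?(le_trans h2)// ler_wpM2l ?powR_ge0// mulrA//.
Qed.

(** For 2^k <= m < 2^(k+1), almost monotonicity carries the bounds from the two neighbouring powers
    to [m], at the cost of [C] and of one doubling. The condition eta < p keeps the exponents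
    positive. *)
Lemma normalizing_growth (eta : R) : 0 < eta < p -> exists c1 c2 : R, exists N1 : nat,
  [/\ 0 < c1, 0 < c2 & forall m, (N1 <= m)%N ->
    c1 * m%:R `^ (p - eta) <= b m <= c2 * m%:R `^ (p + eta)].
Proof.
move=> /andP[eta0 etap].
have [B1 [B2 [k0 [B10 B20 hB]]]] := pow2_growth eta0.
have q0 : 0 < p - eta by rewrite subr_gt0.
have q1 : 0 < p + eta by lra.
have two (r : R) : 0 < 2 `^ r :> R by rewrite powR_gt0.
exists (B1 / (C * 2 `^ (p - eta))), (C * B2 * 2 `^ (p + eta)).
(* 2^N0 instead of N0, so that the power of 2 just below [m] is itself at least N0. *)
exists (maxn (2 ^ k0) (2 ^ N0)); split.
- by rewrite divr_gt0// mulr_gt0.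
- by rewrite !mulr_gt0.
move=> m; rewrite geq_max => /andP[hm hm'].
have m0 : (0 < m)%N by rewrite (leq_trans _ hm)// expn_gt0.
have /andP[mk mk'] := trunc_log_bounds (isT : (1 < 2)%N) m0.
set k := trunc_log 2 m in mk mk'.
have k0k : (k0 <= k)%N by rewrite /k trunc_log_max.
have N0k : (N0 <= 2 ^ k)%N.
  rewrite (@leq_trans (2 ^ N0))//; first exact/ltnW/ltn_expl.
  by rewrite leq_exp2l// /k trunc_log_max.
have /andP[h1 _] := hB k k0k.
have /andP[_ h2] := hB k.+1 (leqW k0k).
have b1 := b_mono N0k mk.
have b2 := b_mono (leq_trans N0k mk) (ltnW mk').
apply/andP; split.
  rewrite mulrAC ler_pdivrMr ?mulr_gt0//.
  apply: (@le_trans _ _ (B1 * (2 ^ k.+1)%:R `^ (p - eta))).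
    apply: ler_wpM2l; first exact: ltW.
    exact: le_powR_nat (ltW q0) (ltnW mk').
  rewrite powR2S.
  have h3 : B1 * (2 ^ k)%:R `^ (p - eta) <= C * b m by exact: le_trans b1.
  have := ler_wpM2l (ltW (two (p - eta))) h3; lra.
apply: (le_trans b2); rewrite -!mulrA; apply: ler_wpM2l; first exact: ltW.
apply: (le_trans h2); apply: ler_wpM2l; first exact: ltW.
rewrite powR2S; apply: ler_wpM2l; first exact: ltW.
exact: le_powR_nat (ltW q1) mk.
Qed.

End growth.

(** * Comparison of the two scales *)

Lemma near_le_powR (R : realType) (theta K : R) : 0 < theta ->
  \forall d \near \oo, K <= d%:R `^ theta.
Proof.
move=> th0; pose A : R := `|K| + 1.
have A0 : 0 <= A by rewrite addr_ge0.
have : \forall d \near \oo, A `^ theta^-1 <= d%:R by exact: nbhs_infty_ger.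
apply: filterS => d hd.
have : (A `^ theta^-1) `^ theta <= d%:R `^ theta.
  by apply: ge0_ler_powR; rewrite ?nnegrE ?powR_ge0// ltW.
rewrite -powRrM mulVf ?gt_eqF// powRr1//; apply: le_trans.
by rewrite (le_trans (ler_norm K))// lerDl.
Qed.

Section growth_rates.
Context {R : realType} (alpha delta : R).
Hypothesis alpha12 : 1 < alpha < 2.
Hypothesis delta_gt0 : 0 < delta.

Let p : R := alpha^-1.
(** The critical exponent: (n d)^p and n d^(1/2) balance at n = d^kap, which is what [kapE]
    expresses. *)
Let kap : R := (2 - alpha) / (2 * alpha - 2).
(** An error [eta] in the growth exponent is amplified by kap + delta + 1, the exponent of n d at n
    = d^(kap + delta); with this choice it consumes half of the margin delta (1 - p). *)
Let eta : R := delta * (1 - p) / (2 * (kap + delta + 1)).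

Lemma inv_alpha_bounds : 2^-1 < p < 1.
Proof.
have /andP[a1 a2] := alpha12; have a0 : 0 < alpha by lra.
by rewrite /p ltf_pV2 ?posrE// a2 invf_lt1.
Qed.

Let kapE : kap * (1 - p) = p - 2^-1.
Proof.
have /andP[a1 a2] := alpha12; rewrite /kap /p; field.
by rewrite !gt_eqF//; lra.
Qed.

Let kap0 : 0 < kap.
Proof. by have /andP[a1 a2] := alpha12; rewrite divr_gt0//; lra. Qed.

Let etaE : eta * (kap + delta + 1) = delta * (1 - p) / 2.
Proof.
have k1 : kap + delta + 1 != 0 by rewrite gt_eqF// !addr_gt0// kap0.
by rewrite /eta; move: (kap + delta + 1) k1 => k k1; field.
Qed.

Lemma eta_bounds : [/\ 0 < eta, eta < p & p + eta < 1].
Proof.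
have /andP[p1 p2] := inv_alpha_bounds; have k0 := kap0.
have p1' : 0 < 1 - p by rewrite subr_gt0.
have k1 : 0 < 2 * (kap + delta + 1) by rewrite mulr_gt0// !addr_gt0.
have e0 : 0 < eta by rewrite divr_gt0// mulr_gt0.
have e1 : eta <= (1 - p) / 2.
  have : delta * eta <= delta * ((1 - p) / 2).
    have := etaE; have := mulr_gt0 e0 k0; lra.
  by rewrite ler_pM2l.
by split => //; lra.
Qed.

Variables (b : nat -> R) (n : nat -> nat).
Hypothesis b_gt0 : forall m, (0 < m)%N -> 0 < b m.
Hypothesis n_gt0 : forall d, (0 < d)%N -> (0 < n d)%N.
Hypothesis growth : exists c1 c2 : R, exists N1 : nat,
  [/\ 0 < c1, 0 < c2 & forall m, (N1 <= m)%N ->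
    c1 * m%:R `^ (p - eta) <= b m <= c2 * m%:R `^ (p + eta)].

(** With q = p + eta < 1, the ratio of n d^(1/2) to (n d)^q is n^(1 - q) d^(1/2 - q), at least
    d^theta by the lower bound on n; since theta > 0, this exceeds every constant. *)
Lemma above_threshold (e : R) : 0 < e ->
  (\forall d \near \oo, d%:R `^ (kap + delta) < (n d)%:R) ->
  \forall d \near \oo, b (n d * d) <= e * ((n d)%:R * Num.sqrt (2 * d%:R)).
Proof.
move=> e0 hn; have [c1 [c2 [N1 [c10 c20 hb]]]] := growth.
have [eta0 etap peta] := eta_bounds.
have /andP[p1 p2] := inv_alpha_bounds.
pose q := p + eta; pose theta := delta * (1 - p) / 2.
have th0 : 0 < theta by rewrite divr_gt0// mulr_gt0// subr_gt0.
have thE : (kap + delta) * (1 - q) = q - 2^-1 + theta.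
  by have := kapE; have := etaE; rewrite /q /theta; lra.
near=> d.
have d0 : (0 < d)%N by near: d; exact: nbhs_infty_gt.
have d0' : 0 < d%:R :> R by rewrite ltr0n.
have nd0 := n_gt0 d0; have nd0' : 0 < (n d)%:R :> R by rewrite ltr0n.
have N1d : (N1 <= n d * d)%N.
  rewrite (@leq_trans d)//; last by rewrite leq_pmull.
  by near: d; exact: nbhs_infty_ge.
have /andP[_ hb2] := hb _ N1d.
have hnd : d%:R `^ (kap + delta) < (n d)%:R by near: d.
have hc : c2 / e <= d%:R `^ theta by near: d; exact: near_le_powR.
apply: (le_trans hb2); rewrite -/q natrM powRM//.
have nsplit : (n d)%:R = (n d)%:R `^ q * (n d)%:R `^ (1 - q).
  rewrite -powRD; last by apply/implyP => _; rewrite gt_eqF.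
  by rewrite addrCA subrr addr0 powRr1.
have sq : d%:R `^ (2^-1) <= Num.sqrt (2 * d%:R) :> R.
  by rewrite powR12_sqrt// ler_sqrt; nra.
have n1q : d%:R `^ (q - 2^-1 + theta) <= (n d)%:R `^ (1 - q).
  rewrite -thE powRrM; apply: ge0_ler_powR; rewrite ?nnegrE ?powR_ge0//; last exact: ltW.
  by rewrite /q; lra.
apply: (@le_trans _ _ (e * ((n d)%:R `^ q * d%:R `^ (q - 2^-1 + theta) * d%:R `^ (2^-1)))).
  have -> : (n d)%:R `^ q * d%:R `^ (q - 2^-1 + theta) * d%:R `^ (2^-1) =
      (n d)%:R `^ q * d%:R `^ q * d%:R `^ theta.
    rewrite -!mulrA -!powRD; [|by apply/implyP => _; rewrite gt_eqF..].
    by congr (_ * _ `^ _); ring.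
  set X := _ `^ q * _; set th := d%:R `^ theta.
  have -> : e * (X * th) = th * e * X by ring.
  by apply: ler_wpM2r; rewrite ?mulr_ge0 ?powR_ge0// -ler_pdivrMr.
apply: ler_wpM2l; first exact: ltW.
rewrite [X in _ <= X * _]nsplit; apply: ler_pM; rewrite ?mulr_ge0 ?powR_ge0//.
by apply: ler_wpM2l; rewrite ?powR_ge0.
Unshelve. all: by end_near. Qed.

(** Here q = p - eta, and the upper bound on n makes the ratio of (n d)^q to n d^(1/2) at least
    d^theta. *)
Lemma below_threshold (e : R) : 0 < e ->
  (\forall d \near \oo, (n d)%:R < d%:R `^ (kap - delta)) ->
  \forall d \near \oo, (n d)%:R * Num.sqrt (2 * d%:R) <= e * b (n d * d).
Proof.
move=> e0 hn; have [c1 [c2 [N1 [c10 c20 hb]]]] := growth.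
have [eta0 etap peta] := eta_bounds.
have /andP[p1 p2] := inv_alpha_bounds.
pose q := p - eta; pose theta := q - 2^-1 - (kap - delta) * (1 - q).
(* In fact theta = delta (1 - p) / 2 + 2 delta eta. *)
have th0 : 0 < theta.
  have := kapE; have := etaE; rewrite /theta /q.
  have := mulr_gt0 delta_gt0 eta0; have : 0 < delta * (1 - p) by rewrite mulr_gt0// subr_gt0.
  by lra.
near=> d.
have d0 : (0 < d)%N by near: d; exact: nbhs_infty_gt.
have d0' : 0 < d%:R :> R by rewrite ltr0n.
have nd0 := n_gt0 d0; have nd0' : 0 < (n d)%:R :> R by rewrite ltr0n.
have N1d : (N1 <= n d * d)%N.
  rewrite (@leq_trans d)//; last by rewrite leq_pmull.
  by near: d; exact: nbhs_infty_ge.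
have /andP[hb1 _] := hb _ N1d.
have hnd : (n d)%:R < d%:R `^ (kap - delta) by near: d.
have hc : Num.sqrt 2 / (e * c1) <= d%:R `^ theta by near: d; exact: near_le_powR.
apply: (@le_trans _ _ (e * (c1 * (n d * d)%:R `^ q))); last by apply: ler_wpM2l => //; exact: ltW.
rewrite natrM powRM//.
have nsplit : (n d)%:R = (n d)%:R `^ q * (n d)%:R `^ (1 - q).
  rewrite -powRD; last by apply/implyP => _; rewrite gt_eqF.
  by rewrite addrCA subrr addr0 powRr1.
have n1q : (n d)%:R `^ (1 - q) <= d%:R `^ ((kap - delta) * (1 - q)).
  rewrite powRrM; apply: ge0_ler_powR; rewrite ?nnegrE ?powR_ge0//; last exact: ltW.
  by rewrite /q; lra.
rewrite sqrtrM// -(powR12_sqrt (ltW d0')).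
have dsplit : d%:R `^ q = d%:R `^ ((kap - delta) * (1 - q)) * d%:R `^ (2^-1) * d%:R `^ theta.
  rewrite -!powRD; [|by apply/implyP => _; rewrite gt_eqF..].
  by congr (_ `^ _); rewrite /theta; ring.
rewrite dsplit [X in X * _ <= _]nsplit.
have sc : Num.sqrt 2 <= e * c1 * d%:R `^ theta.
  by rewrite mulrC -ler_pdivrMr// mulr_gt0.
set A := _ `^ q; set B := (n d)%:R `^ _; set D := d%:R `^ (_ * _).
set h := d%:R `^ (2^-1); set th := d%:R `^ theta.
have -> : A * B * (Num.sqrt 2 * h) = (A * h) * (B * Num.sqrt 2) by ring.
have -> : e * (c1 * (A * (D * h * th))) = (A * h) * (D * (e * c1 * th)) by ring.
apply: ler_wpM2l; first by rewrite mulr_ge0 ?powR_ge0.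
by apply: ler_pM; rewrite ?powR_ge0 ?sqrtr_ge0.
Unshelve. all: by end_near. Qed.

End growth_rates.

(** * Combination of the two limits *)

Lemma near_cvg_in_distribution (R : realType) d (T : measurableType d)
    (P : probability T R) (Y Y' : nat -> T -> R) (mu : probability R R) :
  (\forall k \near \oo, Y k =1 Y' k) -> cvg_in_distribution P Y mu ->
  cvg_in_distribution P Y' mu.
Proof.
move=> YY' hY f cf bf; apply: cvg_trans (hY f cf bf).
apply: near_eq_cvg; apply: filterS YY' => k e.
by apply: eq_integral => w _; rewrite e.
Qed.

Section slutsky.
Context {R : realType} d (T : measurableType d) (P : probability T R).
Variables (Z W : nat -> T -> R) (nu mu : probability R R) (r : nat -> R).
Hypothesis mZ : forall k, measurable_fun [set: T] (Z k).
Hypothesis mW : forall k, measurable_fun [set: T] (W k).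
Hypothesis hZ : cvg_in_distribution P Z nu.
Hypothesis hW : cvg_in_distribution P W mu.
Hypothesis hr : forall e, 0 < e -> \forall k \near \oo, 0 <= r k <= e.

Let mmin M t : measurable_fun [set: R] (fun x : R => Num.min M (t * `|x|)).
Proof.
apply: measurable_minr; first exact: measurable_cst.
by apply: measurable_funM => //; exact: measurable_cst.
Qed.

(** A K-Lipschitz [f] bounded by M changes by at most min(2 M, t |W|) once K r <= t, and the
    expectation of this bounded continuous function of W converges to a small limit. Only the
    separate laws of Z and W enter, not their joint law. *)
Lemma slutsky : cvg_in_distribution P (fun k w => Z k w + r k * W k w) nu.
Proof.
apply: lipschitz_cvg_in_distribution => [k|f K0 M0 f_lip0 fM0].
  by apply: measurable_funD => //; apply: measurable_funM.
pose K := `|K0| + 1; have K_gt0 : 0 < K by rewrite ltr_wpDl.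
pose M := `|M0| + 1; have M_gt0 : 0 < M by rewrite ltr_wpDl.
have f_lip x y : `|f x - f y| <= K * `|x - y|.
  apply: (le_trans (f_lip0 x y)); apply: ler_wpM2r => //.
  by rewrite (le_trans (ler_norm K0))// lerDl.
have fM x : `|f x| <= M.
  by rewrite (le_trans (fM0 x))// (le_trans (ler_norm M0))// lerDl.
have cf := lipschitz_continuous f_lip0.
have mf : measurable_fun [set: R] f by exact: continuous_measurable_fun.
apply/cvgrPdist_le => e e0; pose e4 := e / 4.
have e40 : 0 < e4 by rewrite divr_gt0.
have M2 : 0 <= 2 * M by rewrite mulr_ge0// ltW.
have [t t0 ht] := @Ex_min_cvg0 _ _ _ mu id (2 * M)
  (@measurable_id _ _ _) M2 e4 e40.
pose h (x : R) := Num.min (2 * M) (t * `|x|).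
have h0 x : 0 <= h x by rewrite le_min M2 mulr_ge0// ltW.
have hM x : `|h x| <= 2 * M by rewrite ger0_norm ?ge_min ?lexx.
have ch : continuous h.
  by apply: (@lipschitz_continuous _ h t) => x y; apply: min_lipschitz; exact: ltW.
have L1h k : L1 P (fun w => h (W k w)).
  by apply: (@L1_bounded _ _ _ _ _ (2 * M)) => //; exact: (measurableT_comp (mmin _ _)).
near=> k.
have rk : 0 <= r k <= t / K by near: k; apply: hr; rewrite divr_gt0.
have /andP[r0 rt] := rk.
have Zk : `|\int[nu]_x f x - \int[P]_w f (Z k w)| <= e4.
  near: k; move/cvgrPdist_le: (cvg_in_distribution_Ex hZ cf fM); exact.
have Wk : `|\int[mu]_x h x - \int[P]_w h (W k w)| <= e4.
  near: k; move/cvgrPdist_le: (cvg_in_distribution_Ex hW ch hM); exact.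
have L1f A : measurable_fun [set: T] A -> L1 P (fun w => f (A w)).
  by move=> mA; apply: (@L1_bounded _ _ _ _ _ M) => //; exact: (measurableT_comp mf).
have D : `|\int[P]_w f (Z k w + r k * W k w) - \int[P]_w f (Z k w)| <=
    \int[P]_w h (W k w).
  apply: Ex_dist_le => //; [|exact: L1f|].
    by apply: L1f; apply: measurable_funD => //; apply: measurable_funM.
  move=> w; rewrite le_min; apply/andP; split.
    apply: (le_trans (ler_normB _ _)).
    by have := fM (Z k w + r k * W k w); have := fM (Z k w); lra.
  apply: (le_trans (f_lip _ _)).
  rewrite [X in `|X|](_ : _ = r k * W k w); last by ring.
  rewrite normrM (ger0_norm r0) mulrA; apply: ler_wpM2r => //.
  by rewrite mulrC -ler_pdivlMr.
have hmu : \int[mu]_x h x <= e4 by exact: ht.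
have := ler_norm (- (\int[mu]_x h x - \int[P]_w h (W k w))); rewrite normrN => hh.
rewrite distrC (le_trans (ler_distD (\int[P]_w f (Z k w)) _ _))//.
rewrite [X in _ + X]distrC.
have e4E : e4 * 4 = e by rewrite /e4; field.
by lra.
Unshelve. all: by end_near. Qed.

End slutsky.

(** * Decomposition of the squared norm *)

Section walk_decomposition.
Context {R : realType} d (T : measurableType d) (P : probability T R)
  (X : nat -> nat -> {RV P >-> R}).

Let Y (ij : nat * nat) := X ij.1 ij.2.

Definition grid (n k : nat) : seq (nat * nat) :=
  [seq (i, j) | i <- iota 0 n, j <- iota 0 k].

Lemma grid_uniq n k : uniq (grid n k).
Proof. by apply: allpairs_uniq; rewrite ?iota_uniq// => -[? ?] [? ?]. Qed.

Lemma size_grid n k : size (grid n k) = (n * k)%N.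
Proof. by rewrite size_allpairs !size_iota. Qed.

Lemma enorm_walk_sqr (n k : nat) (w : T) : (0 < n)%N -> (0 < k)%N ->
  enorm (walk (fun i j => X i j) k n w) ^+ 2 - n%:R =
  k%:R^-1 * (\sum_(ij <- grid n k) (Y ij w ^+ 2 - 1)) +
  n%:R / k%:R * Num.sqrt (2 * k%:R) * column_sum Y k n k w.
Proof.
move=> n0 k0; have n0' : 0 < n%:R :> R by rewrite ltr0n.
have k0' : 0 < k%:R :> R by rewrite ltr0n.
have s0 : Num.sqrt (2 * k%:R) != 0 :> R by rewrite gt_eqF// sqrtr_gt0 mulr_gt0.
rewrite /enorm sqr_sqrtr; last by apply: sumr_ge0 => j _; exact: sqr_ge0.
have -> : \sum_(ij <- grid n k) (Y ij w ^+ 2 - 1) =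
    \sum_(j < k) \sum_(i < n) Y (col j i) w ^+ 2 - n%:R * k%:R.
  rewrite big_allpairs exchange_big /=.
  have iotaE m (F : nat -> R) : \sum_(i <- iota 0 m) F i = \sum_(i < m) F i.
    by rewrite -(big_mkord xpredT F) /index_iota subn0.
  rewrite iotaE (eq_bigr (fun j : 'I_k => \sum_(i < n) Y (col j i) w ^+ 2 - n%:R)).
    by rewrite sumrB sumr_const card_ord mulr_natr.
  by move=> j _; rewrite iotaE sumrB sumr_const card_ord.
have E (j : 'I_k) : walk (fun i j => X i j) k n w ord0 j ^+ 2 =
    k%:R^-1 * (\sum_(i < n) Y (col j i) w ^+ 2) +
    n%:R / k%:R * Num.sqrt (2 * k%:R) * scaled_column Y k n j w.
  have -> : walk (fun i j => X i j) k n w ord0 j =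
      psum Y (col j) id n w / Num.sqrt k%:R.
    rewrite /walk summxE /psum mulr_suml; apply: eq_bigr => i _.
    by rewrite /walk_step mxE.
  rewrite exprMn exprVn sqr_sqrtr// psum_sqr /scaled_column /column_form.
  by field; rewrite s0 !gt_eqF.
under eq_bigr do rewrite E.
rewrite big_split /= -mulr_sumr -mulr_sumr -/(column_sum Y k n k w).
by field; rewrite gt_eqF.
Qed.

End walk_decomposition.

Lemma expectation_L2 (R : realType) d (T : measurableType d)
    (P : probability T R) (xi : {RV P >-> R}) (m v : R) :
  'E_P[xi]%E = m%:E -> 'E_P[(fun w => (xi w ^+ 2)%R)]%E = v%:E ->
  [/\ L2 P xi, \int[P]_w xi w = m & \int[P]_w (xi w ^+ 2) = v].
Proof.
rewrite unlock => m0 v0; split.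
- split => //; apply/integrableP; split.
    by apply/measurable_EFinP; exact: measurable_funX.
  rewrite (_ : (\int[P]_w _ = v%:E)%E) ?ltry// -v0; apply: eq_integral => w _.
  by rewrite /= ger0_norm ?sqr_ge0.
- by rewrite /Rintegral m0.
- by rewrite /Rintegral v0.
Qed.

Section normalization.
Context {R : realType} (alpha : R) (L : R -> R).
Hypothesis hL : slowly_varying L.

Definition normalizer (m : nat) : R := m%:R `^ alpha^-1 * L m%:R.

Lemma normalizer_gt0 m : (0 < m)%N -> 0 < normalizer m.
Proof.
move=> m0; have m0' : 0 < m%:R :> R by rewrite ltr0n.
by rewrite mulr_gt0 ?powR_gt0//; exact: hL.1.
Qed.

Lemma normalizer_double :
  normalizer (2 ^ k.+1)%N / normalizer (2 ^ k)%N @[k --> \oo] --> 2 `^ alpha^-1.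
Proof.
have pow2_cvg : (2 ^ k)%:R @[k --> \oo] --> (+oo : set_system R).
  apply/cvgryPge => A; near=> k.
  have : A <= k%:R by near: k; exact: nbhs_infty_ger.
  by move=> /le_trans; apply; rewrite ler_nat ltnW// ltn_expl.
have h : L (2 * (2 ^ k)%:R) / L (2 ^ k)%:R @[k --> \oo] --> (1 : R).
  have two0 : 0 < 2 :> R by [].
  exact: (cvg_comp _ _ pow2_cvg (hL.2 _ two0)).
rewrite -[X in _ --> X]mulr1.
apply: cvg_trans (cvgM (cvg_cst (2 `^ alpha^-1 : R)) h).
apply: near_eq_cvg; near=> k.
have k0 : 0 < (2 ^ k)%:R :> R by rewrite ltr0n expn_gt0.
have L0 := hL.1 _ k0.
have p0 : 0 < (2 ^ k)%:R `^ alpha^-1 by rewrite powR_gt0.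
rewrite /normalizer expnS natrM powRM//.
by rewrite [_ \* _]/GRing.mul_fun /=; field; rewrite !gt_eqF.
Unshelve. all: by end_near. Qed.

End normalization.

Section grid_sums.
Context {R : realType} d0 (T0 : measurableType d0) (P0 : probability T0 R)
  (xi : {RV P0 >-> R}).
Context d (T : measurableType d) (P : probability T R)
  (X : nat * nat -> {RV P >-> R}).
Hypothesis hX : independent_copies xi X.
Context d' (T' : measurableType d') (P' : probability T' R)
  (Y : nat -> {RV P' >-> R}).
Hypothesis hY : independent_copies xi Y.
Variables (g : R -> R) (b : nat -> R) (mu : probability R R).
Hypothesis mg : measurable_fun [set: R] g.
Hypothesis hS : cvg_in_distribution P' (fun m w => psum Y id g m w / b m) mu.
Variable n : nat -> nat.
Hypothesis n_gt0 : forall k, (0 < k)%N -> (0 < n k)%N.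

Definition grid_sum (k : nat) (w : T) : R :=
  (\sum_(ij <- grid (n k) k) g (X ij w)) / b (n k * k).

Lemma measurable_grid_sum k : measurable_fun [set: T] (grid_sum k).
Proof.
apply: measurable_funM => //; apply: measurable_sum => ij.
exact: (measurableT_comp mg).
Qed.

(** The array and the sequence share only the law of their entries, so the limit is transferred
    through equality of the integrals of [f], along m = n k * k. *)
Lemma grid_sum_cvg : cvg_in_distribution P grid_sum mu.
Proof.
move=> f cf [M fM].
have mf : measurable_fun [set: R] f by exact: continuous_measurable_fun.
have m_cvg : (n k * k)%N @[k --> \oo] --> \oo.
  apply/cvgnyPge => A; near=> k; apply: (@leq_trans k).
    by near: k; exact: nbhs_infty_ge.
  by rewrite leq_pmull// n_gt0//; near: k; exact: nbhs_infty_gt.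
apply: cvg_trans (cvg_comp _ _ m_cvg (hS cf (ex_intro _ M fM))).
apply: near_eq_cvg; apply: nearW => k /=; set m := (n k * k)%N.
have mS : measurable_fun [set: T'] (fun w => \sum_(i <- iota 0 m) g (Y i w)).
  by apply: measurable_sum => i; exact: (measurableT_comp mg).
have mG : measurable_fun [set: T] (fun w => \sum_(ij <- grid (n k) k) g (X ij w)).
  by apply: measurable_sum => i; exact: (measurableT_comp mg).
have mfb : measurable_fun [set: R] (fun x => f (x / b m)).
  by apply: (measurableT_comp mf); exact: measurable_funM.
have eq_law_sums : same_law P P' (fun w => \sum_(ij <- grid (n k) k) g (X ij w))
    (fun w => \sum_(i <- iota 0 m) g (Y i w)).
  apply: same_law_sum mg hX.1 hY.1 _ (grid_uniq _ _) (iota_uniq _ _) _.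
    by move=> i i' U mU; have := hX.2 i U mU; rewrite -(hY.2 i' U mU).
  by rewrite size_grid size_iota.
have L1G : L1 P (fun w => f (grid_sum k w)).
  by apply: (@L1_bounded _ _ _ _ _ M) => //; exact: (measurableT_comp mfb mG).
have L1S : L1 P' (fun w => f ((\sum_(i <- iota 0 m) g (Y i w)) / b m)).
  by apply: (@L1_bounded _ _ _ _ _ M) => //; exact: (measurableT_comp mfb mS).
have psumE w : psum Y id g m w = \sum_(i <- iota 0 m) g (Y i w).
  by rewrite /psum -(big_mkord xpredT (fun i => g (Y i w))) /index_iota subn0.
under eq_integral do rewrite psumE.
rewrite (EFin_Ex L1S) (EFin_Ex L1G).
congr EFin; apply/esym.
exact: (same_law_integral mG mS eq_law_sums mfb (fun x => fM (x / b m))).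
Unshelve. all: by end_near. Qed.

End grid_sums.

Theorem theorem3p2 (R : realType)
    (* the variable xi *)
    (d0 : measure_display) (T0 : measurableType d0) (P0 : probability T0 R)
    (xi : {RV P0 >-> R})
    (hmean : 'E_P0[xi]%E = 0%E)
    (hvar : 'E_P0[(fun w => (xi w ^+ 2)%R)]%E = 1%E)
    (* the array of independent copies of xi that drives the walks *)
    (d1 : measure_display) (T1 : measurableType d1) (P1 : probability T1 R)
    (xi2 : nat -> nat -> {RV P1 >-> R})
    (hxi2 : independent_copies xi (fun ij : nat * nat => xi2 ij.1 ij.2))
    (* the stable limit of the sums of squares *)
    (alpha : R) (halpha : 1 < alpha < 2)
    (L : R -> R) (hL : slowly_varying L)
    (d2 : measure_display) (T2 : measurableType d2) (P2 : probability T2 R)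
    (zeta : {RV P2 >-> R})
    (hzeta_int : P2.-integrable [set: T2] (EFin \o zeta))
    (hzeta_mean : 'E_P2[zeta]%E = 0%E)
    (hzeta_stable : stable_law alpha (distribution P2 zeta))
    (hzeta_pos : spectrally_positive (distribution P2 zeta))
    (d3 : measure_display) (T3 : measurableType d3) (P3 : probability T3 R)
    (xi1 : nat -> {RV P3 >-> R})
    (hxi1 : independent_copies xi xi1)
    (hcvg : cvg_in_distribution P3
      (fun m w => (\sum_(i < m) xi1 i w ^+ 2 - m%:R) /
                  (m%:R `^ alpha^-1 * L m%:R))
      (distribution P2 zeta))
    (n : nat -> nat)
    (hn_pos : forall d, (0 < d)%N -> (0 < n d)%N)
    (hn : n d @[d --> \oo] --> \oo) :
  ((exists2 delta : R, 0 < delta &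
      \forall d \near \oo,
        d%:R `^ ((2 - alpha) / (2 * alpha - 2) + delta) < (n d)%:R) ->
   cvg_in_distribution P1
     (fun d w => (enorm (walk (fun i j => xi2 i j) d (n d) w) ^+ 2 - (n d)%:R) /
                 Num.sqrt (2 * (n d)%:R ^+ 2 / d%:R))
     (std_normal R))
  /\
  ((exists2 delta : R, 0 < delta &
      \forall d \near \oo,
        (n d)%:R < d%:R `^ ((2 - alpha) / (2 * alpha - 2) - delta)) ->
   cvg_in_distribution P1
     (fun d w => (enorm (walk (fun i j => xi2 i j) d (n d) w) ^+ 2 - (n d)%:R) /
                 (d%:R^-1 * ((n d)%:R * d%:R) `^ alpha^-1 *
                  L ((n d)%:R * d%:R)))
     (distribution P2 zeta)).

Proof.
have [sxi xi0 xi1_sqr] := expectation_L2 hmean hvar.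
pose b := normalizer alpha L; pose X ij := xi2 ij.1 ij.2.
pose g (x : R) := x ^+ 2 - 1.
have mg : measurable_fun [set: R] g.
  by apply: measurable_funB => //; exact: measurable_funX.
have b_gt0 m : (0 < m)%N -> 0 < b m by exact: normalizer_gt0.
have hS : cvg_in_distribution P3 (fun m w => psum xi1 id g m w / b m)
    (distribution P2 zeta).
  apply: near_cvg_in_distribution hcvg; apply: nearW => m w /=.
  by rewrite /psum sumrB sumr_const card_ord.
have mgxi : measurable_fun [set: T0] (fun w => g (xi w)).
  exact: (measurableT_comp mg).
(* Expressed on the space of [xi], the squared modulus visibly does not depend on [i]. *)
have qE i t : sqr_cf P3 (fun w => g (xi1 i w)) t = sqr_cf P0 (fun w => g (xi w)) t.
  have mcg : measurable_fun [set: R] (fun x => cos (t * g x)).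
    exact: measurable_cos_comp.
  have msg : measurable_fun [set: R] (fun x => sin (t * g x)).
    exact: measurable_sin_comp.
  rewrite /sqr_cf.
  have [|_ ->] := @eq_law_transfer _ _ _ P3 _ _ P0 (xi1 i) xi _ (hxi1.2 i) mcg.
    apply: (@L1_bounded _ _ _ _ _ 1) => [|w]; last exact: cos_max.
    exact: measurable_cos_comp.
  have [|_ ->] // := @eq_law_transfer _ _ _ P3 _ _ P0 (xi1 i) xi _ (hxi1.2 i) msg.
  apply: (@L1_bounded _ _ _ _ _ 1) => [|w]; last exact: sin_max.
  exact: measurable_sin_comp.
have [C C0 [N0 b_mono]] :=
  normalizing_almost_monotone hxi1.1 mg qE b_gt0 hS hzeta_stable.1.
(* The admissible error in the growth exponent depends on [delta], so the bounds are instantiated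
   separately in each regime. *)
have growth delta (delta0 : 0 < delta) :=
  let: And3 eta0 eta_lt _ := eta_bounds halpha delta0 in
  normalizing_growth b_gt0 C0 b_mono (@normalizer_double _ alpha _ hL)
    (introT andP (conj eta0 eta_lt)).
pose W := grid_sum X g b n.
have mW k : measurable_fun [set: T1] (W k) by exact: measurable_grid_sum.
have hW : cvg_in_distribution P1 W (distribution P2 zeta).
  exact: (grid_sum_cvg hxi2 hxi1 mg hS hn_pos).
pose Z k := column_sum X k (n k) k.
have mZ k : measurable_fun [set: T1] (Z k).
  exact/L2_measurable/(L2_column_sum sxi hxi2).
have hZ : cvg_in_distribution P1 Z (std_normal R).
  apply: lipschitz_cvg_in_distribution => // f K M.
  exact: (column_sum_clt sxi xi0 xi1_sqr hxi2 hn_pos hn).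
have split_walk d w : (0 < d)%N ->
    enorm (walk (fun i j => xi2 i j) d (n d) w) ^+ 2 - (n d)%:R =
    d%:R^-1 * b (n d * d)%N * W d w +
    (n d)%:R / d%:R * Num.sqrt (2 * d%:R) * Z d w.
  move=> dpos; have ndpos := hn_pos d dpos.
  rewrite enorm_walk_sqr//; congr (_ + _); rewrite -mulrA; congr (_ * _).
  by rewrite /W /grid_sum mulrCA divff ?mulr1// gt_eqF// b_gt0// muln_gt0 ndpos.
split=> -[delta delta0 hnd].
(* Divided by n / d * sqrt (2 d), which is sqrt (2 n^2 / d), the walk becomes Z plus a vanishing
   multiple of W. *)
- apply: near_cvg_in_distribution (slutsky (r := fun d =>
    b (n d * d)%N / ((n d)%:R * Num.sqrt (2 * d%:R))) mZ mW hZ hW _); last first.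
    move=> e e0.
    have := above_threshold halpha delta0 hn_pos (growth _ delta0) e0 hnd.
    near_simpl => ab; near=> d.
    have dpos : (0 < d)%N by near: d; exact: nbhs_infty_gt.
    have ndpos := hn_pos d dpos.
    have den0 : 0 < (n d)%:R * Num.sqrt (2 * d%:R) :> R.
      by rewrite mulr_gt0 ?ltr0n// sqrtr_gt0 mulr_gt0// ltr0n.
    have bpos : 0 < b (n d * d)%N by rewrite b_gt0// muln_gt0 ndpos.
    rewrite divr_ge0 ?(ltW bpos) ?(ltW den0)//= ler_pdivrMr//.
    by near: d.
  near=> d => w.
  have dpos : (0 < d)%N by near: d; exact: nbhs_infty_gt.
  have ndpos := hn_pos d dpos.
  have d0' : 0 < d%:R :> R by rewrite ltr0n.
  have n0' : 0 < (n d)%:R :> R by rewrite ltr0n.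
  have s0 : 0 < Num.sqrt (2 * d%:R) :> R by rewrite sqrtr_gt0 mulr_gt0.
  have -> : Num.sqrt (2 * (n d)%:R ^+ 2 / d%:R) =
      (n d)%:R / d%:R * Num.sqrt (2 * d%:R) :> R.
    rewrite (_ : _ / _ = ((n d)%:R / d%:R) ^+ 2 * (2 * d%:R)).
      by rewrite (sqrtrM _ (sqr_ge0 _)) sqrtr_sqr ger0_norm// divr_ge0.
    by field; rewrite gt_eqF.
  by rewrite split_walk//; field; rewrite !gt_eqF.
(* The roles are exchanged: divided by b(n d) / d, the walk becomes W plus the inverse ratio times
   Z. *)
- apply: near_cvg_in_distribution (slutsky (r := fun d =>
    (n d)%:R * Num.sqrt (2 * d%:R) / b (n d * d)%N) mW mZ hW hZ _); last first.
    move=> e e0.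
    have := below_threshold halpha delta0 hn_pos (growth _ delta0) e0 hnd.
    near_simpl => be; near=> d.
    have dpos : (0 < d)%N by near: d; exact: nbhs_infty_gt.
    have ndpos := hn_pos d dpos.
    have bpos : 0 < b (n d * d)%N by rewrite b_gt0// muln_gt0 ndpos.
    have num0 : 0 <= (n d)%:R * Num.sqrt (2 * d%:R) :> R.
      by rewrite mulr_ge0// sqrtr_ge0.
    rewrite (divr_ge0 num0 (ltW bpos)) /= ler_pdivrMr//.
    by near: d.
  near=> d => w.
  have dpos : (0 < d)%N by near: d; exact: nbhs_infty_gt.
  have ndpos := hn_pos d dpos.
  have d0' : 0 < d%:R :> R by rewrite ltr0n.
  have bpos : 0 < b (n d * d)%N by rewrite b_gt0// muln_gt0 ndpos.
  rewrite split_walk//.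
  have -> : d%:R^-1 * ((n d)%:R * d%:R) `^ alpha^-1 * L ((n d)%:R * d%:R) =
      d%:R^-1 * b (n d * d)%N by rewrite /b /normalizer natrM mulrA.
  by field; rewrite !gt_eqF.
Unshelve. all: by end_near. Qed.
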